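(* Let $\mu \in \mathcal{T}_{-}$. Assume that $$\lim_{n \to \infty} \int_{\mathbb{T}} \left | \phi_n^* (s)\, \tilde \phi_n (s) - \frac{1}{\overline{w (s)}} \right | \frac{d|s|}{2\pi} = 0$$ and that $\sum_{n}|F_n|^2<\infty$. If $(n_k)$ is a lacunary sequence, then for almost every $s \in \mathbb{T}$ we have $$\lim_{k \to \infty} \left( \phi_{n_k}^* (s)\, \tilde\phi_{n_k} (s)\right)^2 = \overline{w (s)^{-2}} .$$
   Context: $\mathbb{T}$ is the unit circle in $\mathbb{C}$, $\mathbb{N}_0=\{0,1,2,\dots\}$. For a function $g$ of a complex variable, $g^*(z):=\overline{g(\overline{z}^{-1})}$ (on $\mathbb{T}$ this is complex conjugation). A complex probability measure on $\mathbb{T}$ is a complex Borel measure $\mu$ with $\int_{\mathbb{T}}d\mu=1$. For polynomials $f,g$ put $\langle f,g\rangle_\mu:=\int_{\mathbb{T}} f g^*\,d\mu$. A polynomial $\Phi$ is left (right) orthogonal if $\langle \Phi,p\rangle_\mu=0$ (respectively $\langle p,\Phi\rangle_\mu=0$) for all polynomials $p$ of degree strictly less than that of $\Phi$. $\mathcal{T}$ is the class of complex probability measures $\mu$ on $\mathbb{T}$ such that for each $n\in\mathbb{N}_0$ there exist a unique left orthogonal monic polynomial $\Phi_n$ and a unique right orthogonal monic polynomial $\tilde\Phi_n$ of degree $n$. For $\mu\in\mathcal{T}$ there are unique complex numbers $F_{n+1},\tilde F_{n+1}$ ($n\in\mathbb{N}_0$) with $\Phi_{n+1}-z\Phi_n=\overline{F_{n+1}}z^n\tilde\Phi_n^*$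 and $\tilde\Phi_{n+1}-z\tilde\Phi_n=\overline{\tilde F_{n+1}}z^n\Phi_n^*$. $\mathcal{T}_-$ is the class of $\mu\in\mathcal{T}$ with $F_n=-\tilde F_n$ for all $n\ge1$. For $\mu\in\mathcal{T}_-$ one has $\langle\Phi_n,\tilde\Phi_n\rangle_\mu=\prod_{j=1}^n(1+|F_j|^2)>0$, and the normalized polynomials are $\phi_n:=\Phi_n/\sqrt{\langle\Phi_n,\tilde\Phi_n\rangle_\mu}$, $\tilde\phi_n:=\tilde\Phi_n/\sqrt{\langle\Phi_n,\tilde\Phi_n\rangle_\mu}$. $d|s|$ is arclength measure on $\mathbb{T}$, and $\frac{w}{2\pi}$ is the Radon-Nikodym derivative of (the absolutely continuous part of) $\mu$ with respect to arclength. (For $\mu\in\mathcal{T}_-$ one has $|w|\ge1$ almost everywhere.) A monotone increasing sequence $(n_k)_{k\in\mathbb{N}_0}$ of nonnegative integers is called lacunary if there is $L>1$ such that $n_{k+1}\ge L n_k$ for all $k\in\mathbb{N}_0$. *)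

(* Defs.v *)
From HB Require Import structures.
From mathcomp Require Import all_boot all_order all_algebra.
From mathcomp Require Import all_classical all_reals all_analysis.
From mathcomp Require Import measurable_realfun complex.

Set Implicit Arguments.
Unset Strict Implicit.
Unset Printing Implicit Defensive.

Import Order.TTheory GRing.Theory Num.Theory.
Import numFieldNormedType.Exports.

Local Open Scope classical_set_scope.
Local Open Scope ring_scope.
Local Open Scope complex_scope.

Set Warnings "-redundant-canonical-projection".
HB.instance Definition _ (R : rcfType) := NormedModule.copy R[i] R[i]^o.
Set Warnings "redundant-canonical-projection".

(* The modulus as an element of R: the norm `|z| of R[i] lives in R[i]. *)
Notation cabs := ComplexField.Normc.normc.

(* [circle R] carries the Borel sigma-algebra of the topology induced by R[i]. *)
Definition unit_circle (R : realType) : set R[i] := [set z | cabs z = 1].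

Definition circle_top (R : realType) : Type := set_type (@unit_circle R).

Lemma unit_circle1 (R : realType) : (1 : R[i]) \in @unit_circle R.
Proof. by apply/mem_set; exact: ComplexField.Normc.normc1. Qed.

Set Warnings "-redundant-canonical-projection".
HB.instance Definition _ (R : realType) :=
  Topological.copy (circle_top R) (set_type (@unit_circle R)).
HB.instance Definition _ (R : realType) :=
  isPointed.Build (circle_top R) (exist _ 1 (@unit_circle1 R)).

Definition circle (R : realType) : Type :=
  g_sigma_algebraType (@open (circle_top R)).

HB.instance Definition _ (R : realType) :=
  Measurable.copy (circle R) (g_sigma_algebraType (@open (circle_top R))).
Set Warnings "redundant-canonical-projection".

Definition cval (R : realType) (s : circle R) : R[i] := set_val s.

Section arclength.
Variable R : realType.

Lemma cis_unit (t : R) : (cos t +i* sin t) \in @unit_circle R.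
Proof. by apply/mem_set; rewrite /unit_circle /= cos2Dsin2 sqrtr1. Qed.

Definition cis (t : R) : circle R := exist _ (cos t +i* sin t) (cis_unit t).

Lemma measurable_cis : measurable_fun [set: R] cis.
Proof.
have cc : continuous (fun t : R => (cos t +i* sin t : R[i])).
  move=> t; apply/cvgrPdist_le => /= -[e e'].
  rewrite ltcE /= => /andP[/eqP -> e0].
  have a2 : 0 < e / 2 by rewrite divr_gt0.
  have /cvgrPdist_le/(_ _ a2) c1 := @continuous_cos R t.
  have /cvgrPdist_le/(_ _ a2) c2 := @continuous_sin R t.
  near=> u.
  have -> : (cos t +i* sin t) - (cos u +i* sin u) =
      (cos t - cos u)%:C + 'i%C * (sin t - sin u)%:C :> R[i].
    by rewrite [LHS]complexE.
  rewrite (le_trans (ler_normD _ _))// normrM normc_def/= expr0n/= addr0.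
  rewrite [X in _ + X * _]normc_def/= expr0n/= expr1n add0r sqrtr1 mul1r.
  rewrite normc_def/= expr0n/= addr0 !sqrtr_sqr -rmorphD/= lecR.
  rewrite [leRHS]splitr lerD//; near: u; [exact: c1|exact: c2].
have cc' : continuous (cis : R -> circle_top R).
  by apply: continuous_comp_initial; exact: cc.
apply: (@measurability _ _ _ (circle R) _ _ (@open (circle_top R))) => //.
move=> _ [B oB <-]; rewrite setTI; apply: open_measurable.
by move/continuousP : cc'; exact.
Unshelve. all: by end_near.
Qed.

HB.instance Definition _ :=
  isMeasurableFun.Build _ _ R (circle R) cis measurable_cis.

(* Arclength d|s|, as the image of Lebesgue measure on [0, 2 pi[ under
   t |-> e^{it}. *)
Definition arclength : set (circle R) -> \bar R :=
  pushforward (mrestr (@lebesgue_measure R) (measurable_itv `[0, 2 * pi[)) cis.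

Let arclength0 : arclength set0 = 0%E.
Proof. by have := measurable_cis => ?; exact: measure0. Qed.

Let arclength_ge0 A : (0 <= arclength A)%E.
Proof. by have := measurable_cis => ?; exact: measure_ge0. Qed.

Let arclength_sigma_additive : semi_sigma_additive arclength.
Proof. by have := measurable_cis => ?; exact: measure_semi_sigma_additive. Qed.

HB.instance Definition _ := isMeasure.Build _ _ _ arclength
  arclength0 arclength_ge0 arclength_sigma_additive.

End arclength.
Arguments arclength R : clear implicits.

(* A complex measure is given by its real and imaginary parts, which are finite
   signed measures. *)
Record complex_measure d (T : measurableType d) (R : realType) :=
  ComplexMeasure { re_part : {charge set T -> \bar R} ;
                   im_part : {charge set T -> \bar R} }.

Section complex_measure.
Context d (T : measurableType d) (R : realType).
Implicit Types (nu : {charge set T -> \bar R}) (mu : complex_measure T R).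
Implicit Types (lambda : {measure set T -> \bar R}).

Definition cmeasure mu (A : set T) : R[i] :=
  fine (re_part mu A) +i* fine (im_part mu A).

Definition hahn_pos nu : set T := sval (cid (Hahn_decomposition nu)).

Definition hahn_neg nu : set T :=
  sval (cid (svalP (cid (Hahn_decomposition nu)))).

Lemma hahn_pos_neg nu : hahn_decomposition nu (hahn_pos nu) (hahn_neg nu).
Proof. exact: (svalP (cid (svalP (cid (Hahn_decomposition nu))))). Qed.

(* The integral against the Jordan decomposition of nu. *)
Definition charge_integral nu (f : T -> R) : R :=
  \int[jordan_pos (hahn_pos_neg nu)]_x f x -
  \int[jordan_neg (hahn_pos_neg nu)]_x f x.

Definition cintegral mu (f : T -> R[i]) : R[i] :=
  (charge_integral (re_part mu) (fun x => complex.Re (f x)) -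
   charge_integral (im_part mu) (fun x => complex.Im (f x))) +i*
  (charge_integral (re_part mu) (fun x => complex.Im (f x)) +
   charge_integral (im_part mu) (fun x => complex.Re (f x))).

Definition complex_probability mu : Prop := cintegral mu (fun=> 1) = 1.

Definition abs_continuous mu lambda : Prop :=
  re_part mu `<< lambda /\ im_part mu `<< lambda.

Definition singular mu lambda : Prop :=
  exists N, [/\ measurable N, lambda N = 0%E &
    forall A, measurable A -> A `<=` ~` N -> cmeasure mu A = 0].

Definition lebesgue_decomposition mu lambda mu_ac mu_s : Prop :=
  [/\ forall A, measurable A ->
        cmeasure mu A = cmeasure mu_ac A + cmeasure mu_s A,
      abs_continuous mu_ac lambda & singular mu_s lambda].

Definition has_density mu lambda (g : T -> R[i]) : Prop :=
  [/\ lambda.-integrable setT (fun x => (complex.Re (g x))%:E),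
      lambda.-integrable setT (fun x => (complex.Im (g x))%:E) &
      forall A, measurable A -> cmeasure mu A =
        (\int[lambda]_(x in A) complex.Re (g x)) +i*
        (\int[lambda]_(x in A) complex.Im (g x))].

Definition ac_density mu lambda (g : T -> R[i]) : Prop :=
  exists mu_ac mu_s,
    lebesgue_decomposition mu lambda mu_ac mu_s /\ has_density mu_ac lambda g.

End complex_measure.

Notation circle_measure R := (complex_measure (circle R) R).

(* The operation g |-> g^*. *)
Definition star (R : realType) (g : R[i] -> R[i]) (z : R[i]) : R[i] :=
  (g ((z^*%C)^-1))^*%C.

Section orthogonal_polynomials.
Context (R : realType) (mu : circle_measure R).
Implicit Types (p q : {poly R[i]}) (n : nat).

Definition pairing p q : R[i] :=
  cintegral mu (fun s => p.[cval s] * star (horner q) (cval s)).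

(* [size p < size q] is deg p < deg q. *)
Definition left_orthogonal q : Prop :=
  forall p, (size p < size q)%N -> pairing q p = 0.

Definition right_orthogonal q : Prop :=
  forall p, (size p < size q)%N -> pairing p q = 0.

Definition left_monic n q : Prop :=
  [/\ q \is monic, size q = n.+1 & left_orthogonal q].

Definition right_monic n q : Prop :=
  [/\ q \is monic, size q = n.+1 & right_orthogonal q].

Definition class_T : Prop :=
  complex_probability mu /\
  forall n, (exists! q, left_monic n q) /\ (exists! q, right_monic n q).

(* [Phi], [tPhi], [Fcoef] and [tFcoef] are characterized by the properties
   below when mu is in class_T; otherwise they may take default values. *)
Definition Phi n : {poly R[i]} := xget 0 [set q | left_monic n q].

Definition tPhi n : {poly R[i]} := xget 0 [set q | right_monic n q].

(* The recurrences are identities between polynomials; z = 0 is excluded because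
   [star] is only meaningful away from 0. The index 0 is unused. *)
Definition Fcoef n : R[i] :=
  if n is m.+1 then
    xget 0 [set c : R[i] | forall z : R[i], z != 0 ->
      (Phi m.+1).[z] - z * (Phi m).[z] =
      c^*%C * z ^+ m * star (horner (tPhi m)) z]
  else 0.

Definition tFcoef n : R[i] :=
  if n is m.+1 then
    xget 0 [set c : R[i] | forall z : R[i], z != 0 ->
      (tPhi m.+1).[z] - z * (tPhi m).[z] =
      c^*%C * z ^+ m * star (horner (Phi m)) z]
  else 0.

Definition class_Tminus : Prop :=
  class_T /\ forall n, (1 <= n)%N -> Fcoef n = - tFcoef n.

(* [sqrtC] is the nonnegative square root on nonnegative reals. *)
Definition phi n : {poly R[i]} :=
  (sqrtC (pairing (Phi n) (tPhi n)))^-1 *: Phi n.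

Definition tphi n : {poly R[i]} :=
  (sqrtC (pairing (Phi n) (tPhi n)))^-1 *: tPhi n.

End orthogonal_polynomials.

(* The sequence is strictly increasing: a constant sequence 0 would satisfy the
   ratio condition for every L. *)
Definition lacunary (R : realType) (nk : nat -> nat) : Prop :=
  {homo nk : i j / (i < j)%N} /\
  exists2 L : R, 1 < L & forall k, L * (nk k)%:R <= (nk k.+1)%:R.

(* Main.v *)
(* On the circle put u_n = z^n conj(Phi_n) and w_n = z^n conj(tPhi_n), divided
   by the square root of <Phi_n, tPhi_n>. The Szego recurrences say that
   (u_n, w_n) evolves by SU(2) matrices built from F, with
   |u_n|^2 + |w_n|^2 = 2, and phi_n^* tphi_n = u_n conj(w_n). For m >= n,
   u_m = A u_n + B conj(w_n) and w_m = A w_n - B conj(u_n), where all frequencies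
   of B exceed n. The Fejer mean of order n at s annihilates B, hence maps
   (u_m, w_m) approximately to a multiple of (u_n(s), w_n(s)), with an error
   controlled by the local oscillation of (u_n, w_n) at scale 1/n. Eliminating
   the multiple through |u_n|^2 + |w_n|^2 = 2 recovers u_n conj(w_n) from Fejer
   means of (u_m, w_m). Since F is square summable, (u_m, w_m) has an almost
   everywhere limit along a subsequence, and the oscillation tends to 0 almost
   everywhere along lacunary sequences, because its mean is a sum of j/n times
   squared Fourier coefficients. With m -> oo first and then n = n_k -> oo, the
   theorem of Fejer and Lebesgue gives almost everywhere convergence of
   u_{n_k} conj(w_{n_k}); by Fatou's lemma and the L^1 hypothesis the limit is
   1 / conj(w). *)
Require Import Defs.
From mathcomp Require Import all_boot all_order all_algebra.
From mathcomp Require Import cyclic separable cyclotomic.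
From mathcomp Require Import all_classical all_reals all_analysis.
From mathcomp Require Import measurable_realfun complex.
From mathcomp Require Import ring lra zify.
Set Implicit Arguments.
Unset Strict Implicit.
Unset Printing Implicit Defensive.
Import Order.TTheory GRing.Theory Num.Theory.
Import numFieldNormedType.Exports.
Local Open Scope classical_set_scope.
Local Open Scope ring_scope.
Local Open Scope complex_scope.

(** * Discrete Fejer means *)

(** The multiple is the Fejer mean of A, of unknown phase and size. In u_n conj(w_n) it enters only
    through its squared modulus, which can be eliminated; this singles out the product. The Fejer
    kernel of order n serves three purposes: its degree is below n, so B disappears; it is
    nonnegative with mean one, so a squared mean is at most the mean square; its multipliers 1 - j/n
    give |z^j - 1|^2 the mean 2j/n exactly. Averages over roots of unity make these facts identities
    between finite sums over [R[i]]; for polynomials of small degree they agree with integrals over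
    the circle. Lacunarity acts through the sum of j |c_j|^2 over the coefficients c_j of (u_n,
    w_n). Going from n to m > n multiplies it by at most 1 + eta and adds a multiple of m times the
    sum of |F_j|^2 over n < j <= m. Division by the index gives a contraction factor (1 + eta) / L,
    below one for small eta, with summable errors. The mean oscillations therefore have a finite
    sum, which gives convergence to 0 almost everywhere and not only in mean. *)

Section modulus.
Context {R : rcfType}.
Implicit Types z w : R[i].

Lemma cabs_sqrE z : cabs z ^+ 2 = complex.Re z ^+ 2 + complex.Im z ^+ 2.
Proof. by case: z => a b /=; rewrite sqr_sqrtr// addr_ge0// sqr_ge0. Qed.

Lemma cabs_ge0 z : 0 <= cabs z.
Proof. by case: z => a b; exact: sqrtr_ge0. Qed.

Lemma cabsC_sqr z : (cabs z ^+ 2)%:C = z * z^*%C.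
Proof.
rewrite cabs_sqrE; case: z => a b /=; apply/eqP; rewrite eq_complex /=.
by apply/andP; split; apply/eqP; ring.
Qed.

Lemma cabsJ z : cabs z^*%C = cabs z.
Proof. by case: z => a b /=; rewrite sqrrN. Qed.

Lemma cabs_norm z : `|z| = (cabs z)%:C.
Proof. by rewrite normc_def; case: z. Qed.

Lemma cabs_real (r : R) : cabs r%:C = `|r|.
Proof. by rewrite /= expr0n/= addr0 sqrtr_sqr. Qed.

Lemma Re_real (r : R) z : complex.Re (r%:C * z) = r * complex.Re z.
Proof. by case: z => a b /=; rewrite mul0r subr0. Qed.

Lemma Im_real (r : R) z : complex.Im (r%:C * z) = r * complex.Im z.
Proof. by case: z => a b /=; rewrite mul0r addr0. Qed.

Lemma cabsX z n : cabs (z ^+ n) = cabs z ^+ n.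
Proof.
elim: n => [|n IH]; first by rewrite !expr0 ComplexField.Normc.normc1.
by rewrite !exprS ComplexField.Normc.normcM IH.
Qed.

Lemma unit_conj z : cabs z = 1 -> z * z^*%C = 1.
Proof. by move=> z1; rewrite -cabsC_sqr z1 expr1n. Qed.

Lemma unit_conjV z : cabs z = 1 -> z^*%C = z^-1.
Proof.
move=> z1; have z0 : z != 0.
  by apply/eqP => z0; move: z1; rewrite z0 ComplexField.Normc.normc0 => /eqP; rewrite eq_sym oner_eq0.
by apply: (mulfI z0); rewrite unit_conj// mulfV.
Qed.

Lemma prim_cabs N (om : R[i]) : (0 < N)%N -> N.-primitive_root om -> cabs om = 1.
Proof.
move=> N0 /prim_expr_order e.
have : cabs om ^+ N = 1 by rewrite -cabsX e ComplexField.Normc.normc1.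
by move/eqP; rewrite pexpr_eq1// ?cabs_ge0// => /eqP.
Qed.

End modulus.

Section discrete.
Context {R : rcfType} (N : nat) (om : R[i]).
Hypothesis (N0 : (0 < N)%N) (omP : N.-primitive_root om).
Implicit Types (p q h : {poly R[i]}) (n : nat) (s z : R[i]).

Lemma prim_sum_expr (i j : nat) : (i < N)%N -> (j < N)%N ->
  \sum_(k < N) (om ^+ k) ^+ i * ((om ^+ k) ^+ j)^*%C = (i == j)%:R * N%:R.
Proof.
move=> iN jN; have om1 := prim_cabs N0 omP.
have om0 : om != 0.
  by apply/eqP => z0; move: om1; rewrite z0 ComplexField.Normc.normc0 => /eqP; rewrite eq_sym oner_eq0.
have Ek (k : 'I_N) : (om ^+ k) ^+ i * ((om ^+ k) ^+ j)^*%C = (om ^+ i / om ^+ j) ^+ k.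
  rewrite unit_conjV; last by rewrite !cabsX om1 !expr1n.
  by rewrite expr_div_n -!exprM mulnC (mulnC k j).
rewrite (eq_bigr _ (fun k _ => Ek k)).
have [->|ij] := eqVneq i j.
  rewrite mulfV ?expf_eq0 ?(negbTE om0) ?andbF// mul1r.
  by under eq_bigr do rewrite expr1n; rewrite sumr_const card_ord.
rewrite mul0r; set y := om ^+ i / om ^+ j.
have y1 : y != 1.
  apply/eqP => /(congr1 (fun t => t * om ^+ j)); rewrite mul1r mulfVK ?expf_eq0 ?(negbTE om0) ?andbF//.
  move/eqP; rewrite (eq_prim_root_expr omP) !modn_small// => /eqP e.
  by rewrite e eqxx in ij.
have : (y - 1) * \sum_(k < N) y ^+ k = 0.
  rewrite -subrX1 expr_div_n -!exprM !(mulnC _ N) !exprM (prim_expr_order omP).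
  by rewrite !expr1n divr1 subrr.
by move/eqP; rewrite mulf_eq0 subr_eq0 (negbTE y1) => /eqP.
Qed.

(** Exact because exponents below [N] stay distinct modulo [N]: there is no aliasing. *)
Lemma discrete_parseval p q : (size p <= N)%N -> (size q <= N)%N ->
  \sum_(k < N) p.[om ^+ k] * (q.[om ^+ k])^*%C =
  N%:R * \sum_(j < N) p`_j * (q`_j)^*%C.
Proof.
move=> pN qN.
under eq_bigr => k _.
  rewrite (horner_coef_wide _ pN) (horner_coef_wide _ qN) rmorph_sum /= big_distrlr /=.
  over.
rewrite exchange_big /= mulr_sumr; apply: eq_bigr => i _.
rewrite exchange_big /= (bigD1 i)//= [X in _ + X]big1 ?addr0; last first.
  move=> j ji; under eq_bigr do rewrite rmorphM /= mulrACA.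
  by rewrite -mulr_sumr prim_sum_expr// -(inj_eq val_inj) /= eq_sym in ji *; rewrite (negbTE ji) mul0r mulr0.
under eq_bigr do rewrite rmorphM /= mulrACA.
by rewrite -mulr_sumr prim_sum_expr// eqxx mul1r mulrC.
Qed.

Definition dirichlet n : {poly R[i]} := \poly_(j < n) 1.

(** The Fejer kernel as a squared Dirichlet polynomial: nonnegativity is visible and Parseval
    applies to it. For [n = 0] the value is 0. *)
Definition fejer n z : R := n%:R^-1 * cabs (dirichlet n).[z] ^+ 2.

Lemma fejer_ge0 n z : 0 <= fejer n z.
Proof. by rewrite mulr_ge0// ?invr_ge0// sqr_ge0. Qed.

(** Rotation carried out on coefficients: values at [s * z] become values at [z] of another
    polynomial, to which Parseval applies. *)
Definition dil s p : {poly R[i]} := \poly_(i < size p) (p`_i * s ^+ i).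

Lemma coef_dil s p i : (dil s p)`_i = p`_i * s ^+ i.
Proof. by rewrite coef_poly; case: ltnP => // ?; rewrite nth_default// mul0r. Qed.

Lemma horner_dil s p z : (dil s p).[z] = p.[s * z].
Proof.
rewrite (horner_coef_wide z (size_poly _ _)) horner_coef; apply: eq_bigr => i _.
by rewrite coef_dil exprMn mulrA.
Qed.

Lemma size_dil s p : (size (dil s p) <= size p)%N.
Proof. exact: size_poly. Qed.

(* For polynomials of degree at most [N - n], averaging over the N-th roots of
   unity gives the Fejer mean over the circle, see [fconv_poly]. *)
Definition favg n s (f : R[i] -> R[i]) : R[i] :=
  N%:R^-1 * \sum_(k < N) (fejer n (om ^+ k))%:C * f (s * om ^+ k).

Definition ravg n s (f : R[i] -> R) : R :=
  N%:R^-1 * \sum_(k < N) fejer n (om ^+ k) * f (s * om ^+ k).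

(** One factor of the squared Dirichlet polynomial D is attached to p(s z), the other is conjugated;
    Parseval pairs D p(s z) with D, whose coefficients are 1 below [n] and 0 from there on. *)
Lemma favg_poly n s p : (n + size p <= N)%N ->
  favg n s (horner p) = n%:R^-1 * \sum_(j < n) (dirichlet n * dil s p)`_j.
Proof.
move=> npN.
have nN : (n <= N)%N by apply: leq_trans npN; rewrite leq_addr.
have s1 : (size (dirichlet n * dil s p)%R <= N)%N.
  apply: leq_trans npN; apply: (leq_trans (size_polyMleq _ _)).
  apply: (leq_trans (leq_pred _)); apply: leq_add; [exact: size_poly|exact: size_dil].
have s2 : (size (dirichlet n) <= N)%N by apply: leq_trans nN; exact: size_poly.
have Nn0 : N%:R != 0 :> R[i] by rewrite pnatr_eq0 -lt0n.
rewrite /favg.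
under eq_bigr => k _.
  rewrite /fejer rmorphM /= fmorphV rmorph_nat cabsC_sqr -mulrA mulrAC -horner_dil -hornerM.
  over.
rewrite -mulr_sumr discrete_parseval// mulrCA; congr (_ * _); rewrite mulKf//.
rewrite (bigID (fun j : 'I_N => (j < n)%N)) /= [X in _ + X]big1 ?addr0.
  rewrite (big_ord_widen_cond N (fun=> true) (fun j => (dirichlet n * dil s p)`_j)) //=.
  by apply: eq_bigr => j jn; rewrite [X in _ * X^*%C]coef_poly jn conjc1 mulr1.
by move=> j jn; rewrite [X in _ * X^*%C]coef_poly (negbTE jn) conjc0 mulr0.
Qed.

Lemma favg_ravg n s f : favg n s (fun z => (f z)%:C) = (ravg n s f)%:C.
Proof.
rewrite /favg /ravg rmorphM /= fmorphV rmorph_nat rmorph_sum /=.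
by under [in RHS]eq_bigr do rewrite rmorphM.
Qed.

Lemma favg1 n s : (0 < n)%N -> (n < N)%N -> favg n s (fun=> 1) = 1.
Proof.
move=> n0 nN; have -> : (fun=> 1) = horner (1%:P : {poly R[i]}) by apply/funext => z; rewrite hornerC.
rewrite favg_poly; last by rewrite size_polyC oner_eq0/= addn1.
have -> : dil s 1%:P = 1%:P.
  by apply/polyP => i; rewrite coef_dil coefC; case: i => [|i] /=; rewrite ?mulr1 ?mul0r.
rewrite mulr1; under eq_bigr => j _ do rewrite coef_poly ltn_ord.
by rewrite sumr_const card_ord mulVf// pnatr_eq0 -lt0n.
Qed.

Lemma ravg1 n s : (0 < n)%N -> (n < N)%N -> ravg n s (fun=> 1) = 1.
Proof.
move=> n0 nN; apply: (@complexI R); rewrite -favg_ravg.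
by rewrite (_ : (fun=> 1%:C) = fun=> 1)// favg1.
Qed.

(** Multiplication by the Dirichlet polynomial does not lower exponents, so none of the first [n]
    coefficients in [favg_poly] survives. *)
Lemma favg_highpass n s p : (n + size p <= N)%N -> (forall i, (i < n)%N -> p`_i = 0) ->
  favg n s (horner p) = 0.
Proof.
move=> npN p0; rewrite favg_poly// big1 ?mulr0// => j _.
rewrite coefM big1// => i _.
rewrite coef_dil p0 ?mul0r ?mulr0//.
by rewrite (leq_ltn_trans (leq_subr _ _)).
Qed.

(** The triangular Fejer multiplier 1 - j/n: of the n coefficients of the Dirichlet polynomial
    shifted by j, n - j stay below n. *)
Lemma favg_Xn n s j : (j <= n)%N -> (n + j < N)%N ->
  favg n s (fun z => z ^+ j) = s ^+ j * ((n - j)%:R / n%:R).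
Proof.
move=> jn njN; have -> : (fun z => z ^+ j) = horner ('X^j : {poly R[i]}).
  by apply/funext => z; rewrite hornerXn.
rewrite favg_poly; last by rewrite size_polyXn addnS.
have -> : dil s 'X^j = s ^+ j *: 'X^j.
  apply/polyP => i; rewrite coef_dil coefZ coefXn mulrC.
  by case: eqP => [->|] //; rewrite !mulr0.
rewrite mulrC [RHS]mulrA; congr (_ / _).
rewrite -scalerAr; under eq_bigr do rewrite coefZ coefMXn.
rewrite -mulr_sumr; congr (_ * _).
under eq_bigr => i _ do rewrite -if_neg -leqNgt.
rewrite -big_mkcond /=.
rewrite (eq_bigr (fun=> 1)); last first.
  by move=> i ji; rewrite coef_poly (leq_ltn_trans (leq_subr _ _)).
rewrite -(big_mkord (fun i => (j <= i)%N) (fun=> 1)) (big_cat_nat (leq0n j) jn)/=.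
rewrite [X in X + _]big_nat_cond big1 ?add0r; last by move=> i; case: ltnP => //=; lia.
rewrite big_nat_cond (eq_bigl (fun i => (j <= i < n)%N)); last by move=> i; lia.
by rewrite -big_nat sumr_const_nat.
Qed.

Lemma favgD n s f g : favg n s (fun z => f z + g z) = favg n s f + favg n s g.
Proof.
rewrite /favg -mulrDr -big_split /=; congr (_ * _).
by apply: eq_bigr => k _; rewrite mulrDr.
Qed.

Lemma favgZ n s c f : favg n s (fun z => c * f z) = c * favg n s f.
Proof.
rewrite /favg [RHS]mulrCA; congr (_ * _); rewrite mulr_sumr.
by apply: eq_bigr => k _; rewrite mulrCA.
Qed.

Lemma ravg_ge0 n s f : (forall z, 0 <= f z) -> 0 <= ravg n s f.
Proof.
move=> f0; rewrite mulr_ge0 ?invr_ge0// sumr_ge0// => k _.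
by rewrite mulr_ge0// fejer_ge0.
Qed.

Lemma le_ravg n s f g : (forall k : 'I_N, f (s * om ^+ k) <= g (s * om ^+ k)) ->
  ravg n s f <= ravg n s g.
Proof.
move=> fg; rewrite ler_wpM2l ?invr_ge0// ler_sum// => k _.
by rewrite ler_wpM2l// fejer_ge0.
Qed.

Lemma ravgD n s f g : ravg n s (fun z => f z + g z) = ravg n s f + ravg n s g.
Proof.
rewrite /ravg -mulrDr -big_split /=; congr (_ * _).
by apply: eq_bigr => k _; rewrite mulrDr.
Qed.

Lemma ravgZ n s c f : ravg n s (fun z => c * f z) = c * ravg n s f.
Proof.
rewrite /ravg [RHS]mulrCA; congr (_ * _); rewrite mulr_sumr.
by apply: eq_bigr => k _; rewrite mulrCA.
Qed.

Lemma eq_ravg n s f g : (forall k : 'I_N, f (s * om ^+ k) = g (s * om ^+ k)) ->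
  ravg n s f = ravg n s g.
Proof. by move=> fg; congr (_ * _); apply: eq_bigr => k _; rewrite fg. Qed.

Lemma Re_favg n s f : complex.Re (favg n s f) = ravg n s (fun z => complex.Re (f z)).
Proof.
rewrite /favg -(rmorph_nat (real_complex R)) -fmorphV Re_real; congr (_ * _).
rewrite (raddf_sum (@complex.Re R : Rcomplex R -> R)).
by apply: eq_bigr => k _ /=; rewrite Re_real.
Qed.

(* The second moment minus the squared mean is a variance, hence nonnegative. *)
Lemma favg_sqr_le n s f : (0 < n)%N -> (n < N)%N ->
  cabs (favg n s f) ^+ 2 <= ravg n s (fun z => cabs (f z) ^+ 2).
Proof.
move=> n0 nN; set m := favg n s f; rewrite -subr_ge0.
suff -> : ravg n s (fun z => cabs (f z) ^+ 2) - cabs m ^+ 2 =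
    ravg n s (fun z => cabs (f z - m) ^+ 2).
  by apply: ravg_ge0 => z; rewrite sqr_ge0.
rewrite (@eq_ravg n s (fun z => cabs (f z - m) ^+ 2) (fun z => (cabs (f z) ^+ 2 +
   cabs m ^+ 2 * 1) + (-2) * complex.Re (m^*%C * f z))); last first.
  move=> k; rewrite !cabs_sqrE; move: (f _) m => [a b] [c d] /=; ring.
rewrite ravgD ravgZ -Re_favg favgZ ravgD ravgZ ravg1// -/m.
by rewrite [m^*%C * m]mulrC -cabsC_sqr /=; ring.
Qed.

(** On the circle |z^j - 1|^2 = 2 - 2 Re z^j, and the multiplier of z^j is 1 - j/n. This is the
    origin of the weight j/n. *)
Lemma ravg_cabsXn_sub1 n j : (0 < n)%N -> (j <= n)%N -> (n + j < N)%N ->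
  ravg n 1 (fun z => cabs (z ^+ j - 1) ^+ 2) = 2 * j%:R / n%:R.
Proof.
move=> n0 jn njN.
have nN : (n < N)%N by apply: leq_ltn_trans njN; rewrite leq_addr.
rewrite (@eq_ravg _ _ _ (fun z => 2 * 1 + (- 2) * complex.Re (z ^+ j))); last first.
  move=> k; rewrite mul1r.
  have /(congr1 (fun t => t ^+ 2)) : cabs ((om ^+ k) ^+ j) = 1.
    by rewrite !cabsX (prim_cabs N0 omP) !expr1n.
  rewrite !cabs_sqrE; case: (_ ^+ j) => a b /=.
  by rewrite oppr0 addr0 => ?; nra.
rewrite ravgD !ravgZ ravg1// -Re_favg favg_Xn// expr1n mul1r.
rewrite -(rmorph_nat (real_complex R)) -(rmorph_nat (real_complex R) n) -fmorphV -rmorphM/=.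
have nn0 : n%:R != 0 :> R by rewrite pnatr_eq0 -lt0n.
by rewrite natrB//; field.
Qed.

(** Mean square oscillation around [s] at scale 1/n: the Fejer kernel of order n concentrates there.
    It is centred at the value h(s), not at the mean. *)
Definition dosc n h s : R := ravg n s (fun z => cabs (h.[z] - h.[s]) ^+ 2).

(** The Dirichlet integral of [h], that is, its squared homogeneous Sobolev norm of order 1/2. *)
Definition hsum h : R := \sum_(j < size h) j%:R * cabs h`_j ^+ 2.

Lemma hsum_wide n h : (size h <= n)%N -> hsum h = \sum_(j < n) j%:R * cabs h`_j ^+ 2.
Proof.
move=> hn; rewrite /hsum (big_ord_widen n (fun j => j%:R * cabs h`_j ^+ 2))//.
rewrite [RHS](bigID (fun j : 'I_n => (j < size h)%N)) /= [X in _ = _ + X]big1 ?addr0//.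
move=> j; rewrite -leqNgt => hj.
by rewrite nth_default// ComplexField.Normc.normc0 expr0n/= mulr0.
Qed.

(* Valid for every mean over [s] that satisfies Parseval's identity: the
   discrete one and the integral over the circle. *)
Lemma sum_dil_hsum n h : (0 < n)%N -> (size h <= n.+1)%N -> (n + n < N)%N ->
  N%:R^-1 * \sum_(k < N) fejer n (om ^+ k) *
    (\sum_(j < n.+1) cabs (dil (om ^+ k) h - h)`_j ^+ 2) = 2 / n%:R * hsum h.
Proof.
move=> n0 hn nN.
rewrite (hsum_wide hn) [RHS]mulr_sumr.
under eq_bigr do rewrite mulr_sumr.
rewrite exchange_big /= mulr_sumr; apply: eq_bigr => j _.
have jn : (j <= n)%N by rewrite -ltnS.
transitivity (cabs h`_j ^+ 2 * ravg n 1 (fun z => cabs (z ^+ j - 1) ^+ 2)).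
  rewrite /ravg mulrCA; congr (_ * _); rewrite mulr_sumr; apply: eq_bigr => k _.
  rewrite coefB coef_dil -{2}[h`_j]mulr1 -mulrBr ComplexField.Normc.normcM exprMn.
  by rewrite mul1r mulrCA.
by rewrite ravg_cabsXn_sub1//; [ring|rewrite (leq_ltn_trans _ nN)// leq_add2l].
Qed.

Lemma discrete_parseval_sqr p : (size p <= N)%N ->
  N%:R^-1 * \sum_(k < N) cabs p.[om ^+ k] ^+ 2 = \sum_(j < N) cabs p`_j ^+ 2.
Proof.
move=> pN; apply: (@complexI R).
rewrite rmorphM fmorphV rmorph_nat !rmorph_sum /=.
under eq_bigr do rewrite cabsC_sqr.
rewrite discrete_parseval// mulKf ?pnatr_eq0 -?lt0n//.
by apply: eq_bigr => j _; rewrite cabsC_sqr.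
Qed.

Lemma sum_coef_widen (V : zmodType) (f : R[i] -> V) p n m : f 0 = 0 ->
  (size p <= n)%N -> (size p <= m)%N -> \sum_(j < n) f p`_j = \sum_(j < m) f p`_j.
Proof.
move=> f0; suff H k : (size p <= k)%N -> \sum_(j < k) f p`_j = \sum_(j < size p) f p`_j.
  by move=> ? ?; rewrite !H.
move=> pk; rewrite [RHS](big_ord_widen k (fun j => f p`_j))//.
rewrite [LHS](bigID (fun j : 'I_k => (j < size p)%N)) /= [X in _ + X]big1 ?addr0//.
by move=> j; rewrite -leqNgt => hj; rewrite nth_default.
Qed.

(** Interchange the two averages: for a fixed displacement [om ^+ k], Parseval in the base point
    evaluates the mean square of h(om^k z) - h(z). *)
Lemma mean_dosc n h : (0 < n)%N -> (size h <= n.+1)%N -> (n + n < N)%N ->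
  N%:R^-1 * \sum_(l < N) dosc n h (om ^+ l) = 2 / n%:R * hsum h.
Proof.
move=> n0 hn nN; rewrite -sum_dil_hsum// /dosc /ravg -mulr_sumr; congr (_ * _).
rewrite exchange_big /= mulr_sumr; apply: eq_bigr => k _.
rewrite -mulr_sumr mulrCA; congr (_ * _).
have sN : (size (dil (om ^+ k) h - h)%R <= n.+1)%N.
  apply: (leq_trans (size_polyD _ _)); rewrite size_polyN geq_max hn andbT.
  exact: leq_trans (size_dil _ _) hn.
have nN' : (n.+1 <= N)%N by rewrite (leq_ltn_trans _ nN)// leq_addr.
rewrite (@sum_coef_widen _ (fun z => cabs z ^+ 2) _ _ N) ?expr0n//; last 2 first.
- by rewrite ComplexField.Normc.normc0 expr0n.
- exact: leq_trans sN nN'.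
rewrite -discrete_parseval_sqr; last exact: leq_trans sN nN'.
by congr (_ * _); apply: eq_bigr => l _; rewrite hornerD hornerN horner_dil mulrC.
Qed.

End discrete.

(** * The SU(2) transfer matrices *)

(** X^N - 1 splits over the algebraically closed field [R[i]] and is separable in characteristic 0;
    its N distinct roots contain a primitive one. *)
Lemma complex_prim_root {R : rcfType} N : (0 < N)%N ->
  exists om : R[i], N.-primitive_root om.
Proof.
move=> N0; pose p : {poly R[i]} := 'X^N - 1.
have [rs /= def_p] := closed_field_poly_normal p.
rewrite lead_coefXnsubC// scale1r in def_p.
have rs_un : all N.-unity_root rs.
  by apply/allP => z; rewrite -root_prod_XsubC -def_p.
have rs_sz : (N < (size rs).+1)%N by rewrite -(size_prod_XsubC rs id) -def_p size_XnsubC.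
have rs_uniq : uniq rs.
  rewrite -separable_prod_XsubC -def_p; apply: separable_Xn_sub_1.
  by rewrite pnatr_eq0 -lt0n.
by have /hasP[om _ ?] := has_prim_root N0 rs_un rs_uniq rs_sz; exists om.
Qed.

Section evolution.
Context {R : rcfType}.
Variable F : nat -> R[i].
Implicit Types (p q : {poly R[i]}) (pq : {poly R[i]} * {poly R[i]}) (z : R[i]).

(** The polynomial z^m p^*, equal to z^m conj(p) on the circle. The parameter [m] only bounds the
    degree, since [p] may have lower degree. *)
Definition rev_poly m p : {poly R[i]} := \poly_(i < m.+1) (p`_(m - i))^*%C.

Lemma coef_rev_poly m p i : (size p <= m.+1)%N ->
  (rev_poly m p)`_i = if (i <= m)%N then (p`_(m - i))^*%C else 0.
Proof. by move=> pm; rewrite coef_poly ltnS. Qed.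

Lemma horner_rev_poly m p z : (size p <= m.+1)%N -> cabs z = 1 ->
  (rev_poly m p).[z] = z ^+ m * (p.[z])^*%C.
Proof.
move=> pm z1.
rewrite (horner_coef_wide z (size_poly _ _)) (horner_coef_wide z pm).
rewrite rmorph_sum mulr_sumr [RHS](reindex_inj rev_ord_inj); apply: eq_bigr => i _ /=.
rewrite coef_poly ltn_ord subSS rmorphM /= mulrCA; congr (_ * _).
have im : (i <= m)%N by rewrite -ltnS.
rewrite unit_conjV ?cabsX ?z1 ?expr1n//.
have z0 : z != 0.
  by apply/eqP => z0; move: z1; rewrite z0 ComplexField.Normc.normc0 => /eqP; rewrite eq_sym oner_eq0.
rewrite -{2}(subnK im) exprD mulrAC mulfV ?mul1r//.
by rewrite expf_eq0 (negbTE z0) andbF.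
Qed.

(** The factor that gives the one-step matrix with rows (1, f z^m) and (- conj(f z^m), 1)
    determinant one on the circle. *)
Definition cfac (f : R[i]) : R := (Num.sqrt (1 + cabs f ^+ 2))^-1.

Lemma cfac_gt0 f : 0 < cfac f.
Proof. by rewrite invr_gt0 sqrtr_gt0 ltr_wpDr// sqr_ge0. Qed.

Lemma cfac_sqr f : cfac f ^+ 2 = (1 + cabs f ^+ 2)^-1.
Proof. by rewrite exprVn sqr_sqrtr// addr_ge0// sqr_ge0. Qed.

Lemma cfac_sqrK f : cfac f ^+ 2 * (1 + cabs f ^+ 2) = 1.
Proof. by rewrite cfac_sqr mulVf// gt_eqF// ltr_wpDr// sqr_ge0. Qed.

(* The recurrence for (z^n conj(Phi_n), z^n conj(tPhi_n)), normalized, when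
   tF = - F; see [vpol_Phi]. *)
Definition step m pq : {poly R[i]} * {poly R[i]} :=
  ((cfac (F m.+1))%:C *: (pq.1 + F m.+1 *: ('X * rev_poly m pq.2)),
   (cfac (F m.+1))%:C *: (pq.2 - F m.+1 *: ('X * rev_poly m pq.1))).

Fixpoint ev n k pq := if k is k'.+1 then step (n + k') (ev n k' pq) else pq.

Definition deg_le m pq := (size pq.1 <= m.+1)%N /\ (size pq.2 <= m.+1)%N.

Lemma size_X_rev m p : (size ('X * rev_poly m p)%R <= m.+2)%N.
Proof.
apply: (leq_trans (size_polyMleq _ _)); rewrite size_polyX /=.
by rewrite ltnS; exact: size_poly.
Qed.

Lemma step_deg m pq : deg_le m pq -> deg_le m.+1 (step m pq).
Proof.
move=> [p1 p2]; split; apply: (leq_trans (size_scale_leq _ _));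
  apply: (leq_trans (size_polyD _ _)); rewrite ?size_polyN geq_max (leq_trans _ (leqnSn _))//=;
  exact: leq_trans (size_scale_leq _ _) (size_X_rev _ _).
Qed.

Lemma ev_deg n k pq : deg_le n pq -> deg_le (n + k) (ev n k pq).
Proof.
move=> npq; elim: k => [|k IH]; first by rewrite addn0.
by rewrite addnS; exact: step_deg.
Qed.

Lemma horner_step m pq z : deg_le m pq -> cabs z = 1 ->
  (step m pq).1.[z] = (cfac (F m.+1))%:C *
    (pq.1.[z] + F m.+1 * z ^+ m.+1 * (pq.2.[z])^*%C) /\
  (step m pq).2.[z] = (cfac (F m.+1))%:C *
    (pq.2.[z] - F m.+1 * z ^+ m.+1 * (pq.1.[z])^*%C).
Proof.
move=> [p1 p2] z1; rewrite /step /= !(hornerZ, hornerD, hornerN, hornerM, hornerX) !horner_rev_poly//.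
by rewrite exprS !mulrA.
Qed.

Definition pnorm pq z : R := cabs pq.1.[z] ^+ 2 + cabs pq.2.[z] ^+ 2.

(** Unitarity of the step: the opposite signs in the two components of [step] make the cross terms
    cancel, and [cfac] absorbs the factor 1 + |F|^2. *)
Lemma pnorm_step m pq z : deg_le m pq -> cabs z = 1 ->
  pnorm (step m pq) z = pnorm pq z.
Proof.
move=> mpq z1; rewrite /pnorm.
have [-> ->] := horner_step mpq z1.
rewrite !ComplexField.Normc.normcM !cabs_real !exprMn !real_normK ?num_real// -mulrDr.
apply: (@mulfI _ (1 + cabs (F m.+1) ^+ 2)); first by rewrite gt_eqF// ltr_wpDr// sqr_ge0.
rewrite mulrA [_ * cfac _ ^+ 2]mulrC cfac_sqrK mul1r.
have : cabs (z ^+ m.+1) ^+ 2 = 1 by rewrite cabsX z1 !expr1n.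
move=> zm1; transitivity ((1 + cabs (F m.+1) ^+ 2 * cabs (z ^+ m.+1) ^+ 2) *
    (cabs pq.1.[z] ^+ 2 + cabs pq.2.[z] ^+ 2)); last by rewrite zm1 mulr1.
rewrite !cabs_sqrE; move: (F _) (z ^+ _) pq.1.[z] pq.2.[z] => [a b] [c d] [e f] [g h] /=.
ring.
Qed.

Lemma pnorm_ev n k pq z : deg_le n pq -> cabs z = 1 ->
  pnorm (ev n k pq) z = pnorm pq z.
Proof.
by move=> npq z1; elim: k => //= k IH; rewrite pnorm_step//; exact: ev_deg.
Qed.

Definition vpol n := ev 0 n (1%:P, 1%:P).
(* The pair (B, A) of the SU(2) transfer matrix [[A, B], [-B^*, A^*]] from index
   [n] to [n + k], see [vpol_block]. *)
Definition block n k := ev n k (0%:P, 1%:P).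

Lemma vpol_deg n : deg_le n (vpol n).
Proof. by apply: (@ev_deg 0); split; rewrite /= size_polyC oner_eq0. Qed.

Lemma block_deg n k : deg_le (n + k) (block n k).
Proof. by apply: ev_deg; split; rewrite /= size_polyC ?oner_eq0 ?eqxx. Qed.

Lemma pnorm_vpol n z : cabs z = 1 -> pnorm (vpol n) z = 2.
Proof.
move=> z1; rewrite pnorm_ev//; last by split; rewrite /= size_polyC oner_eq0.
by rewrite /pnorm /= hornerC ComplexField.Normc.normc1 expr1n.
Qed.

Lemma pnorm_block n k z : cabs z = 1 -> pnorm (block n k) z = 1.
Proof.
move=> z1; rewrite pnorm_ev//; last by split; rewrite /= size_polyC ?oner_eq0 ?eqxx.
rewrite /pnorm /= !hornerC ComplexField.Normc.normc1 ComplexField.Normc.normc0.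
by rewrite expr1n expr0n add0r.
Qed.

(** The evolution multiplies (u, conj(w)) on the left by SU(2) matrices. Such a matrix is determined
    by its second column, which is the image of (0, 1). *)
Lemma vpol_block n k z : cabs z = 1 ->
  let A := (block n k).2.[z] in let B := (block n k).1.[z] in
  let u := (vpol n).1.[z] in let w := (vpol n).2.[z] in
  (vpol (n + k)).1.[z] = A * u + B * w^*%C /\
  (vpol (n + k)).2.[z] = A * w - B * u^*%C.
Proof.
move=> z1; elim: k => [|k] /=.
  by rewrite addn0 !hornerC !mul0r !mul1r addr0 subr0.
move=> [e1 e2]; rewrite addnS /vpol /=.
have [-> ->] := horner_step (vpol_deg (n + k)) z1.
have [-> ->] := horner_step (block_deg n k) z1.
rewrite e1 e2 !(rmorphD, rmorphB, rmorphM, rmorphN) /= !conjcK; split; ring.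
Qed.

(** Reversal in degree n + k followed by the factor z sends exponent i to n + k + 1 - i. It thus
    maps exponents in [0, k] into [n + 1, n + k + 1] and exponents in [n + 1, n + k] into [1, k],
    which preserves both ranges as [k] grows. *)
Lemma block_spectrum n k :
  (forall i, (i <= n)%N -> (block n k).1`_i = 0) /\
  (forall i, (k < i)%N -> (block n k).2`_i = 0).
Proof.
elim: k => [|k [IB IA]] /=.
  by split=> i; rewrite coefC; case: i; rewrite //= if_same.
have [sB sA] := block_deg n k.
split=> i ik; rewrite coefZ coefD ?coefN !coefZ coefXM.
  rewrite IB// add0r; case: i ik => [|i] ik; rewrite ?mulr0//=.
  rewrite coef_rev_poly//; case: ifP => _; rewrite ?mulr0//.
  by rewrite IA ?conjc0 ?mulr0//; lia.
rewrite (IA _ (ltnW ik)) sub0r; case: i ik => [|i] ik //=.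
rewrite coef_rev_poly//; case: ifP => _; rewrite ?mulr0 ?oppr0 ?mulr0//.
by rewrite IB ?conjc0 ?mulr0 ?oppr0 ?mulr0// leq_subLR addnC leq_add2r -ltnS ltnW.
Qed.

(** The reversed term carries a factor 'X, so only the normalization acts on the constant
    coefficient of A. *)
Lemma block_coef0 n k :
  (block n k).2`_0 = (\prod_(i < k) cfac (F (n + i).+1))%:C.
Proof.
elim: k => [|k IH] /=; first by rewrite big_ord0 coefC.
by rewrite coefZ coefB coefZ coefXM mulr0 subr0 IH big_ord_recr /= mulrC rmorphM.
Qed.

(** For x, y in [0, 1] one has 1 - xy <= (1 - x) + (1 - y); with x and y squares of factors, each
    defect 1 - cfac^2 = |F|^2 cfac^2 is at most |F|^2. *)
Lemma prod_cfac n k :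
  [/\ 0 < \prod_(i < k) cfac (F (n + i).+1),
   \prod_(i < k) cfac (F (n + i).+1) <= 1 &
   1 - (\prod_(i < k) cfac (F (n + i).+1)) ^+ 2 <= \sum_(i < k) cabs (F (n + i).+1) ^+ 2].
Proof.
elim: k => [|k [p0 p1 IH]]; first by rewrite !big_ord0 expr1n subrr.
rewrite !big_ord_recr /=; move: (F _) (\prod_(_ < _) _) (\sum_(_ < _) _) p0 p1 IH => f P S p0 p1 IH.
have := cfac_sqrK f; have := cfac_gt0 f; have := sqr_ge0 (cabs f).
move: (cfac f) (cabs f ^+ 2) => c x x0 c0 e.
have c1 : c <= 1 by nra.
split; [nra|nra|].
have c2 : 0 <= 1 - c ^+ 2 by rewrite subr_ge0 exprn_ile1// ltW.
have P2 : 0 <= 1 - P ^+ 2 by rewrite subr_ge0 exprn_ile1// ltW.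
have PC := mulr_ge0 P2 c2; have xc := mulr_ge0 x0 c2.
rewrite exprMn; nra.
Qed.

Lemma block_parseval n k m : (n + k < m)%N ->
  \sum_(j < m) (cabs (block n k).1`_j ^+ 2 + cabs (block n k).2`_j ^+ 2) = 1.
Proof.
move=> nkm; have m0 : (0 < m)%N by apply: leq_ltn_trans nkm.
have [om omP] := @complex_prim_root R _ m0.
have [sB sA] := block_deg n k.
rewrite big_split /= -(discrete_parseval_sqr m0 omP) ?(leq_trans sB)//.
rewrite -(discrete_parseval_sqr m0 omP) ?(leq_trans sA)// -mulrDr -big_split /=.
rewrite (eq_bigr (fun=> 1)); last first.
  by move=> j _; rewrite -(pnorm_block n k (z := om ^+ j))// cabsX (prim_cabs m0 omP) expr1n.
by rewrite sumr_const card_ord mulVf// pnatr_eq0 -lt0n.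
Qed.

(** By Parseval the squared coefficients of A and B add up to 1. All of them except that of the
    constant term of A, which has weight 0, have weight at most n + k, and their total is 1 minus
    the squared product of the normalizations. *)
Lemma hsum_block n k : hsum (block n k).1 + hsum (block n k).2 <=
  (n + k)%:R * \sum_(i < k) cabs (F (n + i).+1) ^+ 2.
Proof.
have [sB sA] := block_deg n k.
rewrite !(hsum_wide (n := (n + k).+1))// -big_split /=.
have [_ _ p1] := prod_cfac n k.
apply: (@le_trans _ _ ((n + k)%:R * (1 - (\prod_(i < k) cfac (F (n + i).+1)) ^+ 2))); last first.
  by rewrite ler_wpM2l.
have := block_parseval (ltnSn (n + k)); rewrite big_ord_recl /=.
rewrite block_coef0 cabs_real real_normK ?num_real//.
rewrite (block_spectrum n k).1// ComplexField.Normc.normc0 expr0n add0r => e.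
rewrite -[X in X - _]e [X in _ * X]addrAC subrr add0r mulr_sumr.
rewrite [X in X <= _]big_ord_recl /= !mul0r !add0r.
apply: ler_sum => i _; rewrite -mulrDr ler_wpM2r ?addr_ge0 ?sqr_ge0// ler_nat.
exact: ltn_ord.
Qed.

End evolution.

(** * Oscillation of the evolution and recovery of the product *)

Section estimates.
Context {R : rcfType}.
Variable F : nat -> R[i].
Implicit Types (p q : {poly R[i]}) (z : R[i]).

(** The free parameter keeps the factor of the main term close to 1, as the later contraction along
    a lacunary sequence demands. *)
Lemma cabsD_sqr_le (eta : R) (p q : R[i]) : 0 < eta ->
  cabs (p + q) ^+ 2 <= (1 + eta) * cabs p ^+ 2 + (1 + eta^-1) * cabs q ^+ 2.
Proof.
move=> e0.
have H (a b : R) : (a + b) ^+ 2 <= (1 + eta) * a ^+ 2 + (1 + eta^-1) * b ^+ 2.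
  rewrite -subr_ge0.
  have -> : (1 + eta) * a ^+ 2 + (1 + eta^-1) * b ^+ 2 - (a + b) ^+ 2 =
    eta^-1 * (eta * a - b) ^+ 2 by field; rewrite gt_eqF.
  by rewrite mulr_ge0 ?sqr_ge0// invr_ge0 ltW.
rewrite !cabs_sqrE; case: p q => [a b] [c d] /=.
apply: (le_trans (lerD (H a c) (H b d))); rewrite le_eqVlt; apply/orP; left; apply/eqP; ring.
Qed.

(** The increment of a product is split into the block at t acting on the increment of (u, w), plus
    the increment of the block acting on (u, w) at s. Both actions multiply norms, as for
    quaternions. *)
Lemma quaternion_diff_le (eta : R) (At As Bt Bs ut us wt ws : R[i]) : 0 < eta ->
  cabs At ^+ 2 + cabs Bt ^+ 2 = 1 -> cabs us ^+ 2 + cabs ws ^+ 2 = 2 ->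
  cabs ((At * ut + Bt * wt^*%C) - (As * us + Bs * ws^*%C)) ^+ 2 +
  cabs ((At * wt - Bt * ut^*%C) - (As * ws - Bs * us^*%C)) ^+ 2 <=
  (1 + eta) * (cabs (ut - us) ^+ 2 + cabs (wt - ws) ^+ 2) +
  2 * (1 + eta^-1) * (cabs (Bt - Bs) ^+ 2 + cabs (At - As) ^+ 2).
Proof.
move=> e0 AB uw.
have -> : (At * ut + Bt * wt^*%C) - (As * us + Bs * ws^*%C) =
   (At * (ut - us) + Bt * (wt - ws)^*%C) + ((At - As) * us + (Bt - Bs) * ws^*%C).
  by rewrite rmorphB /=; ring.
have -> : (At * wt - Bt * ut^*%C) - (As * ws - Bs * us^*%C) =
   (At * (wt - ws) - Bt * (ut - us)^*%C) + ((At - As) * ws - (Bt - Bs) * us^*%C).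
  by rewrite rmorphB /=; ring.
apply: (le_trans (lerD (cabsD_sqr_le _ _ e0) (cabsD_sqr_le _ _ e0))).
(* Multiplicativity of the quaternion norm. *)
have I (a b c d : R[i]) : cabs (a * c + b * d^*%C) ^+ 2 + cabs (a * d - b * c^*%C) ^+ 2 =
   (cabs a ^+ 2 + cabs b ^+ 2) * (cabs c ^+ 2 + cabs d ^+ 2).
  rewrite !cabs_sqrE; case: a b c d => [a1 a2] [b1 b2] [c1 c2] [d1 d2] /=; ring.
rewrite addrACA -!mulrDr !I AB uw mul1r le_eqVlt; apply/orP; left; apply/eqP; ring.
Qed.

Definition vsum n : R := hsum (vpol F n).1 + hsum (vpol F n).2.

(* The mean of the squared oscillation against the Fejer kernel turns the
   Dirichlet-type sum [hsum] into a pointwise quantity, on which the block acts. *)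
Lemma vsum_block n k (eta : R) : 0 < eta ->
  vsum (n + k) <= (1 + eta) * vsum n +
  2 * (1 + eta^-1) * (hsum (block F n k).1 + hsum (block F n k).2).
Proof.
(* Any order that bounds the degrees recovers [hsum] from the mean oscillation; [m.+1] is taken so
   that the order is positive even for m = 0. *)
move=> e0; set m := (n + k)%N; set M := m.+1; set N := (M + M).+1.
have N0 : (0 < N)%N by [].
have [om omP] := @complex_prim_root R _ N0.
have MN : (M + M < N)%N by [].
have M0 : (0 < M)%N by [].
have mean (h : {poly R[i]}) : (size h <= M)%N -> hsum h = M%:R / 2 * (N%:R^-1 * \sum_(l < N) dosc N om M h (om ^+ l)).
  move=> hM; rewrite (mean_dosc N0 omP M0)//; last exact: leqW.
  have M1 : M%:R != 0 :> R by rewrite pnatr_eq0.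
  by field.
have [s1 s2] := vpol_deg F m.
have [s3 s4] : deg_le m (vpol F n).
  by have [? ?] := vpol_deg F n; split; rewrite (leq_trans (_ : _ <= n.+1)%N)// ltnS leq_addr.
have [s5 s6] := block_deg F n k.
rewrite /vsum !mean// -!mulrDr -!big_split /= !(mulrCA _ (M%:R / 2)) -mulrDr ler_wpM2l//.
rewrite !(mulrCA _ N%:R^-1) -mulrDr ler_wpM2l ?invr_ge0//.
rewrite !mulr_sumr -big_split /=; apply: ler_sum => l _.
rewrite /dosc -!ravgD -!ravgZ -ravgD; apply: le_ravg => j /=.
have o1 : cabs om = 1 by exact: prim_cabs omP.
have l1 : cabs (om ^+ l) = 1 by rewrite cabsX o1 expr1n.
have j1 : cabs (om ^+ l * om ^+ j) = 1 by rewrite ComplexField.Normc.normcM !cabsX o1 !expr1n mulr1.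
have [-> ->] := vpol_block F n k j1.
have [-> ->] := vpol_block F n k l1.
apply: quaternion_diff_le => //; last exact: pnorm_vpol.
by rewrite addrC; exact: pnorm_block.
Qed.

Lemma eq_favg N (om : R[i]) n s f g : (forall k : 'I_N, f (s * om ^+ k) = g (s * om ^+ k)) ->
  favg N om n s f = favg N om n s g.
Proof. by move=> fg; congr (_ * _); apply: eq_bigr => k _; rewrite fg. Qed.

Definition vosc N om n s : R := dosc N om n (vpol F n).1 s + dosc N om n (vpol F n).2 s.

(* The frequencies of the B-entry of the block all exceed [n], so they are
   annihilated by the Fejer mean of order [n]. *)
Lemma favg_vpol_close N (om : R[i]) n k s : (0 < n)%N -> N.-primitive_root om ->
  (n + n + k < N)%N -> cabs s = 1 ->
  let al := favg N om n s (horner (block F n k).2) in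
  cabs (favg N om n s (horner (vpol F (n + k)).1) - al * (vpol F n).1.[s]) ^+ 2 +
  cabs (favg N om n s (horner (vpol F (n + k)).2) - al * (vpol F n).2.[s]) ^+ 2 <=
  vosc N om n s.
Proof.
move=> n0 omP nN s1 /=.
have N0 : (0 < N)%N by apply: leq_ltn_trans nN.
have nN' : (n < N)%N by apply: leq_ltn_trans nN; rewrite -addnA leq_addr.
have j1 (j : 'I_N) : cabs (s * om ^+ j) = 1.
  by rewrite ComplexField.Normc.normcM cabsX s1 (prim_cabs N0 omP) expr1n mulr1.
have [sB sA] := block_deg F n k.
have Bhigh : favg N om n s (horner (block F n k).1) = 0.
  apply: favg_highpass => //; first by lia.
  by move=> i ni; apply: (block_spectrum F n k).1; exact: ltnW.
set u := vpol F n; set B := block F n k in Bhigh *.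
(* The values u(s), w(s) are constants under the mean. The block applied to them contributes [al]
   times them through A and nothing through B; only increments from s remain. *)
have -> : favg N om n s (horner (vpol F (n + k)).1) - favg N om n s (horner B.2) * u.1.[s] =
   favg N om n s (fun z => B.2.[z] * (u.1.[z] - u.1.[s]) + B.1.[z] * (u.2.[z] - u.2.[s])^*%C).
  rewrite (@eq_favg _ _ _ _ _ (fun z => (B.2.[z] * (u.1.[z] - u.1.[s]) + B.1.[z] * (u.2.[z] - u.2.[s])^*%C)
     + (u.1.[s] * B.2.[z] + u.2.[s]^*%C * B.1.[z]))); last first.
    by move=> j; have [-> _] := vpol_block F n k (j1 j); rewrite rmorphB /=; ring.
  by rewrite favgD (favgD _ _ _ _ (fun z => u.1.[s] * _)) !favgZ Bhigh; ring.
have -> : favg N om n s (horner (vpol F (n + k)).2) - favg N om n s (horner B.2) * u.2.[s] =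
   favg N om n s (fun z => B.2.[z] * (u.2.[z] - u.2.[s]) - B.1.[z] * (u.1.[z] - u.1.[s])^*%C).
  rewrite (@eq_favg _ _ _ _ _ (fun z => (B.2.[z] * (u.2.[z] - u.2.[s]) - B.1.[z] * (u.1.[z] - u.1.[s])^*%C)
     + (u.2.[s] * B.2.[z] + (- u.1.[s]^*%C) * B.1.[z]))); last first.
    by move=> j; have [_ ->] := vpol_block F n k (j1 j); rewrite rmorphB /=; ring.
  by rewrite favgD (favgD _ _ _ _ (fun z => u.2.[s] * _)) !favgZ Bhigh; ring.
apply: (le_trans (lerD (favg_sqr_le N0 omP _ _ n0 nN') (favg_sqr_le N0 omP _ _ n0 nN'))).
rewrite /vosc /dosc -!ravgD; apply: le_ravg => j /=; rewrite -/u.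
have : cabs B.1.[s * om ^+ j] ^+ 2 + cabs B.2.[s * om ^+ j] ^+ 2 = 1 by exact: pnorm_block.
rewrite !cabs_sqrE; move: B.1.[_] B.2.[_] (u.1.[_] - _) (u.2.[_] - _).
move=> [b1 b2] [a1 a2] [c1 c2] [d1 d2] /= e.
rewrite le_eqVlt; apply/orP; left; apply/eqP.
by rewrite -[RHS]mul1r -e; ring.
Qed.

(* The unknown mean of the block is eliminated through |x|^2 + |y|^2 = 2. *)
Lemma product_of_close (al x y X W : R[i]) (Y : R) :
  cabs al <= 1 -> cabs x ^+ 2 + cabs y ^+ 2 = 2 -> cabs X <= 2 -> cabs W <= 2 ->
  cabs (X - al * x) ^+ 2 + cabs (W - al * y) ^+ 2 <= Y ->
  cabs (x * y^*%C * (cabs X ^+ 2 + cabs W ^+ 2)%:C - 2 * (X * W^*%C)) <= 40 * Num.sqrt Y.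
Proof.
move=> al1 xy X2 W2 hY.
set a := X - al * x; set b := W - al * y; set e := Num.sqrt Y.
have Y0 : 0 <= Y by apply: le_trans hY; rewrite addr_ge0// sqr_ge0.
have ae : cabs a <= e.
  rewrite -(ler_pXn2r (n := 2)) ?nnegrE ?cabs_ge0 ?sqrtr_ge0// sqr_sqrtr//.
  by apply: le_trans hY; rewrite lerDl sqr_ge0.
have be : cabs b <= e.
  rewrite -(ler_pXn2r (n := 2)) ?nnegrE ?cabs_ge0 ?sqrtr_ge0// sqr_sqrtr//.
  by apply: le_trans hY; rewrite lerDr sqr_ge0.
have x2 : cabs x <= 2.
  by rewrite -(ler_pXn2r (n := 2)) ?nnegrE ?cabs_ge0//; have := sqr_ge0 (cabs y); nra.
have y2 : cabs y <= 2.
  by rewrite -(ler_pXn2r (n := 2)) ?nnegrE ?cabs_ge0//; have := sqr_ge0 (cabs x); nra.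
(* Writing X = al x + a and W = al y + b, the terms in |al|^2 cancel because |x|^2 + |y|^2 = 2;
   every term left contains a or b. *)
have -> : x * y^*%C * (cabs X ^+ 2 + cabs W ^+ 2)%:C - 2 * (X * W^*%C) =
  x * y^*%C * ((X * a^*%C + a * (al * x)^*%C) + (W * b^*%C + b * (al * y)^*%C)) +
  - (2%:C * (a * W^*%C + al * x * b^*%C)).
  have tE : (2 : R)%:C = x * x^*%C + y * y^*%C by rewrite -!cabsC_sqr -xy rmorphD.
  have -> : (2 : R[i]) = (2 : R)%:C by rewrite (rmorph_nat (real_complex R)).
  rewrite !tE.
  rewrite rmorphD /= !cabsC_sqr /a /b !(rmorphB, rmorphM) /=; ring.
have M (p q : R[i]) (c d : R) : cabs p <= c -> cabs q <= d -> cabs (p * q) <= c * d.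
  by move=> pc qd; rewrite ComplexField.Normc.normcM ler_pM// cabs_ge0.
have D (p q : R[i]) (c d : R) : cabs p <= c -> cabs q <= d -> cabs (p + q) <= c + d.
  by move=> pc qd; apply: (le_trans (le_normcD _ _)); rewrite lerD.
have alx : cabs (al * x) <= 2 by rewrite -[2]mul1r; exact: M.
have aly : cabs (al * y) <= 2 by rewrite -[2]mul1r; exact: M.
(* Each of x, y, X, W, al x, al y has modulus at most 2, while a and b have modulus at most e: 32 e
   from the first summand and 8 e from the second. *)
have -> : 40 * e = 2 * 2 * ((2 * e + e * 2) + (2 * e + e * 2)) + 2 * (e * 2 + 2 * e) by ring.
apply: (D).
  apply: (M); first by apply: (M); rewrite ?cabsJ.
  by apply: (D); apply: (D); apply: (M); rewrite ?cabsJ.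
rewrite normcN; apply: (M); first by rewrite cabs_real ger0_norm.
by apply: (D); apply: (M); rewrite ?cabsJ.
Qed.

Lemma cabs_favg_le N (om : R[i]) n s p (c : R) : (0 < n < N)%N -> N.-primitive_root om ->
  cabs s = 1 -> 0 <= c -> (forall z, cabs z = 1 -> cabs p.[z] ^+ 2 <= c ^+ 2) ->
  cabs (favg N om n s (horner p)) <= c.
Proof.
move=> /andP[n0 nN] omP s1 c0 pc.
have N0 : (0 < N)%N by exact: leq_ltn_trans nN.
rewrite -(ler_pXn2r (n := 2)) ?nnegrE ?cabs_ge0//.
apply: (le_trans (favg_sqr_le N0 omP _ _ n0 nN)).
rewrite -[leRHS]mulr1 -(ravg1 N0 omP s n0 nN) -ravgZ; apply: le_ravg => j /=.
rewrite mulr1 pc// ComplexField.Normc.normcM cabsX s1 (prim_cabs N0 omP) expr1n mulr1//.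
Qed.

Lemma product_estimate N (om : R[i]) n k s : (0 < n)%N -> N.-primitive_root om ->
  (n + n + k < N)%N -> cabs s = 1 ->
  let X := favg N om n s (horner (vpol F (n + k)).1) in
  let W := favg N om n s (horner (vpol F (n + k)).2) in
  cabs ((vpol F n).1.[s] * ((vpol F n).2.[s])^*%C * (cabs X ^+ 2 + cabs W ^+ 2)%:C -
    2 * (X * W^*%C)) <= 40 * Num.sqrt (vosc N om n s).
Proof.
move=> n0 omP nN s1 /=.
have nN' : (0 < n < N)%N by rewrite n0 (leq_ltn_trans _ nN)// -addnA leq_addr.
have le4 : (2 : R) <= 2 ^+ 2 by rewrite expr2; lra.
apply: (@product_of_close (favg N om n s (horner (block F n k).2))).
- apply: cabs_favg_le => // z z1; rewrite expr1n -(pnorm_block F n k z1) lerDr sqr_ge0//.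
- exact: pnorm_vpol.
- apply: cabs_favg_le => // z z1; apply: le_trans le4.
  by rewrite -(pnorm_vpol F (n + k) z1) lerDl sqr_ge0.
- apply: cabs_favg_le => // z z1; apply: le_trans le4.
  by rewrite -(pnorm_vpol F (n + k) z1) lerDr sqr_ge0.
- exact: favg_vpol_close.
Qed.

End estimates.

(** * Orthogonal polynomials and the Szego recurrence *)

Section bounded_measurable.
Context d (T : measurableType d) (R : realType).
Implicit Types (f g : T -> R) (h k : T -> R[i]).

(** A class closed under ring operations and integrable for every finite measure: it settles the
    integrability conditions for arclength and for the Jordan parts of charges alike. *)
Definition rbm f := measurable_fun setT f /\ exists M, forall x, `|f x| <= M.

Definition bm h := rbm (fun x => complex.Re (h x)) /\ rbm (fun x => complex.Im (h x)).

Lemma rbm_cst c : rbm (fun=> c).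
Proof. by split; [exact: measurable_cst|exists `|c|]. Qed.

Lemma rbmD f g : rbm f -> rbm g -> rbm (fun x => f x + g x).
Proof.
move=> [mf [M fM]] [mg [N gN]]; split; first exact: measurable_funD.
by exists (M + N) => x; apply: (le_trans (ler_normD _ _)); rewrite lerD.
Qed.

Lemma rbmM f g : rbm f -> rbm g -> rbm (fun x => f x * g x).
Proof.
move=> [mf [M fM]] [mg [N gN]]; split; first exact: measurable_funM.
by exists (M * N) => x; rewrite normrM ler_pM.
Qed.

Lemma rbmN f : rbm f -> rbm (fun x => - f x).
Proof.
move=> [mf [M fM]]; split; first exact: measurableT_comp mf.
by exists M => x; rewrite normrN.
Qed.

Lemma rbmB f g : rbm f -> rbm g -> rbm (fun x => f x - g x).
Proof. by move=> rf rg; apply: rbmD => //; exact: rbmN. Qed.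

Lemma rbm_sum (I : Type) (s : seq I) (f : I -> T -> R) : (forall i, rbm (f i)) ->
  rbm (fun x => \sum_(i <- s) f i x).
Proof.
move=> rf; elim: s => [|i s IH].
  by under eq_fun do rewrite big_nil; exact: rbm_cst.
by under eq_fun do rewrite big_cons; exact: rbmD.
Qed.

Lemma bm_cst c : bm (fun=> c).
Proof. by split; exact: rbm_cst. Qed.

Lemma Re_add (a b : R[i]) : complex.Re (a + b) = complex.Re a + complex.Re b.
Proof. by case: a b => [? ?] []. Qed.

Lemma Im_add (a b : R[i]) : complex.Im (a + b) = complex.Im a + complex.Im b.
Proof. by case: a b => [? ?] []. Qed.

Lemma Re_sub (a b : R[i]) : complex.Re (a - b) = complex.Re a - complex.Re b.
Proof. by case: a b => [? ?] []. Qed.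

Lemma Im_sub (a b : R[i]) : complex.Im (a - b) = complex.Im a - complex.Im b.
Proof. by case: a b => [? ?] []. Qed.

Lemma Re_mul (a b : R[i]) :
  complex.Re (a * b) = complex.Re a * complex.Re b - complex.Im a * complex.Im b.
Proof. by case: a b => [? ?] []. Qed.

Lemma Im_mul (a b : R[i]) :
  complex.Im (a * b) = complex.Re a * complex.Im b + complex.Im a * complex.Re b.
Proof. by case: a b => [? ?] [? ?] /=. Qed.

Lemma bmD h k : bm h -> bm k -> bm (fun x => h x + k x).
Proof.
move=> [h1 h2] [k1 k2]; split.
  by under eq_fun do rewrite Re_add; exact: rbmD.
by under eq_fun do rewrite Im_add; exact: rbmD.
Qed.

Lemma bmM h k : bm h -> bm k -> bm (fun x => h x * k x).
Proof.
move=> [h1 h2] [k1 k2]; split.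
  by under eq_fun do rewrite Re_mul; apply: rbmB; exact: rbmM.
by under eq_fun do rewrite Im_mul; apply: rbmD; exact: rbmM.
Qed.

Lemma bmX h n : bm h -> bm (fun x => h x ^+ n).
Proof.
move=> bh; elim: n => [|n IH]; first exact: bm_cst.
by under eq_fun do rewrite exprS; exact: bmM.
Qed.

Lemma bmJ h : bm h -> bm (fun x => (h x)^*%C).
Proof.
move=> [h1 h2]; split.
  by rewrite (_ : (fun x => _) = fun x => complex.Re (h x))//; apply/funext => x; case: (h x).
rewrite (_ : (fun x => _) = fun x => - complex.Im (h x)); first exact: rbmN.
by apply/funext => x; case: (h x).
Qed.

Lemma bm_real f : rbm f -> bm (fun x => (f x)%:C).
Proof. by move=> rf; split => //=; exact: rbm_cst. Qed.

Lemma bm_sum (I : Type) (s : seq I) (h : I -> T -> R[i]) : (forall i, bm (h i)) ->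
  bm (fun x => \sum_(i <- s) h i x).
Proof.
move=> bh; elim: s => [|i s IH].
  by under eq_fun do rewrite big_nil; exact: bm_cst.
by under eq_fun do rewrite big_cons; exact: bmD.
Qed.

Lemma bm_horner (p : {poly R[i]}) h : bm h -> bm (fun x => p.[h x]).
Proof.
move=> bh; under eq_fun do rewrite horner_coef.
by apply: bm_sum => i; apply: bmM; [exact: bm_cst|exact: bmX].
Qed.

Lemma rbm_cabs_sqr h : bm h -> rbm (fun x => cabs (h x) ^+ 2).
Proof.
move=> [h1 h2]; under eq_fun do rewrite cabs_sqrE.
by apply: rbmD; apply: rbmM.
Qed.

Lemma rbm_integrable (m : {measure set T -> \bar R}) f : (m setT < +oo)%E -> rbm f ->
  m.-integrable setT (EFin \o f).
Proof.
move=> mT [mf [M fM]]; apply: measurable_bounded_integrable => //.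
by exists M; split; rewrite ?num_real// => N MN x _ /=; rewrite (le_trans (fM x))// ltW.
Qed.

End bounded_measurable.

Section charge_integral.
Context d (T : measurableType d) (R : realType).
Implicit Types (f g : T -> R) (nu : {charge set T -> \bar R}).

Lemma jordan_pos_lty nu P N (PN : hahn_decomposition nu P N) : (jordan_pos PN setT < +oo)%E.
Proof. by rewrite ltey_eq fin_num_measure. Qed.

Lemma jordan_neg_lty nu P N (PN : hahn_decomposition nu P N) : (jordan_neg PN setT < +oo)%E.
Proof. by rewrite ltey_eq fin_num_measure. Qed.

Lemma charge_integralD nu f g : rbm f -> rbm g ->
  charge_integral nu (fun x => f x + g x) = charge_integral nu f + charge_integral nu g.
Proof.
move=> rf rg; rewrite /charge_integral !RintegralD//;
  do ?[exact: rbm_integrable (jordan_pos_lty _) _ |exact: rbm_integrable (jordan_neg_lty _) _].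
by ring.
Qed.

Lemma charge_integralZ nu c f : rbm f ->
  charge_integral nu (fun x => c * f x) = c * charge_integral nu f.
Proof.
move=> rf; rewrite /charge_integral !RintegralZl//;
  do ?[exact: rbm_integrable (jordan_pos_lty _) _ |exact: rbm_integrable (jordan_neg_lty _) _].
by ring.
Qed.

Variable mu : complex_measure T R.

Lemma cintegralD h k : bm h -> bm k ->
  cintegral mu (fun x => h x + k x) = cintegral mu h + cintegral mu k.
Proof.
move=> [h1 h2] [k1 k2]; rewrite /cintegral.
have -> : (fun x => complex.Re (h x + k x)) = (fun x => complex.Re (h x) + complex.Re (k x)).
  by apply/funext => x; rewrite Re_add.
have -> : (fun x => complex.Im (h x + k x)) = (fun x => complex.Im (h x) + complex.Im (k x)).
  by apply/funext => x; rewrite Im_add.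
rewrite !charge_integralD//; apply/eqP; rewrite eq_complex /=.
by apply/andP; split; apply/eqP; ring.
Qed.

Lemma cintegralZ c h : bm h ->
  cintegral mu (fun x => c * h x) = c * cintegral mu h.
Proof.
move=> [h1 h2]; rewrite /cintegral; case: c => a b.
have -> : (fun x => complex.Re ((a +i* b) * h x)) = (fun x => a * complex.Re (h x) + - b * complex.Im (h x)).
  by apply/funext => x; rewrite Re_mul mulNr.
have -> : (fun x => complex.Im ((a +i* b) * h x)) = (fun x => a * complex.Im (h x) + b * complex.Re (h x)).
  by apply/funext => x; rewrite Im_mul.
have H c f : rbm f -> rbm (fun x => c * f x) by move=> ?; apply: rbmM => //; exact: rbm_cst.
rewrite !charge_integralD; do ?exact: H.
rewrite !charge_integralZ//; apply/eqP; rewrite eq_complex /=.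
by apply/andP; split; apply/eqP; ring.
Qed.

End charge_integral.

Section circle.
Context {R : realType}.
Implicit Types (s : circle R).

Lemma cabs_cval s : cabs (cval s) = 1.
Proof. by case: s => z zu; exact: (set_mem zu). Qed.

Lemma continuous_circle_measurable (f : circle_top R -> R) : continuous f ->
  measurable_fun setT (f : circle R -> R).
Proof.
move=> /continuousP cf.
apply: (@measurability _ _ (circle R) R setT f _ (RGenOpens.measurableE R)) => //.
move=> _ [_ [x [y ->]] <-]; rewrite setTI; apply: sub_sigma_algebra; apply: cf; exact: interval_open.
Qed.

Lemma cval_continuous : continuous (@cval R : circle_top R -> R[i]).
Proof. exact: initial_continuous. Qed.

Lemma Re_continuous : continuous (fun z : R[i] => complex.Re z).
Proof.
move=> z; apply/(@cvgrPdist_le _ _ _ (nbhs z) (nbhs_filter z)) => /= e e0.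
have e0' : 0 < e%:C by rewrite ltcR.
near=> t.
have : `|z - t| <= e%:C.
  by near: t; move: (e%:C) e0'; apply/(@cvgrPdist_le _ _ _ (nbhs z) (nbhs_filter z)); exact: cvg_id.
rewrite cabs_norm lecR; apply: le_trans.
have := normc_ge_Re (z - t); rewrite cabs_norm lecR.
by rewrite Re_sub.
Unshelve. all: by end_near. Qed.

Lemma Im_continuous : continuous (fun z : R[i] => complex.Im z).
Proof.
move=> z; apply/(@cvgrPdist_le _ _ _ (nbhs z) (nbhs_filter z)) => /= e e0.
have e0' : 0 < e%:C by rewrite ltcR.
near=> t.
have : `|z - t| <= e%:C.
  by near: t; move: (e%:C) e0'; apply/(@cvgrPdist_le _ _ _ (nbhs z) (nbhs_filter z)); exact: cvg_id.
rewrite cabs_norm lecR; apply: le_trans.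
have := normc_ge_Re ((z - t) * 'i); rewrite cabs_norm lecR.
rewrite ComplexField.Normc.normcM /= expr0n expr1n add0r sqrtr1 mulr1 ReiNIm normrN.
by rewrite Im_sub.
Unshelve. all: by end_near. Qed.

Lemma cabs_Re (z : R[i]) : `|complex.Re z| <= cabs z.
Proof. by have := normc_ge_Re z; rewrite cabs_norm lecR. Qed.

Lemma cabs_Im (z : R[i]) : `|complex.Im z| <= cabs z.
Proof.
have := cabs_Re (z * 'i).
by rewrite ComplexField.Normc.normcM /= expr0n expr1n add0r sqrtr1 mulr1 ReiNIm normrN.
Qed.

Lemma bm_cval : bm (@cval R).
Proof.
split; split.
- apply: continuous_circle_measurable => s.
  by apply: continuous_comp; [exact: cval_continuous|exact: Re_continuous].
- by exists 1 => s; rewrite (le_trans (cabs_Re _))// cabs_cval.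
- apply: continuous_circle_measurable => s.
  by apply: continuous_comp; [exact: cval_continuous|exact: Im_continuous].
- by exists 1 => s; rewrite (le_trans (cabs_Im _))// cabs_cval.
Qed.

Lemma bm_horner_cval (p : {poly R[i]}) : bm (fun s : circle R => p.[cval s]).
Proof. by apply: bm_horner; exact: bm_cval. Qed.

Lemma bm_hornerJ (p q : {poly R[i]}) : bm (fun s : circle R => p.[cval s] * (q.[cval s])^*%C).
Proof. by apply: bmM; [|apply: bmJ]; exact: bm_horner_cval. Qed.

End circle.

(** * Reversed polynomials, Toeplitz forms and the abstract Szego recurrence *)

Section rev_poly.
Context {R : rcfType}.
Implicit Types p q : {poly R[i]}.

Lemma rev_polyK m p : (size p <= m.+1)%N -> rev_poly m (rev_poly m p) = p.
Proof.
move=> pm; apply/polyP => i; rewrite coef_rev_poly ?size_poly//.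
case: leqP => im; last by rewrite nth_default// (leq_trans pm).
by rewrite coef_rev_poly// leq_subr conjcK subKn.
Qed.

Lemma rev_polyZ m c p : rev_poly m (c *: p) = c^*%C *: rev_poly m p.
Proof.
apply/polyP => i; rewrite coefZ !coef_poly; case: ifP => _; rewrite ?mulr0//.
by rewrite coefZ rmorphM.
Qed.

Lemma rev_poly_low m p : (size p <= m.+1)%N -> rev_poly m.+1 p = 'X * rev_poly m p.
Proof.
move=> pm; apply/polyP => i; rewrite coefXM !coef_poly.
case: i => [|i] /=; first by rewrite subn0 nth_default// conjc0.
by rewrite subSS.
Qed.

Lemma size_rev_poly m p : (size (rev_poly m p) <= m.+1)%N.
Proof. exact: size_poly. Qed.

Lemma horner_rev_poly_star {R' : realType} m (p : {poly R'[i]}) z :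
  (size p <= m.+1)%N -> z != 0 ->
  (rev_poly m p).[z] = z ^+ m * star (horner p) z.
Proof.
move=> pm z0; rewrite /star.
rewrite (horner_coef_wide z (size_poly _ _)) (horner_coef_wide _ pm).
rewrite rmorph_sum mulr_sumr [RHS](reindex_inj rev_ord_inj); apply: eq_bigr => i _ /=.
rewrite coef_poly ltn_ord subSS rmorphM /= mulrCA; congr (_ * _).
have im : (i <= m)%N by rewrite -ltnS.
rewrite rmorphXn /= conjc_inv conjcK -{2}(subnK im) exprD mulrAC exprVn mulfV ?mul1r//.
by rewrite expf_eq0 (negbTE z0) andbF.
Qed.

End rev_poly.

Section toeplitz.
Context {R : rcfType}.
Implicit Types (p q : {poly R[i]}) (L : {poly R[i]} -> {poly R[i]} -> R[i]).

(** What remains of the pairing for a complex measure, where Hermitian symmetry may fail: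
    sesquilinearity, invariance under multiplication by z, and a symmetry under reversal, which
    holds because the integral of p q z^-m is symmetric in p and q. *)
Definition toeplitz L :=
  [/\ forall c p p' q, L (c *: p + p') q = c * L p q + L p' q,
      forall c p q q', L p (c *: q + q') = c^*%C * L p q + L p q',
      forall p q, L ('X * p) ('X * q) = L p q &
      forall m p q, (size p <= m.+1)%N -> (size q <= m.+1)%N ->
        L p (rev_poly m q) = L q (rev_poly m p)].

Definition lorth L n p := [/\ p \is monic, size p = n.+1 &
  forall q, (size q <= n)%N -> L p q = 0].

(** Exchanges left and right orthogonality, so each statement on left orthogonal polynomials yields
    the right one. *)
Definition dualform L p q := (L q p)^*%C.

Lemma toeplitz_dual L : toeplitz L -> toeplitz (dualform L).
Proof.
move=> [L1 L2 L3 L4]; split; rewrite /dualform.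
- by move=> c p p' q; rewrite L2 rmorphD rmorphM /= conjcK.
- by move=> c p p' q; rewrite L1 rmorphD rmorphM /=.
- by move=> p q; rewrite L3.
- move=> m p q pm qm; congr (_^*%C).
  by rewrite -{1}(rev_polyK pm) L4 ?size_rev_poly// rev_polyK.
Qed.

Variable L : {poly R[i]} -> {poly R[i]} -> R[i].
Hypothesis tL : toeplitz L.

Lemma toeplitz0l q : L 0 q = 0.
Proof.
case: tL => L1 _ _ _; have := L1 (-1) 0 0 q.
by rewrite scaler0 add0r mulN1r addNr.
Qed.

Lemma toeplitz0r q : L q 0 = 0.
Proof.
case: tL => _ L1 _ _; have := L1 (-1) q 0 0.
by rewrite scaler0 add0r rmorphN1 mulN1r addNr.
Qed.

Lemma toeplitzB p p' q : L (p - p') q = L p q - L p' q.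
Proof.
case: tL => L1 _ _ _; have := L1 (-1) p' p q.
by rewrite scaleN1r addrC mulN1r => ->; rewrite addrC.
Qed.

Lemma toeplitzZl c p q : L (c *: p) q = c * L p q.
Proof. by case: tL => L2 _ _ _; have := L2 c p 0 q; rewrite toeplitz0l !addr0. Qed.

Lemma lorth_size_sub n p P : lorth L n P -> (size p <= n.+1)%N ->
  (size (p - p`_n *: P)%R <= n)%N.
Proof.
move=> [/monicP mP sP _] pn.
apply/leq_sizeP => j nj; rewrite coefB coefZ.
case: ltngtP nj => // [nj|<-] _.
  by rewrite (nth_default _ (leq_trans pn nj)) [P`_j]nth_default ?sP// mulr0 subr0.
by move: mP; rewrite lead_coefE sP /= => ->; rewrite mulr1 subrr.
Qed.

(* A polynomial of degree at most [n] orthogonal to all lower degrees is a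
   multiple of [P]: otherwise adding it to [P] would contradict uniqueness. *)
Lemma lorth_unique_scale n P q : unique (lorth L n) P -> (size q <= n.+1)%N ->
  (forall p, (size p <= n)%N -> L q p = 0) -> q = q`_n *: P.
Proof.
move=> [[mP sP oP] uP] qn oq.
have sr := lorth_size_sub (And3 mP sP oP) qn; set r := q - q`_n *: P in sr.
suff /uP e : lorth L n (P + r).
  by apply/eqP; rewrite -subr_eq0 -/r; apply/eqP/(addrI P); rewrite addr0 -e.
split.
- by rewrite monicE lead_coefDl -?monicE// sP ltnS.
- by rewrite size_polyDl// sP ltnS.
- move=> p pn; case: tL => L1 _ _ _.
  by rewrite -[P]scale1r L1 oP// mulr0 add0r toeplitzB toeplitzZl oP// oq// mulr0 subrr.
Qed.

End toeplitz.

Section szego.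
Context {R : rcfType}.
Implicit Types (p q : {poly R[i]}).
Variable L : {poly R[i]} -> {poly R[i]} -> R[i].
Hypothesis tL : toeplitz L.

Definition szego_step n (P P' T : {poly R[i]}) c :=
  P' - 'X * P = c^*%C *: rev_poly n T.

(** In P' - z P the leading terms cancel, and what is left is orthogonal to z q for deg q < n, by
    orthogonality of P' and shift invariance. Its reversal is therefore orthogonal in the dual form
    to all lower degrees, and uniqueness makes it a multiple of T. *)
Lemma szego_recurrence n P P' T : lorth L n P -> lorth L n.+1 P' ->
  unique (lorth (dualform L) n) T -> exists c, szego_step n P P' T c.
Proof.
move=> [/monicP mP sP oP] [/monicP mP' sP' oP'] uT.
case: (tL) => L1 L2 L3 L4.
set D := P' - 'X * P.
have sD : (size D <= n.+1)%N.
  apply/leq_sizeP => j nj; rewrite coefB coefXM.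
  case: j nj => // j nj /=; rewrite ltnS in nj.
  case: ltngtP nj => // [nj|<-] _.
    by rewrite !nth_default ?subrr ?sP ?sP'.
  move: mP mP'; rewrite !lead_coefE sP sP' /= => -> ->.
  by rewrite subrr.
suff e : rev_poly n D = (rev_poly n D)`_n *: T.
  by exists (rev_poly n D)`_n; rewrite /szego_step -/D -rev_polyZ -e rev_polyK.
apply: (lorth_unique_scale (toeplitz_dual tL)) uT _ _ => //; first exact: size_rev_poly.
move=> p pn; rewrite /dualform L4//; last exact: leqW.
(* For n = 0 the only test polynomial is 0. Otherwise the reversal of [p] has a factor 'X, to which
   shift invariance applies. *)
case: n pn sD oP oP' mP mP' sP sP' => [|n] pn sD oP oP' mP mP' sP sP'.
  by move: pn; rewrite leqn0 size_poly_eq0 => /eqP ->; rewrite [X in L _ X](_ : _ = 0) ?(toeplitz0r tL) ?conjc0//;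
    apply/polyP => i; rewrite coef_poly !coef0 conjc0 if_same.
rewrite rev_poly_low// /D (toeplitzB tL) L3 oP ?oP' ?subrr ?conjc0//; last exact: size_rev_poly.
apply: (leq_trans (size_polyMleq _ _)); rewrite size_polyX /=.
by rewrite ltnS size_rev_poly.
Qed.

(** Since P' is orthogonal to the reversal of P, T' may be replaced by z T. Expanding P', the term z
    P gives <P, T> by shift invariance; in the other term z T equals T' minus a multiple of the
    reversal of P, and the symmetry under reversal gives <P, T> again. *)
Lemma szego_norm n P P' T T' c d : lorth L n P -> lorth L n.+1 P' ->
  lorth (dualform L) n T -> lorth (dualform L) n.+1 T' ->
  szego_step n P P' T c -> szego_step n T T' P d ->
  L P' T' = L P T * (1 - c^*%C * d).
Proof.
move=> [mP sP oP] [mP' sP' oP'] [mT sT oT] [mT' sT' oT'] hc hd.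
case: (tL) => L1 L2 L3 L4.
have eT' : T' = d^*%C *: rev_poly n P + 'X * T by rewrite -hd subrK.
have eP' : P' = c^*%C *: rev_poly n T + 'X * P by rewrite -hc subrK.
have o1 q : (size q <= n.+1)%N -> L q T' = 0.
  by move=> /oT' /(congr1 conjc); rewrite /dualform conjcK conjc0.
rewrite {1}eT' L2 oP' ?size_rev_poly// mulr0 add0r {1}eP' L1 L3.
have -> : 'X * T = (- d^*%C) *: rev_poly n P + T' by rewrite eT' addrA -scalerDl addNr scale0r add0r.
rewrite L2 o1 ?size_rev_poly// addr0 rmorphN /= conjcK.
by rewrite L4 ?sP// ?rev_polyK ?sT// ?size_rev_poly//; ring.
Qed.

End szego.

#[local] Arguments Fcoef : simpl never.
#[local] Arguments tFcoef : simpl never.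

(** * The pairing on the circle and its link with the evolution *)

Section circle_pairing.
Context {R : realType} (mu : circle_measure R).
Implicit Types (p q : {poly R[i]}).

Lemma star_unit p z : cabs z = 1 -> star (horner p) z = (p.[z])^*%C.
Proof.
by move=> z1; rewrite /star (unit_conjV z1) invrK.
Qed.

Lemma pairingE p q :
  pairing mu p q = cintegral mu (fun s => p.[cval s] * (q.[cval s])^*%C).
Proof.
by congr (cintegral mu _); apply/funext => s; rewrite star_unit// cabs_cval.
Qed.

Lemma toeplitz_pairing : toeplitz (pairing mu).
Proof.
split=> [c p p' q|c p q q'|p q|m p q pm qm]; rewrite !pairingE.
- rewrite -(cintegralZ mu c (bm_hornerJ p q)) -(cintegralD mu (bmM (bm_cst _ c) (bm_hornerJ p q)) (bm_hornerJ p' q)).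
  by congr (cintegral mu _); apply/funext => s; rewrite hornerD hornerZ mulrDl mulrA.
- rewrite -(cintegralZ mu c^*%C (bm_hornerJ p q)) -(cintegralD mu (bmM (bm_cst _ c^*%C) (bm_hornerJ p q)) (bm_hornerJ p q')).
  congr (cintegral mu _); apply/funext => s; rewrite hornerD hornerZ rmorphD rmorphM /=.
  by rewrite mulrDr mulrCA.
- congr (cintegral mu _); apply/funext => s; rewrite !hornerM !hornerX rmorphM /=.
  by rewrite mulrACA unit_conj ?cabs_cval// mul1r.
- congr (cintegral mu _); apply/funext => s.
  rewrite !horner_rev_poly ?cabs_cval// !rmorphM /= !conjcK.
  by rewrite mulrCA [RHS]mulrCA; congr (_ * _); rewrite mulrC.
Qed.

Hypothesis hT : class_T mu.

Lemma left_monicP n q : left_monic mu n q <-> lorth (pairing mu) n q.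
Proof.
by split=> -[m s o]; split => // p pn; apply: o; move: pn; rewrite s ltnS.
Qed.

Lemma right_monicP n q : right_monic mu n q <-> lorth (dualform (pairing mu)) n q.
Proof.
split=> -[m s o]; split => // p pn.
  by rewrite /dualform o ?conjc0// s.
have := o p; rewrite -ltnS -s => /(_ pn) /(congr1 conjc).
by rewrite /dualform conjcK conjc0.
Qed.

Lemma Phi_unique n : unique (lorth (pairing mu) n) (Phi mu n).
Proof.
have [[P [lP uP]] _] := hT.2 n.
have -> : Phi mu n = P by rewrite /Phi; apply: xget_unique => // Q /uP ->.
by split; [exact/left_monicP|move=> Q /left_monicP; exact: uP].
Qed.

Lemma tPhi_unique n : unique (lorth (dualform (pairing mu)) n) (tPhi mu n).
Proof.
have [_ [P [lP uP]]] := hT.2 n.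
have -> : tPhi mu n = P by rewrite /tPhi; apply: xget_unique => // Q /uP ->.
by split; [exact/right_monicP|move=> Q /right_monicP; exact: uP].
Qed.

(** From right to left, multiplication by 'X extends the pointwise identity to z = 0; the difference
    then vanishes at more points than its degree allows. *)
Lemma szego_step_horner n (P P' T : {poly R[i]}) c : (size T <= n.+1)%N ->
  szego_step n P P' T c <-> forall z : R[i], z != 0 ->
    P'.[z] - z * P.[z] = c^*%C * z ^+ n * star (horner T) z.
Proof.
move=> sT; split=> [e z z0|e].
  have := congr1 (fun p => p.[z]) e.
  by rewrite hornerD hornerN hornerM hornerX hornerZ horner_rev_poly_star// mulrA.
have XI : injective (fun p : {poly R[i]} => 'X * p) by move=> p q; apply: mulfI; rewrite -size_poly_eq0 size_polyX.
apply: XI; set p := 'X * _; set q := 'X * _.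
apply/eqP; rewrite -subr_eq0; apply/eqP; set r := p - q.
have r0 z : r.[z] = 0.
  rewrite /r /p /q hornerD hornerN !hornerM !hornerX.
  have [->|z0] := eqVneq z 0; first by rewrite !mul0r subrr.
  by rewrite -mulrBr hornerD hornerN hornerM hornerX hornerZ e// horner_rev_poly_star// mulrA subrr mulr0.
apply/eqP/negPn/negP => rn0.
have := @max_poly_roots _ r [seq (i%:R : R[i]) | i <- iota 0 (size r)] rn0.
rewrite size_map size_iota ltnn => H; suff : false by []; apply: H.
  by apply/allP => x _; rewrite rootE r0.
by rewrite map_inj_uniq ?iota_uniq// => i j /eqP; rewrite eqr_nat => /eqP.
Qed.

(** The existence part of the recurrence excludes the default value of [xget]. *)
Lemma FcoefP n : szego_step n (Phi mu n) (Phi mu n.+1) (tPhi mu n) (Fcoef mu n.+1).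
Proof.
have [lT _] := tPhi_unique n; have sT : (size (tPhi mu n) <= n.+1)%N by case: lT => _ ->.
have [c hc] := szego_recurrence toeplitz_pairing (Phi_unique n).1 (Phi_unique n.+1).1 (tPhi_unique n).
apply/(szego_step_horner _ _ _ sT) => z z0; rewrite /Fcoef.
case: xgetP => [x _ /(_ z z0) //|/(_ c) []].
exact/(szego_step_horner _ _ _ sT).
Qed.

Lemma tFcoefP n : szego_step n (tPhi mu n) (tPhi mu n.+1) (Phi mu n) (tFcoef mu n.+1).
Proof.
have [lT _] := Phi_unique n; have sT : (size (Phi mu n) <= n.+1)%N by case: lT => _ ->.
have dd : dualform (dualform (pairing mu)) = pairing mu.
  by apply/funext => p; apply/funext => q; rewrite /dualform conjcK.
have uP := Phi_unique n; rewrite -dd in uP.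
have [c hc] := szego_recurrence (toeplitz_dual toeplitz_pairing)
  (tPhi_unique n).1 (tPhi_unique n.+1).1 uP.
apply/(szego_step_horner _ _ _ sT) => z z0; rewrite /tFcoef.
case: xgetP => [x _ /(_ z z0) //|/(_ c) []].
exact/(szego_step_horner _ _ _ sT).
Qed.

Lemma monic_size1 p : p \is monic -> size p = 1%N -> p = 1.
Proof.
by move=> /monicP m s; rewrite (size1_polyC (eq_leq s)); move: m; rewrite lead_coefE s /= => ->.
Qed.

Lemma Phi0 : Phi mu 0 = 1.
Proof. by have [[m s _] _] := Phi_unique 0; exact: monic_size1. Qed.

Lemma tPhi0 : tPhi mu 0 = 1.
Proof. by have [[m s _] _] := tPhi_unique 0; exact: monic_size1. Qed.

Hypothesis hF : forall n, (1 <= n)%N -> Fcoef mu n = - tFcoef mu n.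

Lemma pairing_Phi n :
  pairing mu (Phi mu n) (tPhi mu n) = ((\prod_(i < n) cfac (Fcoef mu i.+1)) ^- 2)%:C.
Proof.
elim: n => [|n IH].
  rewrite big_ord0 expr1n invr1 Phi0 tPhi0 pairingE -[RHS](hT.1 : cintegral mu (fun=> 1) = 1).
  by congr (cintegral mu _); apply/funext => s; rewrite !hornerC conjc1 mulr1.
rewrite (szego_norm toeplitz_pairing (Phi_unique n).1 (Phi_unique n.+1).1
  (tPhi_unique n).1 (tPhi_unique n.+1).1 (FcoefP n) (tFcoefP n)) IH.
rewrite big_ord_recr /= exprMn [in RHS]invfM [RHS]rmorphM /=; congr (_ * _).
rewrite cfac_sqr invrK rmorphD /= cabsC_sqr hF//.
by rewrite rmorphN /=; ring.
Qed.

Lemma szego_normalized (c d f z zn P T : R[i]) :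
  c^*%C = c -> z * z^*%C = 1 -> zn * zn^*%C = 1 ->
  d * (c * (zn * P^*%C) + f * (z * zn) * (c * (zn * T^*%C))^*%C) =
  c * d * (z * zn * (f^*%C * zn * T^*%C + z * P)^*%C).
Proof.
move=> cJ zz zn1; rewrite !(rmorphD, rmorphM) /= !conjcK cJ.
transitivity (c * d * (z * f * (zn * zn^*%C) * T + 1 * zn * P^*%C)); first by ring.
by rewrite -zz; ring.
Qed.

(** On the circle, z^(n+1) times the conjugate of the recurrence for Phi is u + F z^(n+1) conj(w)
    before normalization. The relation tF = - F supplies the minus sign in the second component of
    [step]. *)
Lemma vpol_Phi n z : cabs z = 1 ->
  let c := (\prod_(i < n) cfac (Fcoef mu i.+1))%:C in
  (vpol (Fcoef mu) n).1.[z] = c * (z ^+ n * ((Phi mu n).[z])^*%C) /\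
  (vpol (Fcoef mu) n).2.[z] = c * (z ^+ n * ((tPhi mu n).[z])^*%C).
Proof.
move=> z1; have zz := unit_conj z1.
have zzn k : z ^+ k * (z^*%C) ^+ k = 1 by rewrite -exprMn zz expr1n.
elim: n => [|n] /=.
  by rewrite big_ord0 Phi0 tPhi0 !hornerC conjc1 !mul1r.
move=> [e1 e2].
have [e3 e4] := horner_step (Fcoef mu) (vpol_deg (Fcoef mu) n) z1.
rewrite /vpol /= add0n e3 e4 -/(vpol _ n) e1 e2 big_ord_recr /= (rmorphM (real_complex R)).
have sT : (size (tPhi mu n) <= n.+1)%N by have [[_ -> _] _] := tPhi_unique n.
have sP : (size (Phi mu n) <= n.+1)%N by have [[_ -> _] _] := Phi_unique n.
have z0 : z != 0.
  by apply/eqP => z0; move: z1; rewrite z0 ComplexField.Normc.normc0 => /eqP; rewrite eq_sym oner_eq0.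
have := (szego_step_horner (Phi mu n) (Phi mu n.+1) (Fcoef mu n.+1) sT).1 (FcoefP n) z z0.
have := (szego_step_horner (tPhi mu n) (tPhi mu n.+1) (tFcoef mu n.+1) sP).1 (tFcoefP n) z z0.
rewrite !star_unit//.
have -> : tFcoef mu n.+1 = - Fcoef mu n.+1 by rewrite hF// opprK.
move=> /(canRL (subrK _)) -> /(canRL (subrK _)) ->.
have cJ (c : R) : c%:C^*%C = c%:C by exact: conjc_real.
have zn : z ^+ n * (z ^+ n)^*%C = 1 by rewrite rmorphXn; exact: zzn.
rewrite exprS -!mulNr; split; by apply: szego_normalized; rewrite ?cJ ?z1.
Qed.

Lemma phi_vpol n s :
  star (horner (phi mu n)) (cval s) * (tphi mu n).[cval s] =
  (vpol (Fcoef mu) n).1.[cval s] * ((vpol (Fcoef mu) n).2.[cval s])^*%C.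
Proof.
have z1 := cabs_cval s; move: (cval s) z1 => z z1.
rewrite star_unit// /phi /tphi !hornerZ rmorphM /= pairing_Phi.
have [-> ->] := vpol_Phi n z1.
set k := _ ^- 2; set P := (Phi mu n).[z]; set T := (tPhi mu n).[z].
have k0 : 0 < k by rewrite invr_gt0 exprn_gt0// prodr_gt0// => i _; exact: cfac_gt0.
have e : (sqrtC k%:C)^-1^*%C * (sqrtC k%:C)^-1 = (k^-1)%:C.
  have s0 : 0 <= sqrtC k%:C by rewrite sqrtC_ge0 ler0c ltW.
  have sr : (sqrtC k%:C)^*%C = sqrtC k%:C.
    by move: s0; rewrite -{1}[0]/((0 : R)%:C) lecE; case: (sqrtC _) => a b /= /andP[/eqP -> _]; rewrite oppr0.
  by rewrite conjc_inv sr -invfM -expr2 sqrtCK [RHS](fmorphV (real_complex R)).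
have zn : z ^+ n * (z ^+ n)^*%C = 1 by rewrite rmorphXn -exprMn unit_conj// expr1n.
rewrite mulrACA e /k invrK (rmorphXn (real_complex R)) /=.
have : ((\prod_(i < n) cfac (Fcoef mu i.+1))%:C)^*%C = (\prod_(i < n) cfac (Fcoef mu i.+1))%:C.
  exact: conjc_real.
move: (_%:C) (z ^+ n) zn => c zn zn1 cJ.
rewrite !rmorphM /= conjcK cJ.
have -> : c * (zn * P^*%C) * (c * (zn^*%C * T)) = c ^+ 2 * (P^*%C * T) * (zn * zn^*%C) by ring.
by rewrite zn1 mulr1.
Qed.

End circle_pairing.

(** * Fejer means on the circle *)

Section arclength.
Context {R : realType}.
Implicit Types (f : circle R -> R) (h : circle R -> R[i]).
Local Notation leb := (@lebesgue_measure R).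
Local Notation per := `[(0 : R), 2 * pi[%classic.

Lemma ge0_integral_arclength (f : circle R -> \bar R) : measurable_fun setT f ->
  (forall s, (0 <= f s)%E) ->
  (\int[arclength R]_s f s = \int[leb]_(t in per) f (cis t))%E.
Proof.
move=> mf f0.
rewrite ge0_integral_pushforward//=; last exact: measurable_cis.
rewrite preimage_setT.
have mfc : measurable_fun setT (f \o @cis R) by apply: measurableT_comp => //; exact: measurable_cis.
have m0 : mrestr leb (measurable_itv `[0, 2 * pi[) (~` per) = 0%E.
  by rewrite /= /mrestr setICl measure0.
rewrite (@ge0_negligible_integral _ _ R (mrestr leb (measurable_itv `[0, 2 * pi[))
  setT (~` per) (f \o @cis R))//; last 2 first.
- by apply: measurableC; exact: measurable_itv.
- by move=> x _; exact: f0.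
rewrite setDE setCK setTI; apply: eq_measure_integral => A mA Aper.
by rewrite /= /mrestr setIidl.
Qed.

Lemma arclength_lty : (arclength R setT < +oo)%E.
Proof.
rewrite /arclength /pushforward preimage_setT /mrestr setTI lebesgue_measure_itv /=.
by case: ifP => _; rewrite ?ltry// -EFinD ltry.
Qed.

Lemma Rintegral_arclength f : rbm f ->
  \int[arclength R]_s f s = \int[leb]_(t in per) f (cis t).
Proof.
move=> rf; rewrite /Rintegral; congr fine.
have mper : (leb per < +oo)%E.
  by rewrite lebesgue_measure_itv /=; case: ifP => _; rewrite ?ltry// -EFinD ltry.
have ifc : (mrestr leb (measurable_itv `[0, 2 * pi[)).-integrable setT (EFin \o (f \o @cis R)).
  apply: rbm_integrable.
    by rewrite /= /mrestr setTI.
  case: rf => mf [M fM]; split; last by exists M => x; exact: fM.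
  by apply: measurableT_comp => //; exact: measurable_cis.
rewrite integral_pushforward//=; last 2 first.
- exact: measurable_cis.
- by case: rf => mf _; exact/measurable_EFinP.
have m0 : mrestr leb (measurable_itv `[0, 2 * pi[) (~` per) = 0%E.
  by rewrite /= /mrestr setICl measure0.
rewrite preimage_setT.
rewrite (@negligible_integral _ _ R (mrestr leb (measurable_itv `[0, 2 * pi[))
  setT (~` per) (EFin \o (f \o @cis R)))//; last first.
- by apply: measurableC; exact: measurable_itv.
rewrite setDE setCK setTI; apply: eq_measure_integral => A mA Aper.
by rewrite /= /mrestr setIidl.
Qed.

End arclength.

Section means.
Context {R : realType}.
Implicit Types (f g : circle R -> R) (h k : circle R -> R[i]).
Local Notation leb := (@lebesgue_measure R).

Definition rmean f : R := (2 * pi)^-1 * \int[arclength R]_s f s.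

Definition cmean h : R[i] :=
  rmean (fun s => complex.Re (h s)) +i* rmean (fun s => complex.Im (h s)).

Lemma rbm_arclength_integrable f : rbm f -> (arclength R).-integrable setT (EFin \o f).
Proof. exact: rbm_integrable arclength_lty. Qed.

Lemma rmeanD f g : rbm f -> rbm g -> rmean (fun s => f s + g s) = rmean f + rmean g.
Proof.
by move=> rf rg; rewrite /rmean RintegralD ?mulrDr//; exact: rbm_arclength_integrable.
Qed.

Lemma rmeanZ c f : rbm f -> rmean (fun s => c * f s) = c * rmean f.
Proof.
by move=> rf; rewrite /rmean RintegralZl ?(mulrCA _ c)//; exact: rbm_arclength_integrable.
Qed.

Lemma cmeanD h k : bm h -> bm k -> cmean (fun s => h s + k s) = cmean h + cmean k.
Proof.
move=> [h1 h2] [k1 k2]; rewrite /cmean.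
have -> : (fun x => complex.Re (h x + k x)) = (fun x => complex.Re (h x) + complex.Re (k x)).
  by apply/funext => x; rewrite Re_add.
have -> : (fun x => complex.Im (h x + k x)) = (fun x => complex.Im (h x) + complex.Im (k x)).
  by apply/funext => x; rewrite Im_add.
by rewrite !rmeanD.
Qed.

Lemma cmeanZ c h : bm h -> cmean (fun s => c * h s) = c * cmean h.
Proof.
move=> [h1 h2]; rewrite /cmean; case: c => a b.
have -> : (fun x => complex.Re ((a +i* b) * h x)) = (fun x => a * complex.Re (h x) + - b * complex.Im (h x)).
  by apply/funext => x; rewrite Re_mul mulNr.
have -> : (fun x => complex.Im ((a +i* b) * h x)) = (fun x => a * complex.Im (h x) + b * complex.Re (h x)).
  by apply/funext => x; rewrite Im_mul.
have H c f : rbm f -> rbm (fun x => c * f x) by move=> ?; apply: rbmM => //; exact: rbm_cst.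
rewrite !rmeanD; do ?exact: H.
rewrite !rmeanZ//; apply/eqP; rewrite eq_complex /=.
by apply/andP; split; apply/eqP; ring.
Qed.

Lemma cmean_sum (I : Type) (r : seq I) (h : I -> circle R -> R[i]) : (forall i, bm (h i)) ->
  cmean (fun s => \sum_(i <- r) h i s) = \sum_(i <- r) cmean (h i).
Proof.
move=> bh; elim: r => [|i r IH].
  under eq_fun do rewrite big_nil.
  rewrite big_nil /cmean /= /rmean !Rintegral_cst//= mul0r mulr0.
  by [].
under eq_fun do rewrite big_cons.
by rewrite cmeanD ?IH ?big_cons//; exact: bm_sum.
Qed.

Lemma cvalXn t n : cval (cis t : circle R) ^+ n = cos (n%:R * t) +i* sin (n%:R * t).
Proof.
elim: n => [|n IH]; first by rewrite expr0 mul0r cos0 sin0.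
rewrite exprS IH -natr1 mulrDl mul1r cosD sinD /cval /cis /set_val /=.
by apply/eqP; rewrite eq_complex /=; apply/andP; split; apply/eqP; ring.
Qed.

Lemma trig_2pi n : cos (n%:R * (2 * pi)) = 1 :> R /\ sin (n%:R * (2 * pi)) = 0 :> R.
Proof.
have -> : 2 * pi = pi *+ 2 :> R by rewrite mulr_natl.
elim: n => [|n [c s]]; first by rewrite mul0r cos0 sin0.
by rewrite -natr1 mulrDl mul1r cosD2pi sinD2pi.
Qed.

Lemma pi2_gt0 : 0 < 2 * pi :> R.
Proof. by rewrite mulr_gt0// pi_gt0. Qed.

Lemma integral_trig (f F : R -> R) : (forall t : R, is_derive t 1 F (f t)) -> continuous f ->
  F (2 * pi) = F 0 -> \int[leb]_(t in `[0, 2 * pi[) f t = 0.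
Proof.
move=> dF cf Fe.
have cF : continuous F.
  move=> t; apply: differentiable_continuous; apply/derivable1_diffP.
  exact: (@ex_derive _ _ _ _ _ _ _ (dF t)).
have intf : leb.-integrable `[0, 2 * pi] (EFin \o f).
  apply: continuous_compact_integrable; first exact: segment_compact.
  by apply: continuous_subspaceT.
rewrite Rintegral_itv_bndo_bndc; last first.
  by apply: integrableS intf => //; exact: subset_itv_co_cc.
rewrite /Rintegral (continuous_FTC2 (F := F)) ?pi2_gt0//.
- by rewrite -EFinB Fe subrr.
- exact: continuous_subspaceT.
- split; [by move=> x _; exact: (@ex_derive _ _ _ _ _ _ _ (dF x))| |].
  + by apply: cvg_at_right_filter; exact: cF.
  + by apply: cvg_at_left_filter; exact: cF.
- by move=> x _; rewrite derive1E; exact: (@derive_val _ _ _ _ _ _ _ (dF x)).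
Qed.

Lemma cmean_Xn n : cmean (fun s => cval s ^+ n) = (n == 0%N)%:R.
Proof.
have b : bm (fun s : circle R => cval s ^+ n) by apply: bmX; exact: bm_cval.
case: b => b1 b2.
rewrite /cmean /rmean !Rintegral_arclength//.
under eq_Rintegral do rewrite cvalXn /=.
under [in X in _ +i* X]eq_Rintegral do rewrite cvalXn /=.
case: n b1 b2 => [|n] b1 b2.
  under eq_Rintegral do rewrite mul0r cos0.
  under [in X in _ +i* X]eq_Rintegral do rewrite mul0r sin0.
  rewrite !Rintegral_cst//= lebesgue_measure_itv /= lte_fin pi2_gt0 -EFinD /= mul0r mulr0.
  by rewrite subr0 mul1r mulVf// gt_eqF// pi2_gt0.
have n0 : n.+1%:R != 0 :> R by rewrite pnatr_eq0.
have [c2 s2] := trig_2pi n.+1.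
have cm : continuous (fun t : R => n.+1%:R * t) by move=> t; exact: mulrl_continuous.
have -> : \int[leb]_(t in `[0, 2 * pi[) cos (n.+1%:R * t) = 0.
  apply: (@integral_trig _ (fun t => n.+1%:R^-1 * sin (n.+1%:R * t))).
  - move=> t; apply: is_derive_eq.
    by rewrite /GRing.scale /= mulr1 mulrCA mulVf// mulr1.
  - by move=> t; apply: continuous_comp; [exact: cm|exact: continuous_cos].
  - by rewrite s2 (mulr0 n.+1%:R) sin0.
have -> : \int[leb]_(t in `[0, 2 * pi[) sin (n.+1%:R * t) = 0.
  apply: (@integral_trig _ (fun t => - n.+1%:R^-1 * cos (n.+1%:R * t))).
  - move=> t; apply: is_derive_eq.
    by rewrite /GRing.scale /=; field.
  - by move=> t; apply: continuous_comp; [exact: cm|exact: continuous_sin].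
  - by rewrite c2 mulr0 cos0.
by rewrite mulr0.
Qed.

End means.

(** * Parseval's identity and Fejer means as integrals over the circle *)

Section parseval.
Context {R : realType}.
Implicit Types (f g : circle R -> R) (h k : circle R -> R[i]) (p q : {poly R[i]}).

Lemma cmeanJ h : bm h -> cmean (fun s => (h s)^*%C) = (cmean h)^*%C.
Proof.
move=> [h1 h2]; rewrite /cmean /=.
have -> : (fun x => complex.Re ((h x)^*%C)) = (fun x => complex.Re (h x)).
  by apply/funext => x; case: (h x).
have -> : (fun x => complex.Im ((h x)^*%C)) = (fun x => -1 * complex.Im (h x)).
  by apply/funext => x; rewrite mulN1r; case: (h x).
by rewrite rmeanZ// mulN1r.
Qed.

Lemma cmean_XnJ i j :
  cmean (fun s : circle R => cval s ^+ i * (cval s ^+ j)^*%C) = (i == j)%:R.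
Proof.
have b n : bm (fun s : circle R => cval s ^+ n) by apply: bmX; exact: bm_cval.
have zz (s : circle R) n : cval s ^+ n * (cval s ^+ n)^*%C = 1.
  by rewrite unit_conj// cabsX cabs_cval expr1n.
have [ji|/ltnW ij] := leqP j i.
  have -> : (fun s : circle R => cval s ^+ i * (cval s ^+ j)^*%C) = (fun s => cval s ^+ (i - j)).
    by apply/funext => s; rewrite -{1}(subnK ji) exprD -mulrA zz mulr1.
  by rewrite cmean_Xn subn_eq0 eqn_leq ji andbT.
have -> : (fun s : circle R => cval s ^+ i * (cval s ^+ j)^*%C) = (fun s => (cval s ^+ (j - i))^*%C).
  by apply/funext => s; rewrite -{1}(subnK ij) exprD rmorphM /= mulrCA zz mulr1.
by rewrite cmeanJ// cmean_Xn conjc_nat subn_eq0 eqn_leq ij.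
Qed.

Lemma cmean_parseval N p q : (size p <= N)%N -> (size q <= N)%N ->
  cmean (fun s => p.[cval s] * (q.[cval s])^*%C) = \sum_(j < N) p`_j * (q`_j)^*%C.
Proof.
move=> pN qN.
have b i j : bm (fun s : circle R => cval s ^+ i * (cval s ^+ j)^*%C).
  by apply: bmM; [|apply: bmJ]; apply: bmX; exact: bm_cval.
have -> : (fun s : circle R => p.[cval s] * (q.[cval s])^*%C) =
  (fun s => \sum_(i < N) \sum_(j < N) (p`_i * (q`_j)^*%C) * (cval s ^+ i * (cval s ^+ j)^*%C)).
  apply/funext => s; rewrite (horner_coef_wide _ pN) (horner_coef_wide _ qN) rmorph_sum /=.
  rewrite big_distrlr /=; apply: eq_bigr => i _; apply: eq_bigr => j _.
  by rewrite rmorphM /= mulrACA.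
rewrite cmean_sum; last by move=> i; apply: bm_sum => j; apply: bmM => //; exact: bm_cst.
apply: eq_bigr => i _; rewrite cmean_sum; last by move=> j; apply: bmM => //; exact: bm_cst.
rewrite (bigD1 i)//= [X in _ + X]big1 ?addr0; last first.
  move=> j ji; rewrite cmeanZ// cmean_XnJ.
  by rewrite -(inj_eq val_inj) /= eq_sym in ji *; rewrite (negbTE ji) mulr0.
by rewrite cmeanZ// cmean_XnJ eqxx mulr1.
Qed.

Lemma rmean_sqr N p : (size p <= N)%N ->
  rmean (fun s => cabs p.[cval s] ^+ 2) = \sum_(j < N) cabs p`_j ^+ 2.
Proof.
move=> pN; apply: (@complexI R).
transitivity (cmean (fun s => p.[cval s] * (p.[cval s])^*%C)).
  rewrite /cmean; apply/eqP; rewrite eq_complex /=; apply/andP; split; apply/eqP.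
    by congr rmean; apply/funext => s; rewrite -cabsC_sqr.
  have -> : (fun s => complex.Im (p.[cval s] * (p.[cval s])^*%C)) = (fun s : circle R => 0 * 0).
    by apply/funext => s; rewrite -cabsC_sqr /= mul0r.
  by rewrite rmeanZ ?mul0r//; exact: rbm_cst.
rewrite (cmean_parseval pN pN) rmorph_sum /=; apply: eq_bigr => j _.
by rewrite cabsC_sqr.
Qed.

Lemma rmean_sum (I : Type) (r : seq I) (f : I -> circle R -> R) : (forall i, rbm (f i)) ->
  rmean (fun s => \sum_(i <- r) f i s) = \sum_(i <- r) rmean (f i).
Proof.
move=> rf; elim: r => [|i r IH].
  under eq_fun do rewrite big_nil.
  by rewrite big_nil /rmean Rintegral_cst//= mul0r mulr0.
under eq_fun do rewrite big_cons.
by rewrite rmeanD ?IH ?big_cons//; exact: rbm_sum.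
Qed.

Section osc.
Variables (N : nat) (om : R[i]) (N0 : (0 < N)%N) (omP : N.-primitive_root om).

Lemma dosc_dil n q s : dosc N om n q (cval s) = N%:R^-1 * \sum_(k < N)
  fejer n (om ^+ k) * cabs (dil (om ^+ k) q - q).[cval s] ^+ 2.
Proof.
congr (_ * _); apply: eq_bigr => k _; congr (_ * _).
by rewrite hornerD hornerN horner_dil mulrC.
Qed.

Lemma rbm_dosc n q : rbm (fun s => dosc N om n q (cval s)).
Proof.
under eq_fun do rewrite dosc_dil.
apply: rbmM; first exact: rbm_cst.
apply: rbm_sum => k; apply: rbmM; first exact: rbm_cst.
by apply: rbm_cabs_sqr; exact: bm_horner_cval.
Qed.

(** The base point runs over the circle while the displacements stay roots of unity; Parseval in the
    base point leaves the sum evaluated in [sum_dil_hsum]. *)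
Lemma rmean_dosc n q : (0 < n)%N -> (size q <= n.+1)%N -> (n + n < N)%N ->
  rmean (fun s => dosc N om n q (cval s)) = 2 / n%:R * hsum q.
Proof.
move=> n0 hn nN; rewrite -(sum_dil_hsum N0 omP n0 hn nN).
under eq_fun do rewrite dosc_dil.
have r (k : nat) : rbm (fun s : circle R => cabs (dil (om ^+ k) q - q).[cval s] ^+ 2).
  by apply: rbm_cabs_sqr; exact: bm_horner_cval.
have r' (k : nat) : rbm (fun s : circle R => fejer n (om ^+ k) * cabs (dil (om ^+ k) q - q).[cval s] ^+ 2).
  by apply: rbmM => //; exact: rbm_cst.
rewrite rmeanZ; last by apply: rbm_sum => k; exact: r'.
rewrite rmean_sum; last by move=> k; exact: r'.
congr (_ * _); apply: eq_bigr => k _; rewrite rmeanZ//; congr (_ * _).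
apply: rmean_sqr; apply: (leq_trans (size_polyD _ _)); rewrite size_polyN geq_max hn andbT.
exact: leq_trans (size_dil _ _) hn.
Qed.

End osc.

Definition cfejer n (s t : circle R) : R := fejer n (cval s * (cval t)^*%C).

Definition fconv n h s : R[i] := cmean (fun t => (cfejer n s t)%:C * h t).

Lemma cfejerE n s t :
  cfejer n s t = n%:R^-1 * cabs (dil (cval s)^*%C (dirichlet n)).[cval t] ^+ 2.
Proof.
rewrite /cfejer /fejer horner_dil -[in RHS]cabsJ; congr (_ * cabs _ ^+ 2).
rewrite !horner_coef rmorph_sum /=; apply: eq_bigr => i _.
rewrite rmorphM rmorphXn rmorphM /= conjcK; congr (_ * _).
by rewrite coef_poly; case: ifP => _; rewrite ?conjc0 ?conjc1.
Qed.

Lemma rbm_cfejer n s : rbm (cfejer n s).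
Proof.
rewrite (_ : cfejer n s = fun t => n%:R^-1 * cabs (dil (cval s)^*%C (dirichlet n)).[cval t] ^+ 2).
  by apply: rbmM; [exact: rbm_cst|apply: rbm_cabs_sqr; exact: bm_horner_cval].
by apply/funext => t; exact: cfejerE.
Qed.

(** By Parseval both means are the same finite sum of coefficients. The number of roots of unity has
    to grow with the degree of [p], whereas the integral does not refer to it; limits in the degree
    are therefore taken on the integral side. *)
Lemma fconv_poly N (om : R[i]) n s p : (0 < N)%N -> N.-primitive_root om ->
  (n + size p <= N)%N ->
  fconv n (fun t => p.[cval t]) s = favg N om n (cval s) (horner p).
Proof.
move=> N0 omP npN; rewrite (favg_poly N0 omP _ npN) /fconv.
set D := dil (cval s)^*%C (dirichlet n).
have -> : (fun t => (cfejer n s t)%:C * p.[cval t]) =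
   (fun t => (n%:R^-1)%:C * ((D * p).[cval t] * (D.[cval t])^*%C)).
  apply/funext => t; rewrite cfejerE -/D (rmorphM (real_complex R)) -mulrA; congr (_ * _).
  by rewrite /= cabsC_sqr hornerM; ring.
rewrite cmeanZ; last exact: bm_hornerJ.
have sD : (size D <= n)%N by apply: leq_trans (size_dil _ _) (size_poly _ _).
rewrite (cmean_parseval (N := N)); last 2 first.
- apply: leq_trans npN; apply: (leq_trans (size_polyMleq _ _)).
  by apply: (leq_trans (leq_pred _)); rewrite leq_add2r.
- by apply: leq_trans npN; apply: (leq_trans sD); rewrite leq_addr.
rewrite (fmorphV (real_complex R)) (rmorph_nat (real_complex R)); congr (_ * _).
have nN : (n <= N)%N by apply: leq_trans npN; rewrite leq_addr.
have cD j : D`_j = if (j < n)%N then (cval s)^*%C ^+ j else 0.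
  by rewrite coef_dil coef_poly; case: ifP => _; rewrite ?mul1r ?mul0r.
rewrite (bigID (fun j : 'I_N => (j < n)%N)) /= [X in _ + X]big1 ?addr0; last first.
  by move=> j jn; rewrite cD (negbTE jn) conjc0 mulr0.
rewrite -(big_ord_widen_cond N (fun=> true) (fun j => (D * p)`_j * (D`_j)^*%C)) //=.
apply: eq_bigr => j _; rewrite [X in _ * X^*%C]cD ltn_ord rmorphXn /= conjcK.
rewrite !coefM mulr_suml; apply: eq_bigr => i _.
have ij : (i <= j)%N by rewrite -ltnS.
rewrite !coef_dil (_ : cval s ^+ j = cval s ^+ i * cval s ^+ (j - i)); last by rewrite -exprD subnKC.
have : (cval s)^*%C ^+ i * cval s ^+ i = 1.
  by rewrite mulrC -exprMn unit_conj ?cabs_cval// expr1n.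
move: ((cval s)^*%C ^+ i) (cval s ^+ i) => a b e.
transitivity ((dirichlet n)`_i * p`_(j - i) * cval s ^+ (j - i) * (a * b)); first by ring.
by rewrite e; ring.
Qed.

End parseval.

Section summable.
Context {R : realType}.
Implicit Types (f g : circle R -> R).

Lemma integral_rmean f : rbm f ->
  (\int[arclength R]_s (f s)%:E = (2 * pi * rmean f)%:E)%E.
Proof.
move=> rf; rewrite /rmean mulrA mulfV ?gt_eqF ?pi2_gt0// mul1r /Rintegral fineK//.
by apply: integrable_fin_num => //; exact: rbm_arclength_integrable.
Qed.

(** Monotone convergence: the sum has finite integral, hence is finite almost everywhere. This turns
    bounds on means into pointwise statements, both for oscillations and for increments along a
    subsequence. *)
Lemma ae_cvg_series (f : nat -> circle R -> R) (B : R) :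
  (forall k, rbm (f k)) -> (forall k s, 0 <= f k s) ->
  (forall n, \sum_(k < n) rmean (f k) <= B) ->
  {ae arclength R, forall s, cvgn (series (f ^~ s))}.
Proof.
move=> rf f0 fB.
have mf k : measurable_fun setT (fun s => (f k s)%:E).
  by apply/measurable_EFinP; case: (rf k).
pose S s := (\sum_(k <oo) (f k s)%:E)%E.
have S0 s : (0 <= S s)%E by apply: nneseries_ge0 => k _ _; rewrite lee_fin.
have intS : (arclength R).-integrable setT S.
  apply/integrableP; split; first by apply: ge0_emeasurable_sum => // k s _ _; rewrite lee_fin.
  under eq_integral do rewrite gee0_abs//.
  rewrite integral_nneseries//; last by move=> k s _; rewrite lee_fin.
  apply: (@le_lt_trans _ _ (2 * pi * B)%:E); last exact: ltry.
  apply: lime_le; first by apply: is_cvg_nneseries => k _ _; apply: integral_ge0 => s _; rewrite lee_fin.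
  apply: nearW => n; under eq_bigr do rewrite integral_rmean//.
  rewrite sumEFin lee_fin -mulr_sumr ler_wpM2l ?(ltW pi2_gt0)//.
  by rewrite big_mkord.
have := integrable_ae measurableT intS; apply: filterS => s /(_ I) Sfin.
apply: nondecreasing_is_cvgn.
  by apply/nondecreasing_seqP => n; rewrite !seriesEord /= big_ord_recr /= lerDl.
exists (fine (S s)) => _ [n _ <-].
rewrite -lee_fin fineK// seriesEnat /= -sumEFin.
by apply: nneseries_lim_ge => k _; rewrite lee_fin.
Qed.

End summable.

(** * Bounds for the Fejer kernel *)

Section kernel_bounds.
Context {R : realType}.

(** With c = cos(b/2), cosine is at least c on [0, b/2]. The mean value theorem gives sin(y/2) >= c
    y/2, and sin y = 2 sin(y/2) cos(y/2) brings the second factor c. *)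
Lemma sin_ge_linear (b y : R) : 0 <= y <= b -> b < pi -> cos (b / 2) ^+ 2 * y <= sin y.
Proof.
move=> /andP[y0 yb] bpi; set c := cos (b / 2).
have c0 : 0 < c.
  by rewrite cos_gt0_pihalf//; have := pi_gt0 R; lra.
have cle x : 0 <= x <= b / 2 -> c <= cos x.
  move=> /andP[x0]; rewrite le_eqVlt => /predU1P[->//|xb].
  by rewrite ltW// /c ltr_cos// in_itv/=; have := pi_gt0 R; lra.
have sl : c * (y / 2) <= sin (y / 2).
  have y20 : 0 <= y / 2 by lra.
  have ds x : x \in `]0, y / 2[ -> is_derive x (1 : R) sin (cos x).
    by move=> _; exact: is_derive_sin.
  have cs : {within `[0, y / 2], continuous (@sin R)}.
    by apply: continuous_subspaceT; exact: continuous_sin.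
  have [x] := MVT_segment y20 ds cs.
  rewrite in_itv /= => /andP[x0 xy]; rewrite sin0 !subr0 => ->.
  by rewrite ler_wpM2r//; apply: cle; lra.
have -> : sin y = 2 * (sin (y / 2) * cos (y / 2)).
  by rewrite {1}[y]splitr sinD; ring.
have cy : c <= cos (y / 2) by apply: cle; lra.
apply: (@le_trans _ _ (2 * (c * (y / 2) * c))); first by rewrite le_eqVlt; apply/orP; left; apply/eqP; field.
rewrite ler_pM2l// ler_pM//; last exact: ltW.
by rewrite mulr_ge0//; [exact: ltW|lra].
Qed.

Lemma chord_sqr (a b : R) :
  cabs (cval (cis a) * (cval (cis b))^*%C - 1) ^+ 2 = (2 * sin ((a - b) / 2)) ^+ 2.
Proof.
have -> : cabs (cval (cis a) * (cval (cis b))^*%C - 1) ^+ 2 = 2 - 2 * cos (a - b).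
  rewrite cabs_sqrE /cval /cis /set_val /= cosB.
  have := cos2Dsin2 a; have := cos2Dsin2 b.
  move: (cos a) (sin a) (cos b) (sin b) => ca sa cb sb eb ea.
  rewrite oppr0 addr0.
  transitivity ((ca ^+ 2 + sa ^+ 2) * (cb ^+ 2 + sb ^+ 2) + 1 - 2 * (ca * cb + sa * sb)); first by ring.
  by rewrite ea eb; ring.
set x := (a - b) / 2; have -> : a - b = x + x by rewrite /x -splitr.
by rewrite cosD; have := cos2Dsin2 x; move: (cos x) (sin x) => c s e; nra.
Qed.

Lemma cfejer_le n (s t : circle R) : cfejer n s t <= n%:R.
Proof.
rewrite /cfejer /fejer; set z := cval s * _.
have z1 : cabs z = 1 by rewrite ComplexField.Normc.normcM cabsJ !cabs_cval mulr1.
case: n => [|n]; first by rewrite invr0 mul0r.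
rewrite ler_pdivrMl ?ltr0n// -expr2.
rewrite ler_pXn2r// ?nnegrE ?cabs_ge0//.
rewrite (horner_coef_wide z (size_poly _ _)).
have H (k : nat) : cabs (\sum_(i < k) (dirichlet n.+1)`_i * z ^+ i) <= k%:R.
  elim: k => [|k IH]; first by rewrite big_ord0 ComplexField.Normc.normc0.
  rewrite big_ord_recr /= -natr1; apply: (le_trans (le_normcD _ _)); rewrite lerD//.
  rewrite ComplexField.Normc.normcM cabsX z1 expr1n mulr1 coef_poly.
  by case: ifP => _; rewrite ?ComplexField.Normc.normc1 ?ComplexField.Normc.normc0.
exact: H.
Qed.

(** The geometric sum gives D(z) (z - 1) = z^n - 1 for the Dirichlet polynomial D, of modulus at
    most 2 on the circle. *)
Lemma cfejer_tail n (s t : circle R) :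
  cfejer n s t * n%:R * cabs (cval s * (cval t)^*%C - 1) ^+ 2 <= 4.
Proof.
rewrite /cfejer /fejer; set z := cval s * _.
have z1 : cabs z = 1 by rewrite ComplexField.Normc.normcM cabsJ !cabs_cval mulr1.
case: n => [|n]; first by rewrite mulr0 mul0r.
rewrite [_ * n.+1%:R]mulrC mulVKf ?pnatr_eq0// -exprMn -ComplexField.Normc.normcM.
have -> : (dirichlet n.+1).[z] * (z - 1) = z ^+ n.+1 - 1.
  rewrite subrX1 mulrC (horner_coef_wide z (size_poly _ _)); congr (_ * _).
  by apply: eq_bigr => i _; rewrite coef_poly ltn_ord mul1r.
have : cabs (z ^+ n.+1 - 1) <= 2.
  apply: (le_trans (le_normcD _ _)).
  by rewrite normcN cabsX z1 expr1n ComplexField.Normc.normc1.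
rewrite -(ler_pXn2r (n := 2)) ?nnegrE ?cabs_ge0// => /le_trans; apply.
by rewrite expr2; lra.
Qed.

(** The chord is compared with the distance of angles within one period. The kernel also peaks where
    t - th is close to 2 pi or - 2 pi, so [C] depends on the distance of [th] from the ends of the
    period, but not on n. *)
Lemma cfejer_quadratic (th : R) : 0 < th < 2 * pi ->
  exists2 C : R, 0 <= C & forall n t, 0 <= t < 2 * pi ->
    cfejer n (cis th) (cis t) * n%:R * (t - th) ^+ 2 <= C.
Proof.
move=> /andP[th0 th2].
(* Half of the largest distance from [th] within the period, hence a bound below pi for the
   half-angle in the chord formula. *)
pose b : R := Num.max th (2 * pi - th) / 2.
have bpi : b < pi by rewrite /b; case: (leP th (2 * pi - th)) => ?; lra.
have b0 : 0 < b by rewrite /b; case: (leP th (2 * pi - th)) => ?; lra.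
set c := cos (b / 2) ^+ 2.
have c0 : 0 < c.
  by rewrite exprn_gt0// cos_gt0_pihalf//; have := pi_gt0 R; lra.
exists (4 / c ^+ 2); first by rewrite divr_ge0// sqr_ge0.
move=> n t /andP[t0 t2].
rewrite (ler_pdivlMr _ _ (exprn_gt0 2 c0)).
apply: le_trans (cfejer_tail n (cis th) (cis t)).
rewrite -[leLHS]mulrA ler_wpM2l//.
  by rewrite mulr_ge0// mulr_ge0 ?invr_ge0// sqr_ge0.
rewrite chord_sqr -exprMn.
have key x : 0 <= x -> x <= 2 * b -> (x * c) ^+ 2 <= (2 * sin (x / 2)) ^+ 2.
  move=> x0 xb; rewrite ler_pXn2r ?nnegrE//.
  - have : cos (b / 2) ^+ 2 * (x / 2) <= sin (x / 2) by apply: sin_ge_linear => //; lra.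
    by rewrite -/c; lra.
  - by rewrite mulr_ge0// ltW.
  - have : cos (b / 2) ^+ 2 * (x / 2) <= sin (x / 2) by apply: sin_ge_linear => //; lra.
    by rewrite -/c; have := mulr_ge0 (ltW c0) x0; lra.
have [tth|tth] := leP t th.
  have := key (th - t); rewrite -[t - th]opprB mulNr sqrrN; apply; first by lra.
  by rewrite /b; case: (leP th (2 * pi - th)) => ?; lra.
have := key (t - th); rewrite -[th - t]opprB mulNr sinN mulrN sqrrN; apply; first by lra.
by rewrite /b; case: (leP th (2 * pi - th)) => ?; lra.
Qed.

Lemma rmean_cfejer n (s : circle R) : (0 < n)%N -> rmean (cfejer n s) = 1.
Proof.
move=> n0; rewrite (_ : cfejer n s = fun t => n%:R^-1 * cabs (dil (cval s)^*%C (dirichlet n)).[cval t] ^+ 2); last first.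
  by apply/funext => t; exact: cfejerE.
rewrite rmeanZ; last by apply: rbm_cabs_sqr; exact: bm_horner_cval.
rewrite (rmean_sqr (N := n)); last by apply: leq_trans (size_dil _ _) (size_poly _ _).
rewrite (eq_bigr (fun=> 1)); last first.
  move=> j _; rewrite coef_dil coef_poly ltn_ord mul1r cabsX cabsJ cabs_cval !expr1n//.
by rewrite sumr_const card_ord mulVf// pnatr_eq0 -lt0n.
Qed.

End kernel_bounds.

(** * The theorem of Fejer and Lebesgue *)

Section fejer_lebesgue.
Context {R : realType}.
Implicit Types (f : circle R -> R).
Local Notation leb := (@lebesgue_measure R).
Local Notation per := `[(0 : R), 2 * pi[%classic.

Definition rconv n f s : R := rmean (fun t => cfejer n s t * f t).

Lemma rbm_per_integrable (g : R -> R) : rbm g -> leb.-integrable per (EFin \o g).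
Proof.
move=> [mg [M gM]]; apply: measurable_bounded_integrable => //.
- by rewrite /= lebesgue_measure_itv /=; case: ifP => _; rewrite ?ltry// -EFinD ltry.
- exact: measurable_funTS.
- by exists M; split; rewrite ?num_real// => N MN x _ /=; rewrite (le_trans (gM x))// ltW.
Qed.

Lemma rbm_cis f : rbm f -> rbm (f \o @cis R).
Proof.
move=> [mf [M fM]]; split; last by exists M => t; exact: fM.
by apply: measurableT_comp => //; exact: measurable_cis.
Qed.

Lemma rbm_indic d (T : measurableType d) (A : set T) : measurable A -> rbm (\1_A : T -> R).
Proof.
move=> mA; split; first exact: measurable_indic.
by exists 1 => x; rewrite indicE; case: (_ \in _); rewrite ?normr1 ?normr0.
Qed.

Lemma rbm_norm d (T : measurableType d) (f : T -> R) : rbm f -> rbm (fun x => `|f x|).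
Proof.
move=> [mf [M fM]]; split; first by apply: measurableT_comp.
by exists M => x; rewrite normr_id.
Qed.

Lemma Rintegral_per_sum (I : Type) (r : seq I) (f : I -> R -> R) : (forall i, rbm (f i)) ->
  \int[leb]_(t in per) (\sum_(i <- r) f i t) = \sum_(i <- r) \int[leb]_(t in per) f i t.
Proof.
move=> rf; elim: r => [|i r IH].
  under eq_Rintegral do rewrite big_nil.
  by rewrite big_nil Rintegral_cst// mul0r.
under eq_Rintegral do rewrite big_cons.
rewrite RintegralD//; do ?exact: rbm_per_integrable.
  by rewrite IH big_cons.
by apply: rbm_per_integrable; exact: rbm_sum.
Qed.

Lemma leb_per : leb per = (2 * pi)%:E.
Proof. by rewrite lebesgue_measure_itv /= lte_fin pi2_gt0 -EFinD subr0. Qed.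

Section dyadic.
Variables (n : nat) (k g : R -> R) (th C M eps : R) (L : nat).
Hypotheses (n0 : (0 < n)%N) (C0 : 0 <= C) (eps0 : 0 <= eps).
Hypotheses (rk : rbm k) (rg : rbm g) (g0 : forall t, 0 <= g t) (gM : forall t, g t <= M).
Hypothesis kn : forall t, 0 <= t < 2 * pi -> 0 <= k t <= n%:R.
Hypothesis kC : forall t, 0 <= t < 2 * pi -> k t * n%:R * (t - th) ^+ 2 <= C.
Let rad l : R := 2 ^+ l / n%:R.
Hypothesis avg : forall l, (l <= L)%N ->
  \int[leb]_(t in per) (\1_(ball th (rad l)) t * g t) <= 2 * rad l * eps.

(** Outside the ball of radius 2^(l-1)/n the quadratic decay gives k <= 4 C n 4^-l, and on the
    innermost ball k <= n; the factor 1 + 4 C covers both cases. *)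
Let wt l : R := (1 + 4 * C) * n%:R * 4 ^- l.

Let nR : 0 < n%:R :> R. Proof. by rewrite ltr0n. Qed.

Let rad_gt0 l : 0 < rad l.
Proof. by rewrite divr_gt0// exprn_gt0. Qed.

Let wt_ge0 l : 0 <= wt l.
Proof. by rewrite mulr_ge0 ?invr_ge0 ?exprn_ge0// mulr_ge0// addr_ge0// mulr_ge0. Qed.

Let far_bound l t : 0 <= t < 2 * pi -> ~ ball th (rad l) t -> 4 * k t <= wt l.+1 * 4.
Proof.
move=> tp; rewrite /ball /= => /negP; rewrite -leNgt => h.
have h2 : rad l ^+ 2 <= (t - th) ^+ 2.
  rewrite -(real_normK (num_real (t - th))) distrC ler_pXn2r ?nnegrE//.
  exact: ltW.
have /andP[k0 _] := kn tp.
have kh : k t * n%:R * rad l ^+ 2 <= C.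
  by apply: le_trans (kC tp); rewrite ler_wpM2l// mulr_ge0// ltW.
have e4 : 4 ^+ l = (2 ^+ l) ^+ 2 :> R by rewrite -exprM mulnC exprM expr2; congr (_ ^+ _); ring.
have kh' : k t * 4 ^+ l <= C * n%:R.
  have -> : k t * 4 ^+ l = (k t * n%:R * rad l ^+ 2) * n%:R.
    by rewrite e4 /rad; field; rewrite gt_eqF.
  by rewrite ler_wpM2r// ltW.
have p4 : 0 < 4 ^+ l :> R by rewrite exprn_gt0.
rewrite /wt exprS invfM.
have -> : (1 + 4 * C) * n%:R * (4^-1 * 4 ^- l) * 4 = (1 + 4 * C) * n%:R / 4 ^+ l by field; rewrite gt_eqF.
rewrite ler_pdivlMr//.
by have := ltW nR; nra.
Qed.

Let kernel_bound l t : 0 <= t < 2 * pi -> ball th (rad l) t ->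
  k t <= \sum_(i < l.+1) wt i * \1_(ball th (rad i)) t.
Proof.
move=> tp; elim: l => [|l IH] tb.
  rewrite big_ord_recl big_ord0 addr0 /= indicE mem_set// mulr1 /wt expr0 invr1 mulr1.
  have /andP[_ h] := kn tp; apply: (le_trans h); rewrite ler_peMl//.
  by rewrite lerDl mulr_ge0.
rewrite big_ord_recr /=.
have [tl|tl] := pselect (ball th (rad l) t).
  by rewrite (le_trans (IH tl))// lerDl mulr_ge0// indicE; case: (_ \in _).
rewrite (le_trans (_ : _ <= wt l.+1))//.
  by have := far_bound tp tl; lra.
rewrite [in X in _ + X]indicE mem_set// mulr1 lerDr sumr_ge0// => i _.
by rewrite mulr_ge0// indicE; case: (_ \in _).
Qed.

(* Comparison of the kernel with a combination of indicators of the balls of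
   radius 2^l / n, as in the classical proof of the Fejer-Lebesgue theorem. *)
Lemma dyadic_bound : \int[leb]_(t in per) (k t * g t) <=
  4 * (1 + 4 * C) * eps + (1 + 4 * C) * n%:R * 4 ^- L * (2 * pi * M).
Proof.
have rb l : rbm (\1_(ball th (rad l)) : R -> R).
  by apply: rbm_indic; exact: measurable_ball.
have rt l : rbm (fun t => wt l * (\1_(ball th (rad l)) t * g t)).
  by apply: rbmM; [exact: rbm_cst|exact: rbmM].
have rs : rbm (fun t => \sum_(i < L.+1) wt i * (\1_(ball th (rad i)) t * g t)).
  by apply: rbm_sum.
(* Inside the outermost ball the weighted indicators dominate the kernel; outside it the kernel is
   at most [wt L], which is simply added everywhere. *)
apply: (@le_trans _ _ (\int[leb]_(t in per)
   (\sum_(i < L.+1) wt i * (\1_(ball th (rad i)) t * g t) + wt L * g t))).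
  apply: le_Rintegral => //.
  - by apply: rbm_per_integrable; exact: rbmM.
  - apply: rbm_per_integrable; apply: rbmD => //; apply: rbmM => //; exact: rbm_cst.
  move=> t; rewrite /= in_itv /= => tp.
  under eq_bigr do rewrite mulrA.
  rewrite -mulr_suml -mulrDl ler_wpM2r//.
  have [tl|tl] := pselect (ball th (rad L) t).
    by rewrite (le_trans (kernel_bound tp tl))// lerDl.
  rewrite (le_trans (_ : _ <= wt L))//.
    have := far_bound tp tl; have := wt_ge0 L; rewrite /wt exprS invfM.
    have /andP[k0 _] := kn tp.
    have p4 : 0 < (4 ^+ L)^-1 :> R by rewrite invr_gt0 exprn_gt0.
    have -> : (1 + 4 * C) * n%:R * (4^-1 * 4 ^- L) * 4 = (1 + 4 * C) * n%:R * 4 ^- L by field; rewrite gt_eqF// exprn_gt0.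
    lra.
  rewrite lerDr sumr_ge0// => i _.
  by rewrite mulr_ge0// indicE; case: (_ \in _).
rewrite RintegralD//; last 2 first.
- exact: rbm_per_integrable.
- by apply: rbm_per_integrable; apply: rbmM => //; exact: rbm_cst.
rewrite Rintegral_per_sum// RintegralZl//; last exact: rbm_per_integrable.
apply: lerD; last first.
  rewrite ler_wpM2l//.
  apply: (@le_trans _ _ (\int[leb]_(t in per) M)).
    by apply: le_Rintegral => //; apply: rbm_per_integrable => //; exact: rbm_cst.
  by rewrite Rintegral_cst//= leb_per /= mulrC.
(* The weight (1 + 4 C) n 4^-i meets the ball average 2 * 2^i eps / n, so the scales form a
   geometric series of ratio 1/2. *)
apply: (@le_trans _ _ (\sum_(i < L.+1) 2 * (1 + 4 * C) * eps * 2^-1 ^+ i)).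
  apply: ler_sum => i _; rewrite RintegralZl//; last by apply: rbm_per_integrable; exact: rbmM.
  have iL : (i <= L)%N by rewrite -ltnS.
  apply: (le_trans (ler_wpM2l (wt_ge0 i) (avg iL))).
  have e4 : 4 ^+ i = 2 ^+ i * 2 ^+ i :> R by rewrite -exprMn; congr (_ ^+ _); ring.
  have p2 : 2 ^+ i != 0 :> R by rewrite expf_neq0.
  rewrite /wt /rad e4 exprVn le_eqVlt; apply/orP; left; apply/eqP; field.
  by rewrite p2 gt_eqF.
rewrite -mulr_sumr.
have -> : 4 * (1 + 4 * C) * eps = 2 * (1 + 4 * C) * eps * 2 by ring.
rewrite ler_wpM2l//; first by rewrite mulr_ge0// mulr_ge0// addr_ge0// mulr_ge0.
have h : (2^-1 - 1) * \sum_(i < L.+1) 2^-1 ^+ i = 2^-1 ^+ L.+1 - 1 :> R by rewrite subrX1.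
have : 0 <= 2^-1 ^+ L.+1 :> R by rewrite exprn_ge0.
by move: h; set S := \sum_(_ < _) _; set x := _ ^+ L.+1; lra.
Qed.

End dyadic.

End fejer_lebesgue.

Section lebesgue_points.
Context {R : realType}.
Implicit Types (f : circle R -> R).
Local Notation leb := (@lebesgue_measure R).
Local Notation per := `[(0 : R), 2 * pi[%classic.

(** Puts the Lebesgue point property in the form used on dyadic balls: an integral over the period,
    uniform over all radii up to some 1/(q+1). *)
Lemma lebesgue_pt_avg (F : R -> R) (th eps : R) : rbm F -> 0 < eps ->
  lebesgue_pt F th -> exists q : nat, forall r, 0 < r <= q.+1%:R^-1 ->
    \int[leb]_(t in per) (\1_(ball th r) t * `|F t - F th|) <= 2 * r * eps.
Proof.
move=> rF e0 /fine_cvgP[dfin dcvg].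
have dlt : \forall r \near (0 : R)^'+, fine (davg F th r) < eps.
  by apply: (cvgr_lt _ dcvg).
have : \forall r \near (0 : R)^'+, davg F th r \is a fin_num /\ fine (davg F th r) < eps.
  by apply: filterS2 dfin dlt.
move=> [d /= d0 Hd].
have rG : rbm (fun t => `|F t - F th|) by apply: rbm_norm; apply: rbmB => //; exact: rbm_cst.
(* With q the integer part of 1/d, the radii up to 1/(q+1) lie strictly below d. *)
exists (Num.truncn (d^-1)) => r /andP[r0 rq].
have rd : r < d.
  apply: (le_lt_trans rq); rewrite invf_plt ?posrE ?ltr0n//.
  have /truncn_itv/andP[] // : 0 <= d^-1 by rewrite invr_ge0 ltW.
have [] := Hd r _ r0; first by rewrite /ball_ /= sub0r normrN gtr0_norm.
move=> dfn; rewrite -lte_fin fineK//.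
rewrite /davg /iavg lebesgue_measure_ball ?(ltW r0)// inver mulrn_eq0 /= (gt_eqF r0).
move=> hlt; have r20 : 0 < r *+ 2 by rewrite pmulrn_lgt0.
have {hlt} : (\int[leb]_(y in ball th r) (`|F y - F th|)%:E < (2 * r * eps)%:E)%E.
  move: hlt; rewrite lte_pdivrMl//; by have -> : 2 * r * eps = r *+ 2 * eps by ring.
move=> hle; rewrite -lee_fin.
have rI : rbm (fun t => \1_(ball th r) t * `|F t - F th|).
  by apply: rbmM => //; apply: rbm_indic; exact: measurable_ball.
rewrite /Rintegral fineK; last by apply: integrable_fin_num => //; exact: rbm_per_integrable.
apply: le_trans (ltW hle).
have -> : (\int[leb]_(t in per) (\1_(ball th r) t * `|F t - F th|)%:E)%E =
    (\int[leb]_(t in per) (((fun t => (`|F t - F th|)%:E) \_ (ball th r)) t))%E.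
  apply: eq_integral => t _; rewrite patchE indicE.
  by case: ifP => _; rewrite ?mul1r ?mul0r.
rewrite -integral_mkcondr; apply: ge0_subset_integral => //.
- by apply: measurableI => //; exact: measurable_ball.
- exact: measurable_ball.
- apply/measurable_EFinP; apply: measurable_funTS; exact: (rG).1.
Unshelve. all: by end_near.
Qed.

Lemma le_norm_rmean f : rbm f -> `|rmean f| <= rmean (fun s => `|f s|).
Proof.
move=> rf; rewrite /rmean normrM ger0_norm ?invr_ge0 ?(ltW pi2_gt0)//.
by rewrite ler_wpM2l ?invr_ge0 ?(ltW pi2_gt0)// le_normr_Rintegral//; exact: rbm_arclength_integrable.
Qed.

(** The kernel has mean one, so the error is the mean of the kernel times f(t) - f(s);
    [dyadic_bound] applies with |f(t) - f(s)| <= 2 M. *)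
Lemma rconv_lebesgue_pt f th : rbm f -> 0 < th < 2 * pi ->
  lebesgue_pt (f \o @cis R) th ->
  rconv n f (cis th) @[n --> \oo] --> f (cis th).
Proof.
move=> rf thp lp; have [mf [M fM]] := rf.
have M0 : 0 <= M by apply: le_trans (fM (cis th)).
have [C C0 hC] := cfejer_quadratic thp.
have K0 : 0 < 1 + 4 * C by apply: ltr_pwDl => //; rewrite mulr_ge0.
have p0 := @pi2_gt0 R.
apply/cvgrPdist_le => /= eta eta0.
(* Chosen so that the term 4 (1 + 4 C) eps of [dyadic_bound] is half of the budget 2 pi eta. *)
pose eps := 2 * pi * eta / (8 * (1 + 4 * C)).
have eps0 : 0 < eps by rewrite /eps divr_gt0// mulr_gt0//.
have rc := rbm_cis rf.
have [q hq] := lebesgue_pt_avg rc eps0 lp.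
near=> n.
have nq : (q.+1 <= n)%N by near: n; exact: nbhs_infty_ge.
have n0 : (0 < n)%N by exact: leq_trans nq.
have nR : 0 < n%:R :> R by rewrite ltr0n.
(* Makes the remaining term, of order 1/n, at most the other half of the budget. *)
have hn : 16 * (1 + 4 * C) * q.+1%:R ^+ 2 * M / eta <= n%:R.
  by near: n; exact: nbhs_infty_ger.
set s := cis th; pose g t := `|f (cis t) - f s|.
have rk : rbm (cfejer n s \o @cis R) by apply: rbm_cis; exact: rbm_cfejer.
have rd : rbm (fun t => f t - f s) by apply: rbmB => //; exact: rbm_cst.
have rg : rbm g by apply: rbm_norm; exact: (rbm_cis rd).
have -> : f s - rconv n f s = - rmean (fun t => cfejer n s t * (f t - f s)).
  have -> : (fun t => cfejer n s t * (f t - f s)) = (fun t => cfejer n s t * f t + - f s * cfejer n s t).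
    by apply/funext => t; ring.
  rewrite rmeanD; last 2 first.
  - by apply: rbmM => //; exact: rbm_cfejer.
  - by apply: rbmM; [exact: rbm_cst|exact: rbm_cfejer].
  by rewrite rmeanZ ?rmean_cfejer// -/(rconv n f s) ?mulr1 ?opprD ?opprK 1?addrC//; exact: rbm_cfejer.
rewrite normrN; apply: (le_trans (le_norm_rmean _)); first by apply: rbmM => //; exact: rbm_cfejer.
have -> : (fun t => `|cfejer n s t * (f t - f s)|) = (fun t => cfejer n s t * `|f t - f s|).
  by apply/funext => t; rewrite normrM ger0_norm// fejer_ge0.
rewrite /rmean Rintegral_arclength; last first.
  by apply: rbmM; [exact: rbm_cfejer|exact: rbm_norm].
(* The last scale with 2^L / n <= 1/(q+1): all radii used are admissible, and maximality of L bounds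
   4^-L by 4 (q+1)^2 / n^2. *)
pose L := trunc_log 2 (n %/ q.+1).
have nq0 : (0 < n %/ q.+1)%N by rewrite divn_gt0.
have /andP[L1 L2] := trunc_log_bounds (isT : (1 < 2)%N) nq0.
have hL1 : 2 ^+ L <= n%:R / q.+1%:R :> R.
  rewrite ler_pdivlMr ?ltr0n// -natrX -natrM ler_nat.
  by rewrite (leq_trans _ (leq_trunc_div n q.+1))// leq_mul2r L1 orbT.
have hL2 : n%:R / q.+1%:R <= 2 * 2 ^+ L :> R.
  rewrite ler_pdivrMr ?ltr0n// -exprS -natrX -natrM ler_nat.
  rewrite (leq_trans (ltnW (ltn_ceil n (ltn0Sn q))))// leq_mul2r.
  by rewrite L2 orbT.
rewrite ler_pdivrMl//.
apply: (le_trans (@dyadic_bound R n (cfejer n s \o @cis R) g th C (2 * M) eps L n0 C0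
  (ltW eps0) rk rg _ _ _ _ _)).
- by move=> t; rewrite normr_ge0.
- move=> t; apply: (le_trans (ler_normB _ _)).
  by rewrite mulrDl mul1r lerD.
- by move=> t tp; rewrite fejer_ge0 cfejer_le.
- by move=> t tp; exact: hC.
- move=> l lL; apply: hq; rewrite divr_gt0 ?exprn_gt0//=.
  rewrite ler_pdivrMr//; apply: le_trans (_ : 2 ^+ L <= _).
    by rewrite ler_eXn2l// ltr1n.
  by rewrite mulrC.
have -> : 2 * pi * eta = 2 * pi * eta / 2 + 2 * pi * eta / 2 by rewrite -splitr.
apply: lerD.
  rewrite /eps le_eqVlt; apply/orP; left; apply/eqP; field.
  by rewrite gt_eqF.
have p4 : 0 < 2 ^+ L :> R by rewrite exprn_gt0.
have q0 : 0 < q.+1%:R :> R by rewrite ltr0n.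
have -> : 4 ^- L = (2 ^+ L) ^- 2 :> R by rewrite -exprM mulnC exprM; congr (_ ^- _); ring.
have h1 : (2 ^+ L) ^- 2 <= 4 * q.+1%:R ^+ 2 / n%:R ^+ 2 :> R.
  rewrite -[leLHS]mul1r ler_pdivrMr ?exprn_gt0// mulrAC ler_pdivlMr ?exprn_gt0// mul1r.
  have -> : 4 * q.+1%:R ^+ 2 * 2 ^+ L ^+ 2 = (q.+1%:R * (2 * 2 ^+ L)) ^+ 2 :> R by ring.
  rewrite ler_pXn2r ?nnegrE ?mulr_ge0 ?exprn_ge0 ?ler0n//.
  by rewrite mulrC -ler_pdivrMr.
apply: (@le_trans _ _ ((1 + 4 * C) * n%:R * (4 * q.+1%:R ^+ 2 / n%:R ^+ 2) * (2 * pi * (2 * M)))).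
  apply: ler_wpM2r; first by apply: mulr_ge0; [exact: ltW|exact: mulr_ge0].
  by apply: ler_wpM2l => //; rewrite mulr_ge0// ltW.
have -> : (1 + 4 * C) * n%:R * (4 * q.+1%:R ^+ 2 / n%:R ^+ 2) * (2 * pi * (2 * M)) =
   2 * pi * (8 * (1 + 4 * C) * q.+1%:R ^+ 2 * M / n%:R) by field; rewrite gt_eqF.
rewrite -[leRHS]mulrA ler_wpM2l ?(ltW p0)// ler_pdivrMr//.
move: hn; rewrite ler_pdivrMr// => hn.
by lra.
Unshelve. all: by end_near.
Qed.

End lebesgue_points.

Section fejer_ae.
Context {R : realType}.
Implicit Types (f : circle R -> R) (h : circle R -> R[i]).
Local Notation leb := (@lebesgue_measure R).

(** Expanding the kernel exhibits the mean as a trigonometric polynomial in [s] whose coefficients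
    are integrals, which gives measurability in [s] without product measures. *)
Lemma bm_fconv n h : bm h -> bm (fconv n h).
Proof.
move=> bh.
have bX i : bm (fun s : circle R => cval s ^+ i) by apply: bmX; exact: bm_cval.
pose c i j := cmean (fun t => ((cval t ^+ i)^*%C * cval t ^+ j) * h t).
have bt i j : bm (fun t => ((cval t ^+ i)^*%C * cval t ^+ j) * h t).
  by do 2 (apply: bmM => //); exact: bmJ.
rewrite (_ : fconv n h = fun s => \sum_(i < n) \sum_(j < n)
    ((n%:R^-1)%:C * (cval s ^+ i * (cval s ^+ j)^*%C)) * c i j); last first.
  apply/funext => s; rewrite /fconv.
  have -> : (fun t => (cfejer n s t)%:C * h t) = (fun t => \sum_(i < n) \sum_(j < n)
    ((n%:R^-1)%:C * (cval s ^+ i * (cval s ^+ j)^*%C)) * (((cval t ^+ i)^*%C * cval t ^+ j) * h t)).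
    apply/funext => t; rewrite /cfejer /fejer rmorphM /= cabsC_sqr.
    rewrite (horner_coef_wide _ (size_poly _ _)) rmorph_sum /= big_distrlr /=.
    rewrite -mulrA mulr_suml mulr_sumr; apply: eq_bigr => i _.
    rewrite mulr_suml mulr_sumr; apply: eq_bigr => j _.
    rewrite !coef_poly !ltn_ord !mul1r !exprMn !rmorphM /= !rmorphXn /= conjcK; ring.
  rewrite cmean_sum; last first.
    by move=> i; apply: bm_sum => j; apply: bmM => //; exact: bm_cst.
  apply: eq_bigr => i _; rewrite cmean_sum; last by move=> j; apply: bmM => //; exact: bm_cst.
  by apply: eq_bigr => j _; rewrite cmeanZ.
apply: bm_sum => i; apply: bm_sum => j; apply: bmM; last exact: bm_cst.
by apply: bmM; [exact: bm_cst|apply: bmM => //; exact: bmJ].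
Qed.

Lemma fconvE n h s : fconv n h s =
  rconv n (fun t => complex.Re (h t)) s +i* rconv n (fun t => complex.Im (h t)) s.
Proof.
by rewrite /fconv /cmean; congr (rmean _ +i* rmean _); apply/funext => t; rewrite ?Re_real ?Im_real.
Qed.

Lemma rbm_rconv n f : rbm f -> rbm (rconv n f).
Proof.
move=> rf; have [b _] := bm_fconv n (bm_real rf).
by move: b; under eq_fun do rewrite fconvE /=.
Qed.

(** Lebesgue differentiation yields a null set of angles, whose image on the circle need not be
    visibly measurable. The transfer goes through the upper limit of the error: it is measurable on
    the circle and has integral 0, so it vanishes almost everywhere. *)
Lemma rconv_ae f : rbm f ->
  {ae arclength R, forall s, rconv n f s @[n --> \oo] --> f s}.
Proof.
move=> rf.
pose u n s := (`|rconv n f s - f s|)%:E.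
pose F s := limn_esup (fun n => u n s).
have ru n : rbm (fun s => `|rconv n f s - f s|).
  by apply: rbm_norm; apply: rbmB => //; exact: rbm_rconv.
have mF : measurable_fun setT F.
  by apply: measurable_fun_limn_esup => n; apply/measurable_EFinP; exact: (ru n).1.
have F0 s : (0 <= F s)%E.
  rewrite /F limn_esup_lim; apply: lime_ge; first exact: is_cvg_esups.
  apply: nearW => n; apply: (@le_trans _ _ (u n s)); first by rewrite lee_fin.
  by apply: ereal_sup_ubound; exists n => /=.
have rc := rbm_cis rf.
have loc : locally_integrable setT (f \o @cis R).
  have [mc [M cM]] := rc.
  split => //; first exact: openT.
  move=> K _ cK; apply: (@le_lt_trans _ _ (\int[leb]_(x in K) M%:E)%E).
    apply: ge0_le_integral => //.
    - exact: compact_measurable.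
    - by apply/measurable_EFinP; apply: measurable_funTS; exact: (rbm_norm rc).1.
    - by move=> x _; rewrite lee_fin cM.
  rewrite integral_cst//=; last exact: compact_measurable.
  by rewrite lte_mul_pinfty ?lee_fin ?(le_trans _ (cM 0))//; exact: compact_finite_measure.
have key : {ae leb, forall t, t \in `]0, 2 * pi[ -> F (cis t) = 0%E}.
  have := lebesgue_differentiation loc; apply: filterS; first exact: (ae_filter_ringOfSetsType leb).
  move=> t lp.
  rewrite in_itv /= => tp; have cv := rconv_lebesgue_pt rf tp lp.
  have ucv : u n (cis t) @[n --> \oo] --> 0%E.
    rewrite -[0%E]/(0%:E); apply: cvg_EFin; first exact: nearW.
    rewrite -[0](@normr0 _ R) -(subrr (f (cis t))).
    by apply: cvg_norm; apply: cvgB => //; exact: cvg_cst.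
  by rewrite /F is_cvg_limn_esupE; [exact/cvg_lim|apply/cvg_ex; exists 0%E].
have IF : (\int[arclength R]_s F s = 0)%E.
  rewrite ge0_integral_arclength//.
  (* The angle 0, where the pointwise result does not apply, is removed as a null set. *)
  rewrite -integral_itv_obnd_cbnd; last first.
    by apply: measurable_funTS; apply: measurableT_comp => //; exact: measurable_cis.
  rewrite (ae_eq_integral (cst 0%E))//.
  - by rewrite integral0.
  - by apply: measurable_funTS; apply: measurableT_comp => //; exact: measurable_cis.
have := (ae_eq_integral_abs (arclength R) measurableT mF).1.
under eq_integral do rewrite gee0_abs//.
move=> /(_ IF); apply: filterS => s /(_ I) /= Fs.
have /fine_cvgP[_ /= h] : u n s @[n --> \oo] --> 0%:E.
  apply: limn_esup_le_cvg; first by rewrite -/(F s) Fs.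
  by move=> n; rewrite lee_fin.
by apply/subr_cvg0; apply/norm_cvg0P.
Qed.

End fejer_ae.

(** * Almost everywhere convergence *)

Section oscillation.
Context {R : realType}.
Variable F : nat -> R[i].

(** Parseval for the Dirichlet polynomial times the rotated increment. The right-hand side mentions
    neither [N] nor [om], so the oscillation does not depend on the roots of unity used. *)
Lemma dosc_coef N (om : R[i]) n (h : {poly R[i]}) s : (0 < N)%N -> N.-primitive_root om ->
  (size h <= n.+1)%N -> (n + n < N)%N ->
  dosc N om n h s = n%:R^-1 * \sum_(j < (n + n).+1)
    cabs (dirichlet n * dil s (h - (h.[s])%:P))`_j ^+ 2.
Proof.
move=> N0 omP hn nN.
set q := h - (h.[s])%:P.
have sq : (size q <= n.+1)%N.
  apply: (leq_trans (size_polyD _ _)); rewrite size_polyN geq_max hn /=.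
  by rewrite size_polyC; case: (_ != _).
have sp : (size (dirichlet n * dil s q)%R <= (n + n).+1)%N.
  apply: (leq_trans (size_polyMleq _ _)).
  have h1 : (size (dirichlet n : {poly R[i]}) <= n)%N by exact: size_poly.
  have h2 : (size (dil s q) <= n.+1)%N by apply: leq_trans (size_dil _ _) sq.
  by rewrite -addnS; apply: leq_trans (leq_pred _) _; rewrite leq_add.
rewrite (@sum_coef_widen R _ (fun z => cabs z ^+ 2) _ _ N) ?(leq_trans sp)//; last first.
  by rewrite ComplexField.Normc.normc0 expr0n.
rewrite -(discrete_parseval_sqr N0 omP); last exact: leq_trans sp nN.
rewrite /dosc /ravg mulrCA; congr (_ * _); rewrite mulr_sumr; apply: eq_bigr => k _.
rewrite /fejer -mulrA; congr (_ * _).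
by rewrite hornerM horner_dil /q hornerD hornerN hornerC ComplexField.Normc.normcM exprMn.
Qed.

(** A fixed choice, N = 2n + 1 and some primitive root; by [vosc_osc] every N > 2n gives the same
    value. *)
Definition osc n s : R :=
  vosc F (n + n).+1 (sval (cid (@complex_prim_root R _ (ltn0Sn (n + n))))) n s.

Lemma vosc_osc N (om : R[i]) n s : N.-primitive_root om -> (n + n < N)%N ->
  vosc F N om n s = osc n s.
Proof.
move=> omP nN; rewrite /osc; case: cid => om' om'P /=.
have N0 : (0 < N)%N by exact: leq_ltn_trans nN.
have [s1 s2] := vpol_deg F n.
by rewrite /vosc !dosc_coef.
Qed.

Lemma rbm_osc n : rbm (fun s : circle R => osc n (cval s)).
Proof. by apply: rbmD; exact: rbm_dosc. Qed.

Lemma osc_ge0 n s : 0 <= osc n s.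
Proof. by apply: addr_ge0; apply: ravg_ge0 => z; exact: sqr_ge0. Qed.

Lemma rmean_osc n : (0 < n)%N ->
  rmean (fun s => osc n (cval s)) = 2 / n%:R * vsum F n.
Proof.
move=> n0; rewrite /osc; case: cid => om omP /=.
have [s1 s2] := vpol_deg F n.
rewrite /vosc rmeanD; do ?exact: rbm_dosc.
by rewrite !(rmean_dosc (ltn0Sn (n + n)) omP)// -mulrDr.
Qed.

(** Summing the recursion bounds each partial sum by y_0 + B plus rho times the preceding one; the
    stated bound is the fixed point of that map. *)
Lemma sum_contraction (y e : nat -> R) (rho B : R) : 0 <= rho < 1 -> 0 <= y 0%N ->
  (forall k, y k.+1 <= rho * y k + e k) ->
  (forall K, \sum_(k < K) e k <= B) -> forall K, \sum_(k < K) y k <= (y 0%N + B) / (1 - rho).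
Proof.
move=> /andP[r0 r1] y0 hy hB.
have r1' : 0 < 1 - rho by rewrite subr_gt0.
have B0 : 0 <= B by apply: le_trans (hB 0%N); rewrite big_ord0.
elim=> [|K IH]; first by rewrite big_ord0; apply: divr_ge0; [exact: addr_ge0|exact: ltW].
rewrite big_ord_recl /=.
have h : \sum_(i < K) y (bump 0 i) <= rho * \sum_(i < K) y i + B.
  apply: le_trans (lerD (lexx _) (hB K)).
  by rewrite mulr_sumr -big_split /=; apply: ler_sum => i _; exact: hy.
apply: (le_trans (lerD (lexx _) h)).
have h2 := ler_wpM2l r0 IH.
have e1 : rho * ((y 0%N + B) / (1 - rho)) + (y 0%N + B) = (y 0%N + B) / (1 - rho).
  by field; rewrite gt_eqF.
by lra.
Qed.

Variable B : R.
Hypothesis FB : forall n, \sum_(i < n) cabs (F i.+1) ^+ 2 <= B.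

Lemma sum_blocks (m : nat -> nat) : {homo m : i j / (i < j)%N} -> forall K,
  \sum_(k < K) \sum_(i < m k.+1 - m k) cabs (F (m k + i).+1) ^+ 2 <= B.
Proof.
move=> mm K.
have ml k : (m k <= m k.+1)%N by apply: ltnW; exact: mm.
have E k : \sum_(i < m k.+1 - m k) cabs (F (m k + i).+1) ^+ 2 =
    \sum_(m k <= i < m k.+1) cabs (F i.+1) ^+ 2.
  rewrite -[in RHS](add0n (m k)) big_addn big_mkord; apply: eq_bigr => i _.
  by rewrite addnC.
under eq_bigr do rewrite E.
have -> : \sum_(k < K) \sum_(m k <= i < m k.+1) cabs (F i.+1) ^+ 2 =
    \sum_(m 0%N <= i < m K) cabs (F i.+1) ^+ 2.
  elim: K => [|K IH]; first by rewrite big_ord0 big_geq.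
  rewrite big_ord_recr /= IH -big_cat_nat//.
  by elim: K {IH} => // K IH; rewrite (leq_trans IH).
apply: le_trans (FB (m K)); rewrite -(big_mkord xpredT (fun i => cabs (F i.+1) ^+ 2)).
have m0K : (m 0%N <= m K)%N by elim: K => // K IH; rewrite (leq_trans IH).
by rewrite (big_cat_nat (leq0n (m 0%N)) m0K)/= lerDr sumr_ge0// => i _; exact: sqr_ge0.
Qed.

(* The mean of [osc n_k] is 2 * vsum n_k / n_k, which by [vsum_block] contracts
   along a lacunary sequence up to summable errors. *)
Lemma osc_ae_cvg0 nk : lacunary R nk ->
  {ae arclength R, forall s, osc (nk k) (cval s) @[k --> \oo] --> 0}.
Proof.
move=> [nkm [L L1 hL]].
(* [nk 0] may be 0, where the oscillation carries no information; from index 1 on the sequence is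
   positive. *)
pose m k := nk k.+1.
have mm : {homo m : i j / (i < j)%N} by move=> i j ij; apply: nkm.
have m0 k : (0 < m k)%N by apply: leq_ltn_trans (nkm k k.+1 (ltnSn k)).
have mR k : 0 < (m k)%:R :> R by rewrite ltr0n.
(* With this value (1 + eta) / L = (L + 1) / (2 L) < 1. *)
pose eta := (L - 1) / 2.
have eta0 : 0 < eta by rewrite divr_gt0// subr_gt0.
pose y k := 2 / (m k)%:R * vsum F (m k).
pose e k := 4 * (1 + eta^-1) * \sum_(i < m k.+1 - m k) cabs (F (m k + i).+1) ^+ 2.
have L0 : 0 < L by exact: lt_trans L1.
have v0 n : 0 <= vsum F n.
  by apply: addr_ge0; apply: sumr_ge0 => i _; rewrite mulr_ge0// sqr_ge0.
have hy k : y k.+1 <= (1 + eta) / L * y k + e k.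
  have mk : (m k <= m k.+1)%N by apply: ltnW; exact: mm.
  have := @vsum_block R F (m k) (m k.+1 - m k) eta eta0; rewrite subnKC// => h.
  have h2 := hsum_block F (m k) (m k.+1 - m k); rewrite subnKC// in h2.
  rewrite /y /e; set S := \sum_(i < _) _ in h2 *.
  have e1 : 0 < 1 + eta^-1 by rewrite ltr_pwDl// invr_ge0 ltW.
  have h3 : vsum F (m k.+1) <= (1 + eta) * vsum F (m k) + 2 * (1 + eta^-1) * ((m k.+1)%:R * S).
    by apply: (le_trans h); rewrite lerD2l ler_wpM2l// mulr_ge0// ltW.
  have h4 : (m k.+1)%:R^-1 * vsum F (m k) <= L^-1 * ((m k)%:R^-1 * vsum F (m k)).
    by rewrite mulrA -invfM; apply: ler_wpM2r => //; rewrite lef_pV2 ?posrE ?mulr_gt0//; exact: hL.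
  rewrite mulrAC ler_pdivrMr// .
  have e3 : ((1 + eta) / L * (2 / (m k)%:R * vsum F (m k)) + 4 * (1 + eta^-1) * S) * (m k.+1)%:R =
     2 * ((1 + eta) * (L^-1 * ((m k)%:R^-1 * vsum F (m k))) * (m k.+1)%:R + 2 * (1 + eta^-1) * ((m k.+1)%:R * S)).
    by ring.
  rewrite e3 ler_pM2l//; apply: (le_trans h3); rewrite lerD2r.
  rewrite -[leRHS]mulrA ler_wpM2l ?addr_ge0 ?(ltW eta0)//.
  by rewrite -ler_pdivrMr// mulrC.
have rho : 0 <= (1 + eta) / L < 1.
  rewrite divr_ge0 ?addr_ge0 ?(ltW eta0) ?(ltW L0)//= ltr_pdivrMr// mul1r /eta; lra.
have y0 : 0 <= y 0%N by rewrite mulr_ge0// divr_ge0.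
have eB K : \sum_(k < K) e k <= 4 * (1 + eta^-1) * B.
  rewrite -mulr_sumr ler_wpM2l//; last exact: sum_blocks.
  by rewrite mulr_ge0// addr_ge0// invr_ge0 ltW.
have yB := sum_contraction rho y0 hy eB.
have := @ae_cvg_series R (fun k s => osc (m k) (cval s)) _ (fun k => rbm_osc (m k))
  (fun k s => osc_ge0 (m k) (cval s)) _.
move=> /(_ _ (fun n => _)) H.
have /H : forall n, \sum_(k < n) rmean (fun s => osc (m k) (cval s)) <=
   (y 0%N + 4 * (1 + eta^-1) * B) / (1 - (1 + eta) / L).
  by move=> n; apply: le_trans (yB n); under eq_bigr do rewrite rmean_osc//.
apply: filterS => s /cvg_series_cvg_0.
by rewrite -(cvg_shiftS (fun k => osc (nk k) (cval s))).
Qed.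

End oscillation.

(** * Limits of sequences of functions *)

Section limits.
Context {R : realType}.
Implicit Types (f : circle R -> R).

(** The upper limit is defined everywhere, bounded and measurable, and equals the limit wherever
    there is one. *)
Lemma limit_function (h : nat -> circle R -> R) (M : R) :
  (forall i, rbm (h i)) -> (forall i s, `|h i s| <= M) ->
  exists2 U : circle R -> R, rbm U & forall s l, h i s @[i --> \oo] --> l -> U s = l.
Proof.
move=> rh hM.
pose u i s := (h i s)%:E; pose U s := limn_esup (u ^~ s).
have Ub s : ((- M)%:E <= U s <= M%:E)%E.
  rewrite /U limn_esup_lim; apply/andP; split.
    apply: lime_ge; first exact: is_cvg_esups.
    apply: nearW => n; apply: (@le_trans _ _ (u n s)).
      by rewrite lee_fin; have := hM n s; rewrite ler_norml => /andP[].
    by apply: ereal_sup_ubound; exists n => /=.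
  apply: lime_le; first exact: is_cvg_esups.
  apply: nearW => n; apply: ge_ereal_sup => _ [k _ <-].
  by rewrite lee_fin; have := hM k s; rewrite ler_norml => /andP[].
have Ufin s : U s \is a fin_num.
  have /andP[h1 h2] := Ub s; rewrite fin_numE; apply/andP; split.
    by rewrite gt_eqF// (lt_le_trans _ h1)// ltNyr.
  by rewrite lt_eqF// (le_lt_trans h2)// ltry.
exists (fine \o U).
  split.
    apply: measurableT_comp => //; apply: measurable_fun_limn_esup => i.
    by apply/measurable_EFinP; exact: (rh i).1.
  exists M => s /=; have := Ub s; rewrite -(fineK (Ufin s)) !lee_fin => /andP[h1 h2].
  by rewrite ler_norml h1.
move=> s l hl /=; rewrite /U.
have ul : u i s @[i --> \oo] --> l%:E by apply: cvg_EFin => //; exact: nearW.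
rewrite is_cvg_limn_esupE; last by apply/cvg_ex; exists l%:E.
by rewrite (cvg_lim _ ul).
Qed.

Lemma rmean_cvg (h : nat -> circle R -> R) (U : circle R -> R) (M : R) :
  (forall i, rbm (h i)) -> rbm U -> (forall i s, `|h i s| <= M) ->
  {ae arclength R, forall s, h i s @[i --> \oo] --> U s} ->
  rmean (h i) @[i --> \oo] --> rmean U.
Proof.
move=> rh rU hM hU.
have cv : (\int[arclength R]_s (h i s)%:E)%E @[i --> \oo] --> (\int[arclength R]_s (U s)%:E)%E.
  have [//|//| | | |_ _ //] := @dominated_convergence _ _ R (arclength R) setT measurableT
    (fun i s => (h i s)%:E) (fun s => (U s)%:E) (cst M%:E).
  - by move=> i; apply/measurable_EFinP; exact: (rh i).1.
  - by apply/measurable_EFinP; exact: rU.1.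
  - by apply: filterS hU => s hs _; apply: cvg_EFin => //; exact: nearW.
  - exact: (rbm_arclength_integrable (rbm_cst _ M)).
  - by apply: aeW => s i _; rewrite lee_fin.
rewrite /rmean; apply: cvgMr.
have e : (\int[arclength R]_s (U s)%:E)%E = (\int[arclength R]_s U s)%:E.
  by rewrite /Rintegral fineK//; apply: integrable_fin_num => //; exact: rbm_arclength_integrable.
by rewrite e in cv; have [_] := (fine_cvgP _ _).1 cv.
Qed.

(** The bound has the shape produced by 2 x <= 1/q + q x^2 with q = 2^i: it applies to increments
    whose squares are summable against the weights 2^i. *)
Lemma cvgn_of_diff (x f : nat -> R) : cvgn (series f) ->
  (forall i, `|x i.+1 - x i| <= 2^-1 ^+ i + f i) -> cvgn x.
Proof.
move=> cf hx.
have cg : cvgn (series (fun i => 2^-1 ^+ i : R)).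
  rewrite (_ : (fun i => 2^-1 ^+ i) = geometric 1 (2^-1 : R)).
    by apply: is_cvg_geometric_series; rewrite ger0_norm//; lra.
  by apply/funext => i /=; rewrite mul1r.
have c2 : cvgn (series (fun i => 2^-1 ^+ i + f i)).
  rewrite (_ : series _ = series (fun i => 2^-1 ^+ i : R) + series f); first exact: is_cvgD.
  by apply/funext => n; rewrite /series /= big_split.
have c1 : cvgn (series (telescope x)).
  apply: normed_cvg; apply: (series_le_cvg _ _ _ c2) => //= i.
  exact: le_trans (hx i).
rewrite telescopeK in c1.
suff -> : x = [sequence x n - x 0%N]_n + cst (x 0%N).
  by apply: is_cvgD; [exact: c1|exact: is_cvg_cst].
by apply/funext => n; rewrite fctE /= subrK.
Qed.

(** The rate 4^-i is fast enough to remain summable after multiplication by the weights 2^i of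
    [vpol_limit]. *)
Lemma tail_subsequence (a : nat -> R) (B : R) : (forall i, 0 <= a i) ->
  (forall n, \sum_(i < n) a i <= B) ->
  exists2 m : nat -> nat, {homo m : i j / (i < j)%N} &
    forall i k, \sum_(j < k) a (m i + j)%N <= 4^-1 ^+ i.
Proof.
move=> a0 aB.
have ca : cvgn (series a).
  apply: nondecreasing_is_cvgn.
    by apply/nondecreasing_seqP => n; rewrite !seriesEord /= big_ord_recr /= lerDl.
  by exists B => _ [n _ <-]; rewrite seriesEord /=; exact: aB.
have H i : exists n, forall p k, (n <= p)%N -> \sum_(j < k) a (p + j)%N <= 4^-1 ^+ i.
  have e0 : 0 < 4^-1 ^+ i :> R by rewrite exprn_gt0// invr_gt0.
  have /cvgrPdist_le/(_ _ e0)[n _ hn] := ca; exists n => p k np.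
  have h1 := hn p np; rewrite /= in h1.
  have le : series a (p + k)%N <= limn (series a).
    apply: nondecreasing_cvgn_le => //.
    by apply/nondecreasing_seqP => q; rewrite !seriesEord /= big_ord_recr /= lerDl.
  have e : series a (p + k)%N = series a p + \sum_(j < k) a (p + j)%N.
    by rewrite !seriesEord /= big_split_ord.
  rewrite e in le; have := ler_norm (limn (series a) - series a p); lra.
pose g i := sval (cid (H i)).
have gP i p k : (g i <= p)%N -> \sum_(j < k) a (p + j)%N <= 4^-1 ^+ i.
  by move=> gp; exact: (svalP (cid (H i))).
pose m := fix m i := if i is i'.+1 then maxn (m i').+1 (g i) else g 0%N.
exists m; last first.
  by move=> i k; apply: gP; case: i => //= i; rewrite leq_maxr.
by apply: homo_ltn => [y x z|i]; [exact: ltn_trans|rewrite /= leq_maxl].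
Qed.

End limits.

Section complex_limits.
Context {R : realType}.

Lemma cvg_complex (z : nat -> R[i]) (l : R[i]) :
  complex.Re (z n) @[n --> \oo] --> complex.Re l ->
  complex.Im (z n) @[n --> \oo] --> complex.Im l ->
  z n @[n --> \oo] --> l.
Proof.
move=> /cvgrPdist_le c1 /cvgrPdist_le c2; apply/cvgrPdist_le => /= -[e e'].
rewrite ltcE /= => /andP[/eqP -> e0].
have a2 : 0 < e / 2 by rewrite divr_gt0.
near=> n.
rewrite [e +i* 0]complexr0 cabs_norm lecR.
have -> : l - z n = (complex.Re l - complex.Re (z n))%:C + 'i%C * (complex.Im l - complex.Im (z n))%:C.
  by rewrite [LHS]complexE Re_sub Im_sub.
apply: (le_trans (le_normcD _ _)); rewrite ComplexField.Normc.normcM !cabs_real.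
have -> : cabs ('i%C : R[i]) = 1 by rewrite /= expr0n expr1n add0r sqrtr1.
rewrite mul1r [leRHS]splitr; apply: lerD; near: n; [exact: c1|exact: c2].
Unshelve. all: by end_near.
Qed.

Lemma cvg_Re (z : nat -> R[i]) (l : R[i]) : z n @[n --> \oo] --> l ->
  complex.Re (z n) @[n --> \oo] --> complex.Re l.
Proof. by move=> zl; apply: (cvg_comp _ _ zl); exact: Re_continuous. Qed.

Lemma cvg_Im (z : nat -> R[i]) (l : R[i]) : z n @[n --> \oo] --> l ->
  complex.Im (z n) @[n --> \oo] --> complex.Im l.
Proof. by move=> zl; apply: (cvg_comp _ _ zl); exact: Im_continuous. Qed.

Lemma cvg_cabs_sqr (z : nat -> R[i]) (l : R[i]) : z n @[n --> \oo] --> l ->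
  cabs (z n) ^+ 2 @[n --> \oo] --> cabs l ^+ 2.
Proof.
move=> zl; rewrite cabs_sqrE; under eq_fun do rewrite cabs_sqrE.
by apply: cvgD; apply: cvgM; do ?[exact: cvg_Re|exact: cvg_Im].
Qed.

Lemma cvg_cabs (z : nat -> R[i]) (l : R[i]) : z n @[n --> \oo] --> l ->
  cabs (z n) @[n --> \oo] --> cabs l.
Proof.
move=> zl.
have e x : cabs x = Num.sqrt (cabs x ^+ 2) :> R by rewrite sqrtr_sqr ger0_norm// cabs_ge0.
rewrite e; under eq_fun do rewrite e.
by apply: (cvg_comp _ _ (cvg_cabs_sqr zl)); exact: sqrt_continuous.
Qed.

Lemma cvg_conj (z : nat -> R[i]) (l : R[i]) : z n @[n --> \oo] --> l ->
  (z n)^*%C @[n --> \oo] --> l^*%C.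
Proof.
move=> zl; apply: cvg_complex.
  have e (x : R[i]) : complex.Re (x^*%C) = complex.Re x by case: x.
  by rewrite e; under eq_fun do rewrite e; exact: cvg_Re.
have e (x : R[i]) : complex.Im (x^*%C) = - complex.Im x by case: x.
by rewrite e; under eq_fun do rewrite e; apply: cvgN; exact: cvg_Im.
Qed.

Lemma cvg_realC (r : nat -> R) (l : R) : r n @[n --> \oo] --> l ->
  (r n)%:C @[n --> \oo] --> l%:C.
Proof. by move=> rl; apply: cvg_complex => //=; exact: cvg_cst. Qed.

Lemma cvg_cabs0 (z : nat -> R[i]) (b : nat -> R) : (forall n, cabs (z n) <= b n) ->
  b n @[n --> \oo] --> 0 -> z n @[n --> \oo] --> (0 : R[i]).
Proof.
move=> zb b0.
have H (g : R[i] -> R) : (forall x, `|g x| <= cabs x) -> g (z n) @[n --> \oo] --> 0.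
  move=> hg; apply/norm_cvg0P; apply: (@squeeze_cvgr _ _ _ _ (fun=> 0) b) => //; last exact: cvg_cst.
  by apply: nearW => n; rewrite normr_ge0 (le_trans (hg _)).
by apply: cvg_complex => /=; apply: H => x; [exact: cabs_Re|exact: cabs_Im].
Qed.

(** The estimate determines p_k times S_k = |X_k|^2 + |W_k|^2 in the limit. As S_k tends to 2, it is
    eventually nonzero and can be divided out. *)
Lemma product_limit (p X W : nat -> R[i]) (Y : nat -> R) (x y : R[i]) :
  (forall k, cabs (p k * (cabs (X k) ^+ 2 + cabs (W k) ^+ 2)%:C - 2 * (X k * (W k)^*%C))
     <= 40 * Num.sqrt (Y k)) ->
  Y k @[k --> \oo] --> 0 -> X k @[k --> \oo] --> x -> W k @[k --> \oo] --> y ->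
  cabs x ^+ 2 + cabs y ^+ 2 = 2 -> p k @[k --> \oo] --> x * y^*%C.
Proof.
move=> hE Y0 Xx Wy xy.
pose S k := cabs (X k) ^+ 2 + cabs (W k) ^+ 2.
have S2 : S k @[k --> \oo] --> (2 : R) by rewrite -xy; apply: cvgD; exact: cvg_cabs_sqr.
have S2C : (S k)%:C @[k --> \oo] --> (2 : R)%:C by exact: cvg_realC.
have E0 : p k * (S k)%:C - 2 * (X k * (W k)^*%C) @[k --> \oo] --> (0 : R[i]).
  apply: cvg_cabs0 hE _; rewrite -[0](mulr0 40); apply: cvgMr.
  rewrite -[0](@sqrtr0 R); apply: (cvg_comp _ _ Y0); exact: sqrt_continuous.
have XW : 2 * (X k * (W k)^*%C) @[k --> \oo] --> 2 * (x * y^*%C).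
  have h : X k * (W k)^*%C @[k --> \oo] --> x * y^*%C.
    by apply: cvgM; [exact: Xx|exact: cvg_conj].
  by apply: (@cvgM _ _ _ _ (fun=> 2)); [exact: cvg_cst|exact: h].
have pS : p k * (S k)%:C @[k --> \oo] --> 2 * (x * y^*%C).
  have h : (p k * (S k)%:C - 2 * (X k * (W k)^*%C)) + 2 * (X k * (W k)^*%C) @[k --> \oo] -->
      0 + 2 * (x * y^*%C) by apply: cvgD; [exact: E0|exact: XW].
  rewrite add0r in h.
  suff -> : (fun k => p k * (S k)%:C) =
    (fun k => (p k * (S k)%:C - 2 * (X k * (W k)^*%C)) + 2 * (X k * (W k)^*%C)) by exact: h.
  by apply/funext => k; rewrite subrK.
have two0 : (2 : R)%:C != 0 :> R[i] by rewrite (rmorph_nat (real_complex R)) pnatr_eq0.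
have pSS : p k * (S k)%:C * (S k)%:C^-1 @[k --> \oo] --> 2 * (x * y^*%C) * (2 : R)%:C^-1.
  by apply: cvgM; [exact: pS|apply: cvgV; [exact: two0|exact: S2C]].
have e2 : 2 * (x * y^*%C) * (2 : R)%:C^-1 = x * y^*%C.
  by rewrite mulrC (rmorph_nat (real_complex R)) mulKf// pnatr_eq0.
rewrite e2 in pSS; apply: cvg_trans pSS; apply: near_eq_cvg; near=> k.
have Sk : 0 < S k by near: k; apply: (cvgr_gt _ S2).
rewrite mulfK//; apply/eqP => /(congr1 (@complex.Re R)) /= e.
by rewrite e ltxx in Sk.
Unshelve. all: by end_near.
Qed.

End complex_limits.

(** * Almost everywhere limit of the evolution along a subsequence *)

Section vpol_limits.
Context {R : realType}.
Variable F : nat -> R[i].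

Definition vdiff n k (z : R[i]) : R :=
  cabs ((vpol F (n + k)).1.[z] - (vpol F n).1.[z]) ^+ 2 +
  cabs ((vpol F (n + k)).2.[z] - (vpol F n).2.[z]) ^+ 2.

(** The increment is the quaternion (A - 1, B) acting on (u, w). Its squared norm is 2 - 2 Re A, and
    that of (u, w) is 2. *)
Lemma vdiffE n k z : cabs z = 1 -> vdiff n k z = 4 - 4 * complex.Re ((block F n k).2.[z]).
Proof.
move=> z1; rewrite /vdiff.
have [-> ->] := vpol_block F n k z1.
have := pnorm_vpol F n z1; have := pnorm_block F n k z1; rewrite /pnorm.
move: (block F n k).1.[z] (block F n k).2.[z] (vpol F n).1.[z] (vpol F n).2.[z] => B A u w AB uw.
transitivity ((cabs (A - 1) ^+ 2 + cabs B ^+ 2) * (cabs u ^+ 2 + cabs w ^+ 2)).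
  by rewrite !cabs_sqrE; case: A B u w {AB uw} => [a1 a2] [b1 b2] [u1 u2] [w1 w2] /=; ring.
rewrite uw; move: AB; rewrite !cabs_sqrE; case: A B => [a1 a2] [b1 b2] /= AB.
by rewrite oppr0 addr0; nra.
Qed.

Lemma rbm_vdiff n k : rbm (fun s : circle R => vdiff n k (cval s)).
Proof.
have b p : bm (fun s : circle R => p.[cval s]) by exact: bm_horner_cval.
have b2 (p q : {poly R[i]}) : bm (fun s : circle R => p.[cval s] - q.[cval s]).
  by under eq_fun do rewrite -hornerN -hornerD; exact: b.
by apply: rbmD; apply: rbm_cabs_sqr.
Qed.

(** The mean of A is its constant coefficient P, a product of normalizations in ]0, 1], and 1 - P <=
    1 - P^2. *)
Lemma rmean_vdiff n k : rmean (fun s => vdiff n k (cval s)) <=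
  4 * \sum_(i < k) cabs (F (n + i).+1) ^+ 2.
Proof.
have [P0 P1 hP] := prod_cfac F n k.
under eq_fun do rewrite vdiffE ?cabs_cval//.
have rA : rbm (fun s : circle R => complex.Re ((block F n k).2.[cval s])).
  exact: (bm_horner_cval (block F n k).2).1.
under eq_fun do rewrite -[4 - _]/(4 + - (4 * _)) -mulNr.
rewrite rmeanD; [|exact: rbm_cst|by apply: rbmM => //; exact: rbm_cst].
rewrite rmeanZ//.
have -> : rmean (fun _ : circle R => 4) = 4 :> R.
  rewrite (_ : (fun=> 4) = (fun s : circle R => 4 * cabs (1%:P : {poly R[i]}).[cval s] ^+ 2)); last first.
    by apply/funext => s; rewrite hornerC ComplexField.Normc.normc1 expr1n mulr1.
  rewrite rmeanZ; last by apply: rbm_cabs_sqr; exact: bm_horner_cval.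
  rewrite (rmean_sqr (N := 1)); last by rewrite size_polyC oner_eq0.
  by rewrite big_ord1 coefC ComplexField.Normc.normc1 expr1n mulr1.
have -> : rmean (fun s => complex.Re ((block F n k).2.[cval s])) = \prod_(i < k) cfac (F (n + i).+1).
  have := cmean_parseval (N := (n + k).+1) (p := (block F n k).2) (q := 1%:P).
  have [_ sA] := block_deg F n k.
  move=> /(_ sA) h; have {h} := h _; rewrite size_polyC oner_eq0 => /(_ isT).
  rewrite big_ord_recl [X in _ * X + _](_ : _ = 1); last by rewrite coefC conjc1.
  rewrite mulr1 big1 ?addr0; last by move=> i _; rewrite [X in _ * X^*%C]coefC conjc0 mulr0.
  rewrite block_coef0 => /(congr1 (@complex.Re R)) /= <-.
  rewrite /cmean /=; congr rmean; apply/funext => s.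
  by rewrite hornerC conjc1 mulr1.
by nra.
Qed.

Variable B : R.
Hypothesis FB : forall n, \sum_(i < n) cabs (F i.+1) ^+ 2 <= B.

Lemma cabs_vpol n z : cabs z = 1 -> cabs (vpol F n).1.[z] <= 2 /\ cabs (vpol F n).2.[z] <= 2.
Proof.
move=> z1; have := pnorm_vpol F n z1; rewrite /pnorm.
have := cabs_ge0 (vpol F n).1.[z]; have := cabs_ge0 (vpol F n).2.[z].
move: (cabs _) (cabs _) => a b a0 b0 e.
by split; nra.
Qed.

(** Square summability makes the mean square increments decay like 4^-i along a sparse enough
    subsequence; weighted by 2^i they still have a finite sum, so almost everywhere the increments
    themselves are summable. *)
Lemma vpol_limit : exists m (uo wo : circle R -> R[i]),
  [/\ {homo m : i j / (i < j)%N}, bm uo, bm wo &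
   {ae arclength R, forall s,
     (vpol F (m i)).1.[cval s] @[i --> \oo] --> uo s /\
     (vpol F (m i)).2.[cval s] @[i --> \oo] --> wo s}].
Proof.
have [m mm mtail] := tail_subsequence (fun i => sqr_ge0 (cabs (F i.+1))) FB.
have ml i : (m i <= m i.+1)%N by apply: ltnW; exact: mm.
pose D i (s : circle R) := 2 ^+ i * vdiff (m i) (m i.+1 - m i) (cval s).
have rD i : rbm (D i) by apply: rbmM; [exact: rbm_cst|exact: rbm_vdiff].
have D0 i s : 0 <= D i s by rewrite mulr_ge0 ?exprn_ge0// addr_ge0// sqr_ge0.
have aeD : {ae arclength R, forall s, cvgn (series (D ^~ s))}.
  (* The i-th weighted mean is at most 2^i * 4 * 4^-i = 4 * 2^-i, and these add up to at most 8. *)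
  apply: (@ae_cvg_series R D 8 rD D0) => n.
  apply: (@le_trans _ _ (\sum_(k < n) 4 * 2^-1 ^+ k)).
    apply: ler_sum => k _; rewrite rmeanZ; last exact: rbm_vdiff.
    have h : rmean (fun s => vdiff (m k) (m k.+1 - m k) (cval s)) <= 4 * 4^-1 ^+ k.
      by apply: (le_trans (rmean_vdiff _ _)); rewrite ler_wpM2l.
    have p : 0 <= 2 ^+ k :> R by rewrite exprn_ge0.
    apply: (le_trans (ler_wpM2l p h)).
    have e4 : 4^-1 ^+ k = 2^-1 ^+ k * 2^-1 ^+ k :> R by rewrite -exprMn; congr (_ ^+ _); field.
    rewrite e4 !exprVn le_eqVlt; apply/orP; left; apply/eqP; field.
    by rewrite expf_neq0.
  rewrite -mulr_sumr.
  have h : (2^-1 - 1) * \sum_(i < n) 2^-1 ^+ i = 2^-1 ^+ n - 1 :> R by rewrite subrX1.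
  have : 0 <= 2^-1 ^+ n :> R by rewrite exprn_ge0.
  by move: h; set S := \sum_(_ < _) _; set x := _ ^+ n; lra.
have conv (g : nat -> circle R -> R) : (forall i s, (g i.+1 s - g i s) ^+ 2 <= vdiff (m i) (m i.+1 - m i) (cval s)) ->
    forall s, cvgn (series (D ^~ s)) -> cvgn (g ^~ s).
  move=> hg s cD; apply: (cvgn_of_diff cD) => i.
  have := hg i s; rewrite /D -(real_normK (num_real (g i.+1 s - g i s))).
  have := normr_ge0 (g i.+1 s - g i s).
  move: (`|_|) (vdiff _ _ _) => x v x0 xv.
  have p2 : 0 < 2 ^+ i :> R by rewrite exprn_gt0.
  rewrite exprVn; set q := 2 ^+ i in p2 *.
  have h1 : q * x ^+ 2 <= q * v by rewrite ler_pM2l.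
  have h2 : 0 <= q^-1 * (q * x - 1) ^+ 2 by rewrite mulr_ge0 ?sqr_ge0// invr_ge0 ltW.
  have h3 : q^-1 * (q * x - 1) ^+ 2 = q * x ^+ 2 - 2 * x + q^-1 by field; rewrite gt_eqF.
  by rewrite h3 in h2; lra.
pose g1 i (s : circle R) := complex.Re (vpol F (m i)).1.[cval s].
pose g2 i (s : circle R) := complex.Im (vpol F (m i)).1.[cval s].
pose g3 i (s : circle R) := complex.Re (vpol F (m i)).2.[cval s].
pose g4 i (s : circle R) := complex.Im (vpol F (m i)).2.[cval s].
have [b1 b2 b3 b4] : [/\ forall i s, `|g1 i s| <= 2, forall i s, `|g2 i s| <= 2,
    forall i s, `|g3 i s| <= 2 & forall i s, `|g4 i s| <= 2].
  have h i s := cabs_vpol (m i) (cabs_cval s).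
  split=> i s; have [h1 h2] := h i s;
    [exact: le_trans (cabs_Re _) h1|exact: le_trans (cabs_Im _) h1|
     exact: le_trans (cabs_Re _) h2|exact: le_trans (cabs_Im _) h2].
have [r1 r2 r3 r4] : [/\ forall i, rbm (g1 i), forall i, rbm (g2 i), forall i, rbm (g3 i) &
    forall i, rbm (g4 i)].
  by split=> i; [exact: (bm_horner_cval _).1|exact: (bm_horner_cval _).2|
    exact: (bm_horner_cval _).1|exact: (bm_horner_cval _).2].
have [U1 rU1 hU1] := limit_function r1 b1.
have [U2 rU2 hU2] := limit_function r2 b2.
have [U3 rU3 hU3] := limit_function r3 b3.
have [U4 rU4 hU4] := limit_function r4 b4.
exists m, (fun s => U1 s +i* U2 s), (fun s => U3 s +i* U4 s); split => //.
have d (i : nat) (s : circle R) :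
  [/\ (g1 i.+1 s - g1 i s) ^+ 2 <= vdiff (m i) (m i.+1 - m i) (cval s),
      (g2 i.+1 s - g2 i s) ^+ 2 <= vdiff (m i) (m i.+1 - m i) (cval s),
      (g3 i.+1 s - g3 i s) ^+ 2 <= vdiff (m i) (m i.+1 - m i) (cval s) &
      (g4 i.+1 s - g4 i s) ^+ 2 <= vdiff (m i) (m i.+1 - m i) (cval s)].
  rewrite /vdiff subnKC// /g1 /g2 /g3 /g4 -!Re_sub -!Im_sub !cabs_sqrE.
  move: (complex.Re (_ - _)) (complex.Im (_ - _)) (complex.Re (_ - _)) (complex.Im (_ - _)) => x1 x2 x3 x4.
  by split; have := sqr_ge0 x1; have := sqr_ge0 x2; have := sqr_ge0 x3; have := sqr_ge0 x4; lra.
apply: filterS aeD => s cD.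
have C g (U : circle R -> R) : (forall s l, g i s @[i --> \oo] --> l -> U s = l) ->
    (forall i s, (g i.+1 s - g i s) ^+ 2 <= vdiff (m i) (m i.+1 - m i) (cval s)) ->
    g i s @[i --> \oo] --> U s.
  move=> hU hd; have /cvg_ex[l hl] := conv g hd s cD.
  by rewrite (hU s l hl).
split; apply: cvg_complex => /=.
- by apply: (C g1) => // i t; have [] := d i t.
- by apply: (C g2) => // i t; have [] := d i t.
- by apply: (C g3) => // i t; have [] := d i t.
- by apply: (C g4) => // i t; have [] := d i t.
Qed.

End vpol_limits.

Lemma homo_ltn_ge (m : nat -> nat) : {homo m : i j / (i < j)%N} -> forall i, (i <= m i)%N.
Proof. by move=> mm; elim=> // i IH; exact: leq_ltn_trans IH (mm _ _ _). Qed.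

Lemma homo_ltn_cvgny (m : nat -> nat) : {homo m : i j / (i < j)%N} -> m i @[i --> \oo] --> \oo.
Proof.
move=> mm; apply/cvgnyPge => A; near=> i.
by apply: leq_trans (homo_ltn_ge mm i); near: i; exact: nbhs_infty_ge.
Unshelve. all: by end_near.
Qed.

(** * The product estimate in the limit *)

Section limits.
Context {R : realType}.

Lemma fconv_cvg n s (h : nat -> circle R -> R[i]) (H : circle R -> R[i]) (M : R) :
  (forall i, bm (h i)) -> bm H -> (forall i t, cabs (h i t) <= M) ->
  {ae arclength R, forall t, h i t @[i --> \oo] --> H t} ->
  fconv n (h i) s @[i --> \oo] --> fconv n H s.
Proof.
move=> bh bH hM hH; rewrite fconvE; under eq_fun do rewrite fconvE.
have M0 : 0 <= M by apply: le_trans (cabs_ge0 _) (hM 0%N s).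
have K (g : R[i] -> R) : (forall i, rbm (fun t => g (h i t))) -> rbm (fun t => g (H t)) ->
    (forall z, `|g z| <= cabs z) -> (forall (z : nat -> R[i]) l, z i @[i --> \oo] --> l ->
      g (z i) @[i --> \oo] --> g l) ->
    rconv n (fun t => g (h i t)) s @[i --> \oo] --> rconv n (fun t => g (H t)) s.
  move=> r1 r2 gb gc; apply: (@rmean_cvg R _ _ (n%:R * M)).
  - by move=> i; apply: rbmM; [exact: rbm_cfejer|exact: r1].
  - by apply: rbmM; [exact: rbm_cfejer|exact: r2].
  - move=> i t; rewrite normrM; apply: ler_pM => //.
      by rewrite ger0_norm ?cfejer_le// fejer_ge0.
    exact: le_trans (gb _) (hM i t).
  - apply: filterS hH => t ht; apply: cvgM; [exact: cvg_cst|exact: gc].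
apply: cvg_complex => /=.
- apply: (K (@complex.Re R)).
  + by move=> i; have [] := bh i.
  + by have [] := bH.
  + exact: cabs_Re.
  + by move=> z l; exact: cvg_Re.
- apply: (K (@complex.Im R)).
  + by move=> i; have [] := bh i.
  + by have [] := bH.
  + exact: cabs_Im.
  + by move=> z l; exact: cvg_Im.
Qed.

Lemma fconv_ae (H : circle R -> R[i]) (m : nat -> nat) : bm H -> {homo m : i j / (i < j)%N} ->
  {ae arclength R, forall s, fconv (m i) H s @[i --> \oo] --> H s}.
Proof.
move=> [H1 H2] mm.
have mo := homo_ltn_cvgny mm.
apply: filterS2 (rconv_ae H1) (rconv_ae H2) => s c1 c2.
under eq_fun do rewrite fconvE.
apply: cvg_complex => /=; [exact: (cvg_comp _ _ mo c1)|exact: (cvg_comp _ _ mo c2)].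
Qed.

Variable F : nat -> R[i].
Variables (m : nat -> nat) (uo wo : circle R -> R[i]).
Hypotheses (mm : {homo m : i j / (i < j)%N}) (buo : bm uo) (bwo : bm wo).
Hypothesis mlim : {ae arclength R, forall s,
     (vpol F (m i)).1.[cval s] @[i --> \oo] --> uo s /\
     (vpol F (m i)).2.[cval s] @[i --> \oo] --> wo s}.

Lemma pnorm_limit : {ae arclength R, forall s, cabs (uo s) ^+ 2 + cabs (wo s) ^+ 2 = 2}.
Proof.
apply: filterS mlim => s [c1 c2].
have : cabs (vpol F (m i)).1.[cval s] ^+ 2 + cabs (vpol F (m i)).2.[cval s] ^+ 2
    @[i --> \oo] --> cabs (uo s) ^+ 2 + cabs (wo s) ^+ 2.
  by apply: cvgD; [exact: (cvg_cabs_sqr c1)|exact: (cvg_cabs_sqr c2)].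
rewrite (_ : (fun i => _) = fun=> 2); last first.
  by apply/funext => i; exact: pnorm_vpol (cabs_cval s).
by move/(cvg_lim (@Rhausdorff R)) <-; rewrite lim_cst.
Qed.

(** Letting m tend to infinity at fixed n: the number of roots of unity grows with m, but by
    [vosc_osc] the right-hand side does not change, and the means on the left are integrals
    converging by domination. *)
Lemma product_estimate_limit n s : (0 < n)%N ->
  cabs ((vpol F n).1.[cval s] * ((vpol F n).2.[cval s])^*%C *
      (cabs (fconv n uo s) ^+ 2 + cabs (fconv n wo s) ^+ 2)%:C -
    2 * (fconv n uo s * (fconv n wo s)^*%C)) <= 40 * Num.sqrt (osc F n (cval s)).
Proof.
move=> n0.
have mi := homo_ltn_ge mm.
pose X i := fconv n (fun t => (vpol F (m i)).1.[cval t]) s.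
pose W i := fconv n (fun t => (vpol F (m i)).2.[cval t]) s.
set p := _ * _^*%C.
have est i : (n <= i)%N -> cabs (p * (cabs (X i) ^+ 2 + cabs (W i) ^+ 2)%:C -
    2 * (X i * (W i)^*%C)) <= 40 * Num.sqrt (osc F n (cval s)).
  move=> ni; have nm := leq_trans ni (mi i).
  have N0 : (0 < (n + m i).+1)%N by [].
  have [om omP] := @complex_prim_root R _ N0.
  have nN : (n + n + (m i - n) < (n + m i).+1)%N by rewrite -addnA subnKC.
  have := product_estimate F n0 omP nN (cabs_cval s) => /=.
  rewrite (vosc_osc F _ omP) ?ltnS ?leq_add2l// subnKC//.
  have [s1 s2] := vpol_deg F (m i).
  have e1 : (n + size (vpol F (m i)).1 <= (n + m i).+1)%N by rewrite -addnS leq_add2l.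
  have e2 : (n + size (vpol F (m i)).2 <= (n + m i).+1)%N by rewrite -addnS leq_add2l.
  by rewrite -(fconv_poly s N0 omP e1) -(fconv_poly s N0 omP e2).
have b2 (q : nat -> {poly R[i]}) i : bm (fun t : circle R => (q i).[cval t]).
  exact: bm_horner_cval.
have h1 i (t : circle R) : cabs (vpol F (m i)).1.[cval t] <= 2.
  by have [] := cabs_vpol F (m i) (cabs_cval t).
have h2 i (t : circle R) : cabs (vpol F (m i)).2.[cval t] <= 2.
  by have [] := cabs_vpol F (m i) (cabs_cval t).
have cX : X i @[i --> \oo] --> fconv n uo s.
  have h : {ae arclength R, forall t, (vpol F (m i)).1.[cval t] @[i --> \oo] --> uo t}.
    by apply: filterS mlim => t [c _]; exact: c.
  exact: (fconv_cvg (b2 (fun i => (vpol F (m i)).1)) buo h1 h).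
have cW : W i @[i --> \oo] --> fconv n wo s.
  have h : {ae arclength R, forall t, (vpol F (m i)).2.[cval t] @[i --> \oo] --> wo t}.
    by apply: filterS mlim => t [_ c]; exact: c.
  exact: (fconv_cvg (b2 (fun i => (vpol F (m i)).2)) bwo h2 h).
have c1 : (cabs (X i) ^+ 2 + cabs (W i) ^+ 2)%:C @[i --> \oo] -->
    (cabs (fconv n uo s) ^+ 2 + cabs (fconv n wo s) ^+ 2)%:C.
  by apply: cvg_realC; apply: cvgD; [exact: (cvg_cabs_sqr cX)|exact: (cvg_cabs_sqr cW)].
have c2 : X i * (W i)^*%C @[i --> \oo] --> fconv n uo s * (fconv n wo s)^*%C.
  by apply: cvgM; [exact: cX|exact: cvg_conj].
have c3 : p * (cabs (X i) ^+ 2 + cabs (W i) ^+ 2)%:C @[i --> \oo] -->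
    p * (cabs (fconv n uo s) ^+ 2 + cabs (fconv n wo s) ^+ 2)%:C.
  by apply: cvgM; [exact: cvg_cst|exact: c1].
have c4 : 2 * (X i * (W i)^*%C) @[i --> \oo] --> 2 * (fconv n uo s * (fconv n wo s)^*%C).
  by apply: cvgM; [exact: cvg_cst|exact: c2].
have c5 : cabs (p * (cabs (X i) ^+ 2 + cabs (W i) ^+ 2)%:C - 2 * (X i * (W i)^*%C)) @[i --> \oo] -->
    cabs (p * (cabs (fconv n uo s) ^+ 2 + cabs (fconv n wo s) ^+ 2)%:C
      - 2 * (fconv n uo s * (fconv n wo s)^*%C)).
  by apply: cvg_cabs; exact: (cvgB c3 c4).
rewrite -(cvg_lim (@Rhausdorff R) c5); apply: limr_le; first by apply/cvg_ex; eexists; exact: c5.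
near=> i; apply: est; near: i; exact: nbhs_infty_ge.
Unshelve. all: by end_near.
Qed.

Variable B : R.
Hypothesis FB : forall n, \sum_(i < n) cabs (F i.+1) ^+ 2 <= B.

Lemma vpol_product_ae_cvg nk : lacunary R nk ->
  {ae arclength R, forall s, (vpol F (nk k)).1.[cval s] * ((vpol F (nk k)).2.[cval s])^*%C
    @[k --> \oo] --> uo s * (wo s)^*%C}.
Proof.
move=> lnk; have [nkm _] := lnk.
have := fconv_ae buo nkm; have := fconv_ae bwo nkm.
move=> cw cu; have co := osc_ae_cvg0 FB lnk.
apply: filterS (filterI (filterI cw cu) (filterI co pnorm_limit)) => s [[{}cw {}cu] [{}co uw1]].
(* Dropping the first index makes every order positive, as the product estimate requires. *)
rewrite -cvg_shiftS in cw; rewrite -cvg_shiftS in cu; rewrite -cvg_shiftS in co.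
rewrite -cvg_shiftS; apply: (product_limit _ co cu cw uw1) => k.
by apply: product_estimate_limit; exact: leq_ltn_trans (nkm k k.+1 (ltnSn k)).
Qed.

End limits.

(** * Identification of the limit *)

Section measurability.
Context d (T : measurableType d) {R : realType}.

Lemma measurable_cabs (h : T -> R[i]) :
  measurable_fun setT (fun x => complex.Re (h x)) ->
  measurable_fun setT (fun x => complex.Im (h x)) ->
  measurable_fun setT (fun x => cabs (h x)).
Proof.
move=> h1 h2.
have -> : (fun x => cabs (h x)) =
    Num.sqrt \o (fun x => complex.Re (h x) ^+ 2 + complex.Im (h x) ^+ 2).
  by apply/funext => x /=; case: (h x).
apply: measurableT_comp.
  by apply: continuous_measurable_fun; exact: sqrt_continuous.
by apply: measurable_funD; apply: measurable_funX.
Qed.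

Lemma measurable_complex_inv (h : T -> R[i]) :
  measurable_fun setT (fun x => complex.Re (h x)) ->
  measurable_fun setT (fun x => complex.Im (h x)) ->
  measurable_fun setT (fun x => complex.Re (h x)^-1) /\
  measurable_fun setT (fun x => complex.Im (h x)^-1).
Proof.
move=> h1 h2.
(* On nonnegative reals the power of exponent -1 is the inverse, also at 0 where both are 0; so
   zeros of [h] need no separate treatment. *)
pose n x := (complex.Re (h x) ^+ 2 + complex.Im (h x) ^+ 2) `^ (-1).
have mn : measurable_fun setT n.
  apply: (measurableT_comp (measurable_powR (-1))).
  by apply: measurable_funD; apply: measurable_funX.
have e1 : (fun x => complex.Re (h x)^-1) = (fun x => complex.Re (h x) * n x).
  apply/funext => x; rewrite /n powR_inv1 ?addr_ge0 ?sqr_ge0//.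
  by case: (h x).
have e2 : (fun x => complex.Im (h x)^-1) = (fun x => - complex.Im (h x) * n x).
  apply/funext => x; rewrite /n powR_inv1 ?addr_ge0 ?sqr_ge0//.
  by case: (h x) => a b /=; rewrite mulNr.
rewrite e1 e2; split; apply: measurable_funM => //.
exact: measurableT_comp.
Qed.

End measurability.

Section fatou.
Context d (T : measurableType d) {R : realType} (nu : {measure set T -> \bar R}).

(** By Fatou's lemma the lower limit, nonnegative everywhere, has integral 0; it vanishes almost
    everywhere and agrees there with [g]. *)
Lemma ae_cvg_eq0 (f : nat -> T -> R) (g : T -> R) :
  (forall i, measurable_fun setT (f i)) -> measurable_fun setT g -> (forall i x, 0 <= f i x) ->
  (\int[nu]_x (f i x)%:E)%E @[i --> \oo] --> 0%E ->
  {ae nu, forall x, f i x @[i --> \oo] --> g x} -> {ae nu, forall x, g x = 0}.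
Proof.
move=> mf mg f0 f_cvg fg.
pose u i x := (f i x)%:E.
have mu i : measurable_fun setT (u i) by apply/measurable_EFinP; exact: mf.
have u0 i x : (0 <= u i x)%E by rewrite lee_fin f0.
have := fatou nu measurableT mu (fun i x _ => u0 i x).
rewrite (cvg_limn_einf_sup f_cvg).1 => le0.
have ug : {ae nu, forall x, limn_einf (u ^~ x) = (g x)%:E}.
  apply: filterS fg => x fgx; apply: (cvg_limn_einf_sup _).1.
  by apply: cvg_EFin; [exact: nearW|exact: fgx].
have mlim : measurable_fun setT (fun x => limn_einf (u ^~ x)).
  have -> : (fun x => limn_einf (u ^~ x)) = (fun x => - limn_esup ((fun i x => - u i x) ^~ x))%E.
    apply/funext => x; rewrite -limn_einfN; congr limn_einf.
    by apply/funext => i /=; rewrite opprK.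
  apply: measurableT_comp => //; apply: measurable_fun_limn_esup => i.
  exact: measurableT_comp.
have lim0 x : (0 <= limn_einf (u ^~ x))%E.
  rewrite limn_einf_lim; apply: lime_ge; first exact: is_cvg_einfs.
  by apply: nearW => n; apply: le_ereal_inf_tmp => _ [k /= _ <-].
have int0 : (\int[nu]_x `|limn_einf (u ^~ x)| = 0)%E.
  apply/eqP; rewrite eq_le; apply/andP; split; last by apply: integral_ge0 => x _; exact: abse_ge0.
  by under eq_integral do rewrite gee0_abs//.
have := (ae_eq_integral_abs nu measurableT mlim).1 int0.
by apply: filterS2 ug => x -> /(_ I) [].
Qed.

End fatou.

Lemma nneseries_bound {R : realType} (f : nat -> R) : (forall i, 0 <= f i) ->
  (\sum_(1 <= i <oo) (f i)%:E < +oo)%E ->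
  forall n, \sum_(i < n) f i.+1 <= fine (\sum_(1 <= i <oo) (f i)%:E)%E.
Proof.
move=> f0 foo n.
have fin : (\sum_(1 <= i <oo) (f i)%:E)%E \is a fin_num.
  by rewrite ge0_fin_numE// nneseries_ge0// => i _ _; rewrite lee_fin.
rewrite -lee_fin fineK// -sumEFin.
have := @nneseries_lim_ge R (fun i => (f i)%:E) xpredT 1%N n.+1.
rewrite big_add1 /= big_mkord; apply => i _ _; rewrite lee_fin; exact: f0.
Qed.

Lemma measurable_density {R : realType} (mu : circle_measure R) (w : circle R -> R[i]) :
  ac_density mu (arclength R) (fun s => w s / (2 * pi)%:C) ->
  measurable_fun setT (fun s => complex.Re (w s)) /\
  measurable_fun setT (fun s => complex.Im (w s)).
Proof.
move=> [mac [msing [_ [/measurable_int/measurable_EFinP m1 /measurable_int/measurable_EFinP m2 _]]]].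
have p0 : (2 * pi)%:C != 0 :> R[i] by rewrite fmorph_eq0 gt_eqF// pi2_gt0.
have e s : w s = (2 * pi)%:C * (w s / (2 * pi)%:C) by rewrite mulrC divfK.
split.
- under eq_fun do rewrite e Re_real.
  by apply: measurable_funM.
- under eq_fun do rewrite e Im_real.
  by apply: measurable_funM.
Qed.

Theorem theorem4 (R : realType) (mu : circle_measure R) (w : circle R -> R[i])
  (mu_Tminus : class_Tminus mu)
  (w_density : ac_density mu (arclength R) (fun s => w s / (2 * pi)%:C))
  (phi_cvg : (\int[arclength R]_s
      (cabs (star (horner (phi mu n)) (cval s) * (tphi mu n).[cval s] - ((w s)^*%C)^-1)
        / (2 * pi))%:E)%E @[n --> \oo] --> 0%E)
  (F_l2 : (\sum_(1 <= n <oo) ((cabs (Fcoef mu n)) ^+ 2)%:E < +oo)%E)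
  (nk : nat -> nat) (nk_lacunary : lacunary R nk) :
  {ae arclength R, forall s : circle R,
    (star (horner (phi mu (nk k))) (cval s) * (tphi mu (nk k)).[cval s]) ^+ 2
      @[k --> \oo] --> ((w s) ^- 2)^*%C}.
Proof.
have [hT hF] := mu_Tminus.
have FB := nneseries_bound (fun i => sqr_ge0 (cabs (Fcoef mu i))) F_l2.
(* The subsequence [m] depends on F and not on [nk]. The same limit uo conj(wo) governs the products
   along [nk], while its distance to 1 / conj(w) is tested along [m]. *)
have [m [uo [wo [mm buo bwo mlim]]]] := vpol_limit FB.
have lim := vpol_product_ae_cvg mm buo bwo mlim FB nk_lacunary.
have [w1 w2] := measurable_density w_density.
pose prod n (s : circle R) := star (horner (phi mu n)) (cval s) * (tphi mu n).[cval s].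
have prodE n s : prod n s = (vpol (Fcoef mu) n).1.[cval s] * ((vpol (Fcoef mu) n).2.[cval s])^*%C.
  exact: phi_vpol.
pose dist (h : circle R -> R[i]) s := cabs (h s - ((w s)^*%C)^-1) / (2 * pi).
have mdist h : bm h -> measurable_fun setT (dist h).
  move=> [[h1 _] [h2 _]].
  have [v1 v2] : measurable_fun setT (fun s => complex.Re ((w s)^*%C)^-1) /\
      measurable_fun setT (fun s => complex.Im ((w s)^*%C)^-1).
    apply: measurable_complex_inv.
      by rewrite (_ : (fun s => _) = fun s => complex.Re (w s))//; apply/funext => s; case: (w s).
    rewrite (_ : (fun s => _) = fun s => - complex.Im (w s)); last by apply/funext => s; case: (w s).
    exact: measurableT_comp.
  apply: measurable_funM => //; apply: measurable_cabs.
    by under eq_fun do rewrite Re_sub; apply: measurable_funB.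
  by under eq_fun do rewrite Im_sub; apply: measurable_funB.
have bprod n : bm (prod n).
  rewrite (_ : prod n = fun s => (vpol (Fcoef mu) n).1.[cval s] * ((vpol (Fcoef mu) n).2.[cval s])^*%C).
    exact: bm_hornerJ.
  by apply/funext => s; exact: prodE.
have blim : bm (fun s => uo s * (wo s)^*%C) by apply: bmM => //; exact: bmJ.
have moo := homo_ltn_cvgny mm.
(* The L^1 convergence restricts to [m], where the products converge almost everywhere. *)
have wlim : {ae arclength R, forall s, dist (fun s => uo s * (wo s)^*%C) s = 0}.
  apply: (ae_cvg_eq0 (f := fun i => dist (prod (m i)))).
  - by move=> i; exact: mdist.
  - exact: mdist.
  - by move=> i s; rewrite divr_ge0 ?cabs_ge0// ltW// pi2_gt0.
  - exact: (cvg_comp _ _ moo phi_cvg).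
  - apply: filterS mlim => s [c1 c2].
    have c3 : prod (m i) s @[i --> \oo] --> uo s * (wo s)^*%C.
      under eq_fun do rewrite prodE.
      by apply: cvgM; [exact: c1|exact: cvg_conj].
    have c4 : prod (m i) s - ((w s)^*%C)^-1 @[i --> \oo] --> uo s * (wo s)^*%C - ((w s)^*%C)^-1.
      by apply: cvgB; [exact: c3|exact: cvg_cst].
    by apply: cvgM; [exact: (cvg_cabs c4)|exact: cvg_cst].
apply: filterS (filterI wlim lim) => s [w0 ls].
have ew : uo s * (wo s)^*%C = ((w s)^*%C)^-1.
  apply/eqP; rewrite -subr_eq0; apply/eqP/ComplexField.Normc.eq0_normc.
  by move/eqP: w0; rewrite mulf_eq0 invr_eq0 [X in _ || X]gt_eqF ?pi2_gt0// orbF => /eqP.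
have -> : ((w s) ^- 2)^*%C = uo s * (wo s)^*%C * (uo s * (wo s)^*%C).
  by rewrite ew -expr2 exprVn conjc_inv rmorphXn.
have c1 : prod (nk k) s @[k --> \oo] --> uo s * (wo s)^*%C.
  by under eq_fun do rewrite prodE; exact: ls.
rewrite [X in X @ _](_ : _ = fun k => prod (nk k) s * prod (nk k) s).
  by apply: cvgM; exact: c1.
by apply/funext => k; rewrite expr2.
Qed.
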